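(* Let $(A,\mathfrak m)$ be a non-regular Gorenstein local ring of dimension $d\ge 1$ whose residue field $k=A/\mathfrak m$ is uncountable. Let $N$ be a perfect $A$-module of dimension $t\ge 1$ and let $I$ be an ideal of definition of $N$. Let $M$ be a non-free maximal Cohen-Macaulay $A$-module which is also a test module. Then there exist infinitely many integers $i\ge 1$ such that $r_i^{I,N}(M)=r_1^{I,N}(\Omega^dk)$.
   Context: All rings are commutative Noetherian and all modules are finitely generated. $\lambda(-)$ denotes length. Over a Cohen-Macaulay local ring, a non-zero module $N$ is perfect if and only if it is Cohen-Macaulay of finite projective dimension. An ideal of definition of $N$ is an ideal $I\subseteq\mathfrak m$ with $\lambda(N/IN)<\infty$. An $A$-module $U$ is a test module if every $A$-module $V$ with $\operatorname{Tor}_i^A(U,V)=0$ for all $i\gg0$ has finite projective dimension. $\Omega^d k$ is the $d$-th syzygy of $k$ in a minimal free resolution (a maximal Cohen-Macaulay module). For a maximal Cohen-Macaulay $A$-module $M$ and $i\ge 1$, the function $n\mapsto\lambda(\operatorname{Tor}_i^A(M,N/I^nN))$ is known to agree with a polynomial for $n\gg0$; $r_i^{I,N}(M)$ denotes its degree. The zero polynomial has degree $-1$. *)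

(* Defs.v *)
From HB Require Import structures.
From mathcomp Require Import all_boot all_order all_algebra.
From mathcomp Require Import boolp classical_sets functions cardinality.

Set Implicit Arguments.
Unset Strict Implicit.
Unset Printing Implicit Defensive.

Import GRing.Theory.

Local Open Scope classical_set_scope.
Local Open Scope ring_scope.

(* Modules over [A] are arbitrary [lmodType A]; finite generation is a separate
   hypothesis.  A submodule is a [submodClosed V]; an ideal is a
   [submodClosed A^o], or an [idealr A] when it has to be proper. *)

Section Submodules.
Variable A : comNzRingType.
Implicit Types V : lmodType A.

Definition span_pred V (S : set V) : pred V := fun x =>
  `[< exists n (c : 'I_n -> A) (e : 'I_n -> V),
        (forall i, S (e i)) /\ x = \sum_(i < n) c i *: e i >].

Fact span_closed V (S : set V) : submod_closed (span_pred S).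
Proof.
split; first by apply/asboolP; exists 0%N, (fun=> 0), (fun=> 0); split=> [[]|];
  rewrite ?big_ord0.
move=> a u v /asboolP[n [c [e [Se ->]]]] /asboolP[p [c' [e' [Se' ->]]]].
apply/asboolP; exists (n + p)%N.
exists (fun i : 'I_(n + p) =>
  match fintype.split i with inl j => a * c j | inr j => c' j end).
exists (fun i : 'I_(n + p) =>
  match fintype.split i with inl j => e j | inr j => e' j end).
split=> [i|]; first by case: (fintype.split i).
rewrite big_split_ord scaler_sumr /=; congr (_ + _); apply: eq_bigr => i _.
  by rewrite -[lshift p i]/(unsplit (inl i)) unsplitK scalerA.
by rewrite -[rshift n i]/(unsplit (inr i)) unsplitK.
Qed.
HB.instance Definition _ V (S : set V) :=
  GRing.isSubmodClosed.Build A V (span_pred S) (span_closed S).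

Definition span V (S : set V) : submodClosed V :=
  GRing.SubmodClosed.clone A V (span_pred S) _.

(* [J W]; [J] may be any set of scalars, in particular the entries of a
   sequence, in which case this is the submodule [(x_1, ..., x_r) W]. *)
Definition smul V (J : {pred A}) (W : {pred V}) : submodClosed V :=
  span [set v | exists a w, [/\ a \in J, w \in W & v = a *: w]].

Fixpoint ideal_pow (J : {pred A}) (n : nat) : submodClosed A^o :=
  if n is n'.+1 then smul J (ideal_pow J n') else span [set: A^o].

Definition pow_smul V (J : {pred A}) (n : nat) : submodClosed V :=
  smul (ideal_pow J n) (predT : {pred V}).

Definition annihilator V : {pred A} := fun a => `[< forall x : V, a *: x = 0 >].

(* A [submodClosed] variable carries no [zmodClosed] structure, and an
   [idealr A] no [submodClosed] one; the two wrappers below provide them. *)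
Definition submod_pred V (W : submodClosed V) : pred V := fun x => x \in W.
Fact submod_pred_closed V (W : submodClosed V) : submod_closed (submod_pred W).
Proof. exact: submodClosedP. Qed.
HB.instance Definition _ V (W : submodClosed V) :=
  GRing.isSubmodClosed.Build A V (submod_pred W) (submod_pred_closed W).

Definition ideal_pred (J : idealr A) : pred A^o := fun x => x \in J.
Fact ideal_pred_closed (J : idealr A) : submod_closed (ideal_pred J).
Proof.
split; first exact: (idealr0 J).
by move=> a u v Ju Jv; apply: (rpredD (idealMr a Ju) Jv).
Qed.
HB.instance Definition _ (J : idealr A) :=
  GRing.isSubmodClosed.Build A A^o (ideal_pred J) (ideal_pred_closed J).

Definition submod V (W : submodClosed V) := {x : V | x \in submod_pred W}.
HB.instance Definition _ V (W : submodClosed V) := SubChoice.on (submod W).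
HB.instance Definition _ V (W : submodClosed V) :=
  GRing.SubChoice_isSubLmodule.Build A V _ (submod W)
    (submod_pred_closed W).

End Submodules.

Section QuotientModule.
Local Open Scope quotient_scope.
Variables (A : comNzRingType) (V : lmodType A) (W : submodClosed V).

Definition quotmod : Type :=
  Quotient.quot (GRing.ZmodClosed.clone V (submod_pred W) _).
HB.instance Definition _ := GRing.Zmodule.on quotmod.
HB.instance Definition _ := Quotient.on quotmod.

Lemma quotmod_eqP (x y : V) :
  reflect (\pi_quotmod x = \pi_quotmod y) (x - y \in W).
Proof. exact: (@eqmodP _ (Quotient.equiv_equiv _) x y). Qed.

Lemma quotmod_piD : {morph \pi_quotmod : x y / x + y}.
Proof. exact: Quotient.pi_add. Qed.

Definition quot_scale (a : A) (x : quotmod) : quotmod :=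
  \pi_quotmod (a *: repr x).

Lemma quotmod_piZ a x : \pi_quotmod (a *: x) = quot_scale a (\pi_quotmod x).
Proof.
apply/quotmod_eqP; rewrite -scalerBr; apply: rpredZ.
by apply/quotmod_eqP; rewrite reprK.
Qed.

Fact quot_scaleA a b x :
  quot_scale a (quot_scale b x) = quot_scale (a * b) x.
Proof. by rewrite -[x]reprK -!quotmod_piZ scalerA reprK. Qed.
Fact quot_scale1 : left_id 1 quot_scale.
Proof. by move=> x; rewrite -[x]reprK -quotmod_piZ scale1r. Qed.
Fact quot_scaleDr : right_distributive quot_scale +%R.
Proof.
move=> a x y; rewrite -[x]reprK -[y]reprK -quotmod_piD -!quotmod_piZ.
by rewrite scalerDr quotmod_piD.
Qed.
Fact quot_scaleDl x : {morph quot_scale^~ x : a b / a + b}.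
Proof.
by move=> a b; rewrite /= -[x]reprK -!quotmod_piZ scalerDl quotmod_piD.
Qed.
HB.instance Definition _ := GRing.Zmodule_isLmodule.Build A quotmod
  quot_scaleA quot_scale1 quot_scaleDr quot_scaleDl.

End QuotientModule.

Section Homological.
Variable A : comNzRingType.
Implicit Types (V N U : lmodType A) (J : {pred A}).

Definition fin_gen V := exists n (e : 'I_n -> V), forall x, x \in span (range e).

Definition noetherian := forall J : submodClosed A^o,
  exists n (e : 'I_n -> A^o), J =i span (range e).

Definition is_maximal (m : idealr A) := forall J : idealr A,
  {subset m <= J} -> {subset J <= m}.

Definition is_local (m : idealr A) :=
  is_maximal m /\ forall m' : idealr A, is_maximal m' -> m' =i m.

Definition residue_module (m : idealr A) : lmodType A :=
  quotmod (GRing.SubmodClosed.clone A A^o (ideal_pred m) _).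

(* The supremum of the lengths of the chains of submodules of [V] is [l]. *)
Definition submod_chain V (l : nat) (c : nat -> submodClosed V) :=
  forall i, (i < l)%N -> {subset c i <= c i.+1} /\ ~ {subset c i.+1 <= c i}.

Definition has_length V (l : nat) :=
  (exists c, @submod_chain V l c) /\ ~ (exists c, @submod_chain V l.+1 c).

(* Krull dimension of [V]: chains of primes containing the annihilator. *)
Definition prime_chain V (l : nat) (c : nat -> prime_idealr A) :=
  {subset annihilator V <= c 0%N} /\
  forall i, (i < l)%N -> {subset c i <= c i.+1} /\ ~ {subset c i.+1 <= c i}.

Definition has_dim V (t : nat) :=
  (exists c, prime_chain V t c) /\ ~ (exists c, prime_chain V t.+1 c).

Definition regular_local (m : idealr A) := exists n, has_dim A^o n /\
  exists e : 'I_n -> A^o, m =i span (range e).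

Definition regular_seq V (s : seq A) :=
  (forall i, (i < size s)%N -> forall x : V,
     s`_i *: x \in smul (mem (take i s)) (predT : {pred V}) ->
     x \in smul (mem (take i s)) (predT : {pred V})) /\
  exists x : V, x \notin smul (mem s) (predT : {pred V}).

Definition has_grade J V (n : nat) :=
  (exists s, [/\ size s = n, {subset s <= J} & regular_seq V s]) /\
  ~ (exists s, [/\ size s = n.+1, {subset s <= J} & regular_seq V s]).

Definition cohen_macaulay (m : idealr A) V :=
  exists n, has_grade m V n /\ has_dim V n.

Definition max_cohen_macaulay (m : idealr A) V :=
  exists n, [/\ has_grade m V n, has_dim V n & has_dim A^o n].

Definition is_free V := exists n (f : {linear 'rV[A]_n -> V}), bijective f.

Definition is_projective (P : lmodType A) :=
  forall (X Y : lmodType A) (g : {linear X -> Y}) (f : {linear P -> Y}),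
    (forall y, exists x, g x = y) ->
  exists h : {linear P -> X}, forall p, g (h p) = f p.

Definition is_injective (E : lmodType A) :=
  forall (X Y : lmodType A) (g : {linear X -> Y}) (f : {linear X -> E}),
    injective g ->
  exists h : {linear Y -> E}, forall x, h (g x) = f x.

Definition pd_le V (n : nat) :=
  exists (P : nat -> lmodType A) (d : forall i, {linear P i.+1 -> P i})
         (e : {linear P 0%N -> V}),
    [/\ forall i, is_projective (P i),
        forall v, exists x, e x = v,
        forall x, e x = 0 <-> exists y, d 0%N y = x,
        forall i x, d i x = 0 <-> exists y, d i.+1 y = x
      & forall i, (n < i)%N -> forall x : P i, x = 0].

Definition finite_pd V := exists n, pd_le V n.

Definition has_pd V (n : nat) := pd_le V n /\ forall i, (i < n)%N -> ~ pd_le V i.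

Definition finite_injdim V :=
  exists (n : nat) (E : nat -> lmodType A)
         (d : forall i, {linear E i -> E i.+1}) (e : {linear V -> E 0%N}),
    [/\ forall i, is_injective (E i),
        injective e,
        forall x, d 0%N x = 0 <-> exists v, e v = x,
        forall i x, d i.+1 x = 0 <-> exists y, d i y = x
      & forall i, (n < i)%N -> forall x : E i, x = 0].

Definition gorenstein := finite_injdim A^o.

(* Perfect: non-zero, with projective dimension equal to the grade, i.e. to
   the maximal length of an A-regular sequence in the annihilator. *)
Definition perfect V := (exists x : V, x != 0) /\
  exists g, has_grade (annihilator V) A^o g /\ has_pd V g.

(* Resolutions by free modules of finite rank; the differential
   F_{i+1} -> F_i is [x |-> x *m diff i]. *)
Record free_resolution U := FreeResolution {
  rk : nat -> nat;
  diff : forall i, 'M[A]_(rk i.+1, rk i);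
  aug : {linear 'rV[A]_(rk 0%N) -> U};
  aug_surj : forall u, exists x, aug x = u;
  aug_exact : forall x, aug x = 0 <-> exists y, x = y *m diff 0%N;
  diff_exact : forall i (x : 'rV[A]_(rk i.+1)), x *m diff i = 0 <-> exists y, x = y *m diff i.+1
}.

Definition minimal_resolution (m : idealr A) U (F : free_resolution U) :=
  forall i j k, diff F i j k \in m.

(* [A^p (x) V] is identified with [V^p]: [D (x) V] is then the right action of
   the matrix [D] on row vectors with entries in [V]. *)
Definition tensor_mx V p q (D : 'M[A]_(p, q)) (v : {ffun 'I_p -> V}) :
    {ffun 'I_q -> V} :=
  [ffun k => \sum_(j < p) D j k *: v j].

Fact tensor_mx_linear V p q (D : 'M[A]_(p, q)) : linear (@tensor_mx V p q D).
Proof.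
move=> a u v; apply/ffunP => k; rewrite !ffunE scaler_sumr -big_split /=.
apply: eq_bigr => j _.
by rewrite !ffunE scalerDr !scalerA mulrC.
Qed.
HB.instance Definition _ V p q (D : 'M[A]_(p, q)) :=
  GRing.isLinear.Build A {ffun 'I_p -> V} {ffun 'I_q -> V} *:%R
    (@tensor_mx V p q D) (@tensor_mx_linear V p q D).

Definition ker_pred (X Y : lmodType A) (f : {linear X -> Y}) : pred X :=
  fun x => f x == 0.
Fact ker_closed (X Y : lmodType A) (f : {linear X -> Y}) :
  submod_closed (ker_pred f).
Proof.
split; rewrite /ker_pred ?unfold_in ?linear0 // => a u v.
by rewrite !unfold_in linearP => /eqP-> /eqP->; rewrite scaler0 addr0.
Qed.
HB.instance Definition _ (X Y : lmodType A) (f : {linear X -> Y}) :=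
  GRing.isSubmodClosed.Build A X (ker_pred f) (ker_closed f).
Definition kernel (X Y : lmodType A) (f : {linear X -> Y}) : submodClosed X :=
  GRing.SubmodClosed.clone A X (ker_pred f) _.

Definition im_pred (X Y : lmodType A) (f : {linear X -> Y}) : pred Y :=
  fun y => `[< exists x, f x = y >].
Fact im_closed (X Y : lmodType A) (f : {linear X -> Y}) :
  submod_closed (im_pred f).
Proof.
split; first by apply/asboolP; exists 0; rewrite linear0.
move=> a u v /asboolP[x <-] /asboolP[y <-]; apply/asboolP.
by exists (a *: x + y); rewrite linearP.
Qed.
HB.instance Definition _ (X Y : lmodType A) (f : {linear X -> Y}) :=
  GRing.isSubmodClosed.Build A Y (im_pred f) (im_closed f).
Definition image_mod (X Y : lmodType A) (f : {linear X -> Y}) :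
  submodClosed Y := GRing.SubmodClosed.clone A Y (im_pred f) _.

Definition preim_pred V (Z B : submodClosed V) : pred (submod Z) :=
  fun z => val z \in B.
Fact preim_closed V (Z B : submodClosed V) : submod_closed (@preim_pred V Z B).
Proof.
split; first by rewrite unfold_in /preim_pred rpred0.
move=> a u v; rewrite !unfold_in /preim_pred => Bu Bv.
by rewrite linearP; apply: (rpredD (rpredZ a Bu) Bv).
Qed.
HB.instance Definition _ V (Z B : submodClosed V) :=
  GRing.isSubmodClosed.Build A (submod Z) (@preim_pred V Z B)
    (@preim_closed V Z B).

(* [Z / (Z n B)]; below [B] is always contained in [Z]. *)
Definition subquot V (Z B : submodClosed V) : lmodType A :=
  quotmod (GRing.SubmodClosed.clone A (submod Z) (@preim_pred V Z B) _).

Section Tor.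
Variables (U : lmodType A) (F : free_resolution U) (V : lmodType A).

Definition tor_cycles (i : nat) : submodClosed {ffun 'I_(rk F i) -> V} :=
  match i with
  | 0 => span [set: {ffun 'I_(rk F 0%N) -> V}]
  | i'.+1 => kernel (@tensor_mx V _ _ (diff F i'))
  end.

Definition tor_boundaries (i : nat) : submodClosed {ffun 'I_(rk F i) -> V} :=
  image_mod (@tensor_mx V _ _ (diff F i)).

(* [Tor_i(U, V)], computed from the resolution [F] of [U]. *)
Definition tor (i : nat) : lmodType A :=
  subquot (tor_cycles i) (tor_boundaries i).
End Tor.

(* The [d]-th syzygy of [U] in [F]: [U] itself for [d = 0], and the image of
   [F_d -> F_{d-1}] for [d >= 1]. *)
Definition syzygy U (F : free_resolution U) (d : nat) : lmodType A :=
  match d with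
  | 0 => U
  | d'.+1 => submod (image_mod
      (mulmxr (diff F d') : {linear 'rV[A]_(rk F d'.+1) -> 'rV[A]_(rk F d')}))
  end.

(* As Tor does not depend on the resolution, the two definitions below may use
   any resolution; one exists as soon as [U] is finitely generated and [A] is
   noetherian. *)
Definition tor_eventually_zero U V := exists (F : free_resolution U) (n : nat),
  forall i, (n <= i)%N -> forall x : tor F V i, x = 0.

Definition test_module U :=
  forall V, fin_gen V -> tor_eventually_zero U V -> finite_pd V.

Definition ideal_of_definition (m : idealr A) V (I : idealr A) :=
  {subset I <= m} /\
  exists l, has_length (quotmod (smul I (predT : {pred V}))) l.

(* [n |-> length (Tor_i(U, V / I^n V))] agrees for large [n] with a polynomial
   of degree [r]. *)
Definition tor_degree (I : idealr A) V U (i : nat) (r : int) :=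
  exists (F : free_resolution U) (p : {poly rat}),
    (exists n0, forall n, (n0 <= n)%N -> exists l,
        has_length (tor F (quotmod (pow_smul V I n)) i) l /\
        p.[n%:R] = l%:R) /\
    r = (size p)%:Z - 1.

End Homological.

(* Main.v *)
(* Fix generators a_1, ..., a_q of I and write T_i(L) for the graded module
   n |-> Tor_{i+1}(L, I^n N) over A[X_1, ..., X_q], where X_j acts as a_j.

   A regular sequence of length g in ann N pushes the heights of primes up by g, so
   pd N = g <= d - t < d.  Hence Tor_{i+2}(L, N/I^n N) is T_i(L)_n for i >= d - 1, and
   there T_i(L) is noetherian with pieces of finite length: it has a Hilbert polynomial.
   Noetherian induction on annihilators shows that a Serre class satisfying Nakayama's
   lemma which contains T_i(k) contains T_j(L) for all j >= i and all L.  In particular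
   no T_i(M) with i >= d - 1 grows faster than T_{d-1}(k).

   Suppose that all T_i(M), i >> 0, grow at most like n^{s-1}, whereas T_{d-1}(k) grows
   like n^s.  As k is uncountable, there are linear forms y_1, ..., y_s, x which are
   filter-regular on all these modules and on their successive quotients.  Replace the
   Rees system by the iterated cone W of the y_j, so that T_i(M, W) vanishes in large
   degrees, and let W' be the cone of x on W.  Now T_{d-1}(k) is noetherian already over
   A[y_1, ..., y_s, x], hence so is T_i(L, W') for all L and i >= d - 1; there the y_j
   and x act locally nilpotently, so T_{d-1}(k, W'), and then every T_i(L, W'), vanishes
   in degrees n >= n_1 with n_1 independent of i.  Thus x is bijective on the T_i(M, W)
   in these degrees, and Tor_i(M, W_{n_1}) = 0 for i >> 0.  Since M is a test module,
   W_{n_1} has finite projective dimension, T_i(k, W) vanishes in degrees n >= n_1 for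
   i >> 0, and undoing the cones T_i(k) grows at most like n^{s-1} for i >> 0.

   Finally k embeds in the quotient of A by a maximal regular sequence.  The Tor of that
   quotient vanishes in the relevant range, so the bound descends from i + 1 to i, down
   to i = d - 1: a contradiction. *)
Require Import Defs.
From HB Require Import structures.
From mathcomp Require Import all_boot all_order all_algebra.
From mathcomp Require Import boolp classical_sets functions cardinality.
From Stdlib Require List.

Set Implicit Arguments.
Unset Strict Implicit.
Unset Printing Implicit Defensive.

Import GRing.Theory.

Local Open Scope classical_set_scope.
Local Open Scope ring_scope.

(** * Lengths of subquotients *)

Section Length.
Variable A : comNzRingType.
Implicit Types V : lmodType A.

(** The obstacle is uniformity in [i]. Filter-regular forms only make each [T_i(M, W)] vanish from
    some degree on that depends on [i], whereas the test hypothesis speaks of a single module and of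
    all [i >> 0] at once. A bound valid for every [i] has to come from one index of one module, and
    [k] provides it: Nakayama and syzygies carry vanishing from [k] to all finitely generated
    modules and all higher indices without moving the degree. Cones are preferred to quotients of
    Tor because their pieces are finitely generated modules, to which the test hypothesis applies;
    the price is one homological index per cone, repaid in the last step. The extra form [x] is
    there because [k] grows by one order more than [M]: the [y_j] alone need not make [T_{d-1}(k)]
    finitely generated over the forms. The starting index is [d - 1] because [Tor_1] of the [d]-th
    syzygy is [Tor_{d+1}(k, -)]. *)

Definition issub V (U : set V) :=
  U 0 /\ forall a u v, U u -> U v -> U (a *: u + v).

Lemma issub0 V (U : set V) : issub U -> U 0. Proof. by case. Qed.
Lemma issubD V (U : set V) u v : issub U -> U u -> U v -> U (u + v).
Proof. by case=> _ h Uu Uv; rewrite -[u]scale1r; apply: h. Qed.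
Lemma issubZ V (U : set V) a u : issub U -> U u -> U (a *: u).
Proof. by case=> U0 h Uu; rewrite -[_ *: _]addr0; apply: h. Qed.
Lemma issubN V (U : set V) u : issub U -> U u -> U (- u).
Proof. by move=> h Uu; rewrite -scaleN1r; apply: issubZ. Qed.
Lemma issubB V (U : set V) u v : issub U -> U u -> U v -> U (u - v).
Proof. by move=> h Uu Uv; apply: issubD => //; apply: issubN. Qed.
Lemma issub_sum V (U : set V) (I : Type) (r : seq I) (P : pred I) (F : I -> V) :
  issub U -> (forall i, P i -> U (F i)) -> U (\sum_(i <- r | P i) F i).
Proof.
move=> hU hF; apply: (big_ind U) => //; first exact: issub0.
by move=> x y; apply: issubD.
Qed.
Lemma issubBr V (U : set V) u v : issub U -> U (u - v) -> U v -> U u.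
Proof. by move=> h Uuv Uv; rewrite -[u](subrK v); apply: issubD. Qed.
Lemma issubBl V (U : set V) u v : issub U -> U (u - v) -> U u -> U v.
Proof.
by move=> h Uuv Uu; rewrite -[v](subKr u); apply: issubB.
Qed.

Definition mwf V (Z B : set V) := [/\ issub Z, issub B & B `<=` Z].

(* Homomorphisms [Z/B -> Z'/B'] are presented by additive relations between the
   ambient modules, so that connecting maps need no choice of lifts. *)
Record mhom V V' (Z B : set V) (Z' B' : set V') (R : V -> V' -> Prop) : Prop :=
  MHom {
  mhom0 : R 0 0;
  mhomL : forall a x y x' y', R x x' -> R y y' -> R (a *: x + y) (a *: x' + y');
  mhomI : forall x x', R x x' -> Z x /\ Z' x';
  mhomT : forall x, Z x -> exists x', R x x';
  mhomB : forall x x', R x x' -> B x -> B' x'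
}.

Lemma mhomB2 V V' (Z B : set V) (Z' B' : set V') R x y x' y' :
  mhom Z B Z' B' R -> R x x' -> R y y' -> R (x - y) (x' - y').
Proof.
move=> h Rx Ry; have := mhomL h (-1) Ry Rx.
by rewrite !scaleN1r [- y + _]addrC [- y' + _]addrC.
Qed.

(** Only the inclusion of the kernel of [S] in the image of [R] is recorded, the half of exactness
    that bounds the middle term by its neighbours. *)
Definition mexact V1 V2 V3 (Z1 B1 : set V1) (Z2 B2 : set V2) (Z3 B3 : set V3)
    (R : V1 -> V2 -> Prop) (S : V2 -> V3 -> Prop) :=
  [/\ mhom Z1 B1 Z2 B2 R, mhom Z2 B2 Z3 B3 S
    & forall x x', S x x' -> B3 x' -> exists y z, R y z /\ B2 (x - z)].

Definition between V (Z B U : set V) := [/\ issub U, B `<=` U & U `<=` Z].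

Definition chain V (Z B : set V) (l : nat) (c : nat -> set V) :=
  (forall i, (i <= l)%N -> between Z B (c i)) /\
  forall i, (i < l)%N -> c i `<=` c i.+1 /\ ~ c i.+1 `<=` c i.

Definition lenle V (Z B : set V) l := ~ exists c, chain Z B l.+1 c.
Definition len V (Z B : set V) l := (exists c, chain Z B l c) /\ lenle Z B l.

Lemma chain_le V (Z B : set V) k l c :
  (k <= l)%N -> chain Z B l c -> chain Z B k c.
Proof.
move=> kl [h1 h2]; split=> i ik; first exact/h1/(leq_trans ik).
exact/h2/(leq_trans ik).
Qed.

Lemma chain_lenle V (Z B : set V) k l c :
  lenle Z B l -> chain Z B k c -> (k <= l)%N.
Proof.
move=> hl hc; rewrite leqNgt; apply/negP => lk; apply: hl; exists c.
exact: chain_le hc.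
Qed.

Lemma lenle_leq V (Z B : set V) k l : (k <= l)%N -> lenle Z B k -> lenle Z B l.
Proof.
move=> kl hk [c hc]; have := chain_lenle hk hc.
by move=> lk; move: (leq_trans lk kl); rewrite ltnn.
Qed.

Lemma len_uniq V (Z B : set V) k l : len Z B k -> len Z B l -> k = l.
Proof.
move=> [[c hc] hk] [[c' hc'] hl]; apply/eqP; rewrite eqn_leq.
by rewrite (chain_lenle hl hc) (chain_lenle hk hc').
Qed.

Lemma len_lenle V (Z B : set V) k l : len Z B k -> lenle Z B l -> (k <= l)%N.
Proof. by move=> [[c hc] _] /chain_lenle; apply; apply: hc. Qed.

Lemma lenle_len V (Z B : set V) l : mwf Z B -> lenle Z B l ->
  exists2 k, (k <= l)%N & len Z B k.
Proof.
move=> [sZ sB BZ]; elim: l => [|l IH] hl.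
  exists 0%N => //; split=> //; exists (fun=> B); split=> // i _.
  by split.
have [hc|hc] := pselect (exists c, chain Z B l.+1 c); first by exists l.+1.
by have [k kl hk] := IH hc; exists k => //; apply: leqW.
Qed.

(** Prepared for images and preimages of a strict chain, which increase only weakly: deleting
    repetitions leaves one step for each strict inclusion. *)
Lemma chain_thin V (Z B : set V) (c : nat -> set V) l :
  (forall i, (i <= l)%N -> between Z B (c i)) ->
  (forall i, (i < l)%N -> c i `<=` c i.+1) ->
  exists c', chain Z B (\sum_(i < l) `[< ~ c i.+1 `<=` c i >])%N c' /\
    c' (\sum_(i < l) `[< ~ c i.+1 `<=` c i >])%N = c l.
Proof.
elim: l => [|l IH] h1 h2.
  by rewrite big_ord0; exists c.
have [||c' [[c1 c2] c3]] := IH.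
- by move=> i il; apply/h1/leqW.
- by move=> i il; apply/h2/leqW.
rewrite big_ord_recr /=; set k := (\sum_(i < l) _)%N in c1 c2 c3 *.
have [hs|hs] := asboolP (~ _); last first.
  rewrite addn0; exists c'; split=> //; rewrite c3; apply/seteqP; split.
    exact: h2.
  exact: contrapT.
rewrite addn1; exists (fun i => if (i <= k)%N then c' i else c l.+1).
split; last by rewrite ltnn.
split=> i ik.
  by case: ifP => [/c1//|_]; apply: h1.
rewrite -ltnS ik; case: ifP => [|/negbT]; first exact: c2.
rewrite -leqNgt => ki; have -> : i = k by apply/eqP; rewrite eqn_leq -ltnS ik.
by rewrite c3; split=> //; apply: h2.
Qed.

(** All values are required to lie in [U]; since [U] will contain the boundaries, by which two
    values of [R] differ, this is the same as one value lying there. *)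
Definition mpre V1 V2 (Z1 : set V1) (R : V1 -> V2 -> Prop) (U : set V2) : set V1 :=
  [set y | Z1 y /\ forall z, R y z -> U z].
Definition mim V2 V3 (B3 : set V3) (S : V2 -> V3 -> Prop) (U : set V2) : set V3 :=
  [set x' | exists x y, [/\ U x, S x y & B3 (x' - y)]].

Section Exact.
Variables (V1 V2 V3 : lmodType A).
Variables (Z1 B1 : set V1) (Z2 B2 : set V2) (Z3 B3 : set V3).
Variables (R : V1 -> V2 -> Prop) (S : V2 -> V3 -> Prop).
Hypotheses (w1 : mwf Z1 B1) (w2 : mwf Z2 B2) (w3 : mwf Z3 B3).
Hypothesis ex : mexact Z1 B1 Z2 B2 Z3 B3 R S.

Lemma between_mpre U : between Z2 B2 U -> between Z1 B1 (mpre Z1 R U).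
Proof.
case: w1 w2 ex => [sZ1 sB1 BZ1] [sZ2 sB2 BZ2] [hR _ _] [sc Bc cZ]; split.
- split; first split; first exact: issub0.
    by move=> z Rz; apply: Bc; apply: (mhomB hR Rz); apply: issub0.
  move=> k u v [Zu hu] [Zv hv]; split; first by case: sZ1 => _; apply.
  have [u' Ru] := mhomT hR Zu; have [v' Rv] := mhomT hR Zv.
  move=> z Rz; have Ruv := mhomL hR k Ru Rv.
  have /(mhomB hR): R 0 (z - (k *: u' + v')).
    by rewrite -(subrr (k *: u + v)); apply: (mhomB2 hR).
  move=> /(_ (issub0 sB1)) /Bc h; apply: (issubBr sc h).
  by case: sc => _; apply; [apply: hu|apply: hv].
- by move=> y By; split; [apply: BZ1|move=> z Rz; apply/Bc/(mhomB hR Rz)].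
- by move=> y [].
Qed.

Lemma between_mim U : between Z2 B2 U -> between Z3 B3 (mim B3 S U).
Proof.
case: w2 w3 ex => [sZ2 sB2 BZ2] [sZ3 sB3 BZ3] [_ hS _] [sc Bc cZ]; split.
- split.
    exists 0, 0; split; [exact: issub0|exact: mhom0 hS|].
    by rewrite subrr; apply: issub0.
  move=> k u v [x [y [cx Sx Bx]]] [x' [y' [cx' Sx' Bx']]].
  exists (k *: x + x'), (k *: y + y'); split; first by case: sc => _; apply.
    exact: (mhomL hS).
  rewrite opprD addrACA -scalerBr; by case: sB3 => _; apply.
- move=> y By; exists 0, 0; split; [exact: issub0|exact: mhom0 hS|].
  by rewrite subr0.
- move=> x' [x [y [cx Sx Bx]]]; apply: (issubBr sZ3 (BZ3 _ Bx)).
  by case: (mhomI hS Sx).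
Qed.

(** The modular law across an exact triple: an element of [U'] is corrected by one of [U] with the
    same image, and the difference comes from the left, where the preimages agree. *)
Lemma mexact_cmp U U' : between Z2 B2 U -> between Z2 B2 U' -> U `<=` U' ->
  mpre Z1 R U' `<=` mpre Z1 R U -> mim B3 S U' `<=` mim B3 S U -> U' `<=` U.
Proof.
case: w1 w2 w3 ex => [sZ1 sB1 BZ1] [sZ2 sB2 BZ2] [sZ3 sB3 BZ3] [hR hS exx].
move=> [sc Bc cZ] [sc' Bc' cZ'] UU' he hf x cx.
have [x' Sx] := mhomT hS (cZ' _ cx).
have [u [v [cu Su Bu]]] : mim B3 S U x'.
  by apply: hf; exists x, x'; split=> //; rewrite subrr; apply: issub0.
have [y [z [Ry Bz]]] := exx _ _ (mhomB2 hS Sx Su) Bu.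
have Cz : U' z.
  by apply: (issubBl sc' (Bc' _ Bz)); apply: issubB => //; apply: UU'.
have [] : mpre Z1 R U y.
  apply: he; split; first by case: (mhomI hR Ry).
  move=> z' Rz'; have := mhomB2 hR Ry Rz'; rewrite subrr => /(mhomB hR).
  by move=> /(_ (issub0 sB1)) /Bc'/(issubBl sc'); apply.
move=> _ /(_ _ Ry) cz; apply: (issubBr sc _ cu).
by apply: (issubBr sc (Bc _ Bz)).
Qed.

Lemma mpreS U U' : U `<=` U' -> mpre Z1 R U `<=` mpre Z1 R U'.
Proof. by move=> h y [Zy hy]; split=> // z /hy /h. Qed.

Lemma mimS U U' : U `<=` U' -> mim B3 S U `<=` mim B3 S U'.
Proof. by move=> h x' [x [y [/h cx Sx Bx]]]; exists x, y. Qed.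

Lemma lenle_exact a b : lenle Z1 B1 a -> lenle Z3 B3 b -> lenle Z2 B2 (a + b).
Proof.
move=> ha hb [c [c1 c2]]; pose l := (a + b).+1.
have e1 i : (i <= l)%N -> between Z1 B1 (mpre Z1 R (c i)).
  by move=> /c1 /between_mpre.
have f1 i : (i <= l)%N -> between Z3 B3 (mim B3 S (c i)).
  by move=> /c1 /between_mim.
have e2 i : (i < l)%N -> mpre Z1 R (c i) `<=` mpre Z1 R (c i.+1).
  by move=> il; apply/mpreS/(c2 _ il).1.
have f2 i : (i < l)%N -> mim B3 S (c i) `<=` mim B3 S (c i.+1).
  by move=> il; apply/mimS/(c2 _ il).1.
have [c' [/(chain_lenle ha) le _]] := chain_thin e1 e2.
have [c'' [/(chain_lenle hb) lf _]] := chain_thin f1 f2.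
(* By [mexact_cmp] each step of [c] is strict on at least one side, so the two counts add up to at
   least [l = a + b + 1]. *)
have := leq_add le lf; rewrite -big_split /= leqNgt => /negP; apply.
rewrite -[X in (X <= _)%N]/l -[X in (X <= _)%N](card_ord l) -sum1_card.
apply: leq_sum => i _; have il := ltn_ord i.
case: asboolP => [//|/contrapT he]; case: asboolP => [//|/contrapT hf].
exfalso; apply: (c2 _ il).2.
by apply: mexact_cmp he hf; [exact/c1/ltnW|exact/c1|exact: (c2 _ il).1].
Qed.
End Exact.

(** Exactness gives the upper bound; for the lower one the chains are concatenated, the upper chain
    taking over at index [a]. *)
Lemma len_add V (Z U B : set V) a b : mwf Z U -> mwf U B ->
  len U B a -> len Z U b -> len Z B (a + b).
Proof.
move=> [sZ sU UZ] [_ sB BU] [[c [c1 c2]] ha] [[e [e1 e2]] hb]; split; last first.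
  pose R (x y : V) := U x /\ x = y; pose S (x y : V) := Z x /\ x = y.
  apply: (@lenle_exact _ _ _ U B Z B Z U R S) => //; split=> //.
  - exact: subset_trans UZ.
  - split=> [|k x y x' y' [Ux <-] [Uy <-]|x _ [Ux <-]|x|x _ [_ <-]] //.
    + by split=> //; apply: issub0.
    + by split=> //; case: sU => _; apply.
    + by split=> //; apply: UZ.
    + by exists x.
  - split=> [|k x y x' y' [Ux <-] [Uy <-]|x _ [Ux <-]|x|x _ [_ <-]] //.
    + by split=> //; apply: issub0.
    + by split=> //; case: sZ => _; apply.
    + by exists x.
    + exact: BU.
  - by move=> x _ [Zx <-] Ux; exists x, x; rewrite subrr; split=> //; apply: issub0.
exists (fun i => if (i < a)%N then c i else e (i - a)%N); split=> [i iab|i iab].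
  case: ifP => [/ltnW/c1[? ? ?]|].
    by split=> //; apply: subset_trans UZ.
  move=> /negbT; rewrite -leqNgt => ai; have [|? ? ?] := e1 (i - a)%N.
    by rewrite leq_subLR.
  by split=> //; apply: subset_trans BU _.
have [ai|ia] := leqP a i.
  rewrite ltnNge (leq_trans ai (leqnSn i)) /= subSn //; apply: e2.
  by rewrite ltn_subLR.
have [h1 h2] := c2 _ ia; have [ia'|] := ltnP i.+1 a; first by [].
move=> ai; have {ai}ai : i.+1 = a by apply/eqP; rewrite eqn_leq ai ia.
rewrite ai subnn; have [se Be eZ] := e1 0%N isT.
have [sc _ cU] : between U B (c a) by apply: c1.
rewrite ai in h1 h2; split; first by apply: (subset_trans h1); apply: subset_trans Be.
move=> h; apply: h2; apply: (subset_trans _ h); exact: subset_trans Be.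
Qed.

Lemma lenle0 V (Z B : set V) : Z `<=` B -> lenle Z B 0.
Proof.
move=> ZB [c [c1 c2]]; have [_] := c2 0%N isT; apply.
have [_ _ h] := c1 1%N isT; have [_ h' _] := c1 0%N isT.
exact/(subset_trans h)/(subset_trans ZB).
Qed.

Lemma len0 V (Z B : set V) : mwf Z B -> len Z B 0 -> Z `<=` B.
Proof.
move=> [sZ sB BZ] [_ h]; apply: contrapT => ZB; apply: h.
exists (fun i => if i is 0%N then B else Z); by split=> [[|i] _|[|i]] //; split.
Qed.

Lemma mhom_inv V V' (Z B : set V) (Z' B' : set V') R :
  mhom Z B Z' B' R -> (forall x x', R x x' -> B' x' -> B x) ->
  (forall x', Z' x' -> exists x, R x x') -> mhom Z' B' Z B (fun x' x => R x x').
Proof.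
move=> h hi hs; split=> //; first exact: mhom0 h.
- by move=> a x y x' y'; apply: (mhomL h).
- by move=> x x' /(mhomI h) [].
- by move=> x x' /hi.
Qed.

Lemma mexact_id V V' (Z B : set V) (Z' B' : set V') R :
  mwf Z B -> mhom Z B Z' B' R -> (forall x x', R x x' -> B' x' -> B x) ->
  mexact B B Z B Z' B' (fun x y => B x /\ x = y) R.
Proof.
move=> [sZ sB BZ] h hi; split=> //.
- split=> [|k x y x' y' [Ux <-] [Uy <-]|x _ [Ux <-]|x|x _ [_ <-]] //.
  + by split=> //; apply: issub0.
  + by split=> //; case: sB => _; apply.
  + by split=> //; apply: BZ.
  + by exists x.
- move=> x x' Rx /(hi _ _ Rx) Bx; exists x, x; split=> //.
  by rewrite subrr; apply: issub0.
Qed.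

Lemma lenle_inj V V' (Z B : set V) (Z' B' : set V') R l :
  mwf Z B -> mwf Z' B' -> mhom Z B Z' B' R ->
  (forall x x', R x x' -> B' x' -> B x) -> lenle Z' B' l -> lenle Z B l.
Proof.
move=> w w' h hi hl; rewrite -[l]add0n.
have wB : mwf B B by case: w => _ ? _; split.
by apply: (lenle_exact wB w w' (mexact_id w h hi)) => //; apply: lenle0.
Qed.

Lemma len_iso V V' (Z B : set V) (Z' B' : set V') R l :
  mwf Z B -> mwf Z' B' -> mhom Z B Z' B' R ->
  (forall x x', R x x' -> B' x' -> B x) ->
  (forall x', Z' x' -> exists x, R x x') ->
  len Z B l <-> len Z' B' l.
Proof.
move=> w w' h hi hs; have h' := mhom_inv h hi hs.
have hi' x' x : R x x' -> B x -> B' x' by apply: (mhomB h).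
have aux V1 V2 (Z1 B1 : set V1) (Z2 B2 : set V2) R1 : mwf Z1 B1 -> mwf Z2 B2 ->
    mhom Z1 B1 Z2 B2 R1 -> (forall x x', R1 x x' -> B2 x' -> B1 x) ->
    (forall x', Z2 x' -> exists x, R1 x x') ->
    len Z1 B1 l -> len Z2 B2 l.
  move=> w1 w2 h1 i1 s1 [[c hc] hl].
  have h2 := mhom_inv h1 i1 s1.
  have i2 x' x : R1 x x' -> B1 x -> B2 x' by apply: (mhomB h1).
  have l2 := lenle_inj w2 w1 h2 i2 hl; have [k kl hk] := lenle_len w2 l2.
  have := chain_lenle (lenle_inj w1 w2 h1 i1 hk.2) hc => lk.
  by have <- : k = l by apply/eqP; rewrite eqn_leq kl lk.
split; first exact: (aux _ _ _ _ _ _ _ w w' h hi hs).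
by apply: (aux _ _ _ _ _ _ _ w' w h' hi') => x /(mhomT h) [x' Rx]; exists x'.
Qed.
End Length.

(** * Graded modules *)

Section Graded.
Variable A : comNzRingType.

Record gsys (m : nat) := GSys {
  gob :> nat -> lmodType A;
  gop : forall (j : 'I_m) n, {linear gob n -> gob n.+1}
}.

(* The graded module with pieces [cyc n / bnd n], presented without forming quotients. *)
Record gquo (m : nat) := GQuo {
  gq_sys :> gsys m;
  cyc : forall n, set (gq_sys n);
  bnd : forall n, set (gq_sys n)
}.
Arguments cyc {m} T n _ : rename.
Arguments bnd {m} T n _ : rename.

Section FixOps.
Variable m : nat.
Implicit Types (W : gsys m) (T : gquo m).

Definition comm W := forall i j n (x : W n),
  gop W i n.+1 (gop W j n x) = gop W j n.+1 (gop W i n x).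

Definition gwf T := [/\ forall n, mwf (cyc T n) (bnd T n),
  forall j n x, cyc T n x -> cyc T n.+1 (gop T j n x)
  & forall j n x, bnd T n x -> bnd T n.+1 (gop T j n x)].

Lemma cyc_sub T n : gwf T -> issub (cyc T n).
Proof. by case=> /(_ n) []. Qed.
Lemma bnd_sub T n : gwf T -> issub (bnd T n).
Proof. by case=> /(_ n) []. Qed.
Lemma bnd_cyc T n : gwf T -> bnd T n `<=` cyc T n.
Proof. by case=> /(_ n) []. Qed.
Lemma gwf_m T n : gwf T -> mwf (cyc T n) (bnd T n).
Proof. by case. Qed.

Definition ghom T T' (R : forall n, T n -> T' n -> Prop) :=
  (forall n, mhom (cyc T n) (bnd T n) (cyc T' n) (bnd T' n) (R n)) /\
  forall j n x x', R n x x' -> R n.+1 (gop T j n x) (gop T' j n x').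

Definition exact3 T1 T2 T3 :=
  exists (R : forall n, T1 n -> T2 n -> Prop) (S : forall n, T2 n -> T3 n -> Prop),
  [/\ ghom R, ghom S & forall n x x', S n x x' -> bnd T3 n x' ->
      exists y z, R n y z /\ bnd T2 n (x - z)].

Definition subfam T (U : forall n, set (T n)) :=
  (forall n, between (cyc T n) (bnd T n) (U n)) /\
  forall j n x, U n x -> U n.+1 (gop T j n x).
Arguments subfam : clear implicits.

(** The ascending chain condition on graded submodules; one stage [k] has to serve all degrees. *)
Definition noeth T := forall c : nat -> forall n, set (T n),
  (forall k, subfam T (c k)) -> (forall k n, c k n `<=` c k.+1 n) ->
  exists k, forall l n, (k <= l)%N -> c l n `<=` c k n.

Lemma mexact_slice T1 T2 T3 R S n : ghom R -> ghom S ->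
  (forall n x x', S n x x' -> bnd T3 n x' ->
      exists y z, R n y z /\ bnd T2 n (x - z)) ->
  mexact (cyc T1 n) (bnd T1 n) (cyc T2 n) (bnd T2 n) (cyc T3 n) (bnd T3 n)
    (R n) (S n).
Proof. by move=> [h1 _] [h2 _] ex; split=> // x x' /ex. Qed.

Lemma asc_le T (c : nat -> forall n, set (T n)) k l n :
  (forall k n, c k n `<=` c k.+1 n) -> (k <= l)%N -> c k n `<=` c l n.
Proof.
move=> h /subnKC <-; elim: (l - k)%N => [|p IH]; first by rewrite addn0.
by rewrite addnS; apply: subset_trans IH _; apply: h.
Qed.

Lemma noeth_exact T1 T2 T3 : gwf T1 -> gwf T2 -> gwf T3 -> exact3 T1 T2 T3 ->
  noeth T1 -> noeth T3 -> noeth T2.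
Proof.
move=> w1 w2 w3 [R [S [hR hS ex]]] n1 n3 c hc cc.
have me n := mexact_slice n hR hS ex.
pose e k n := mpre (cyc T1 n) (R n) (c k n).
pose f k n := mim (bnd T3 n) (S n) (c k n).
have bc k n : between (cyc T2 n) (bnd T2 n) (c k n) by case: (hc k).
have [k1 hk1] : exists k, forall l n, (k <= l)%N -> e l n `<=` e k n.
  apply: n1 => [k|k n]; last exact/mpreS/cc.
  split=> [n|j n y [Zy hy]].
    exact: (between_mpre (gwf_m n w1) (gwf_m n w2) (me n)).
  split; first by case: w1 => _ + _; apply.
  move=> z Rz; have [z' Rz'] := mhomT (hR.1 n) Zy.
  have := mhomB2 (hR.1 n.+1) Rz (hR.2 j _ _ _ Rz').
  rewrite subrr => /(mhomB (hR.1 n.+1)) /(_ (issub0 (bnd_sub _ w1))).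
  have [sU BU _] := bc k n.+1.
  move=> /BU /(issubBr sU); apply; apply: (hc k).2; exact: hy.
have [k3 hk3] : exists k, forall l n, (k <= l)%N -> f l n `<=` f k n.
  apply: n3 => [k|k n]; last exact/mimS/cc.
  split=> [n|j n x' [x [y [cx Sx Bx]]]].
    exact: (between_mim (gwf_m n w2) (gwf_m n w3) (me n)).
  exists (gop T2 j n x), (gop T3 j n y); split; first exact: (hc k).2.
    exact: (hS.2).
  by rewrite -linearB; case: w3 => _ _; apply.
exists (maxn k1 k3) => l n kl.
have [k1l k3l] : (k1 <= l)%N /\ (k3 <= l)%N.
  by split; apply: leq_trans kl; rewrite ?leq_maxl ?leq_maxr.
apply: (mexact_cmp (gwf_m n w1) (gwf_m n w2) (gwf_m n w3) (me n)) => //.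
- exact: (asc_le cc kl).
- by apply: (subset_trans (hk1 _ _ k1l)); apply/mpreS/(asc_le cc)/leq_maxl.
- by apply: (subset_trans (hk3 _ _ k3l)); apply/mimS/(asc_le cc)/leq_maxr.
Qed.

Definition restr W (Z B : forall n, set (W n)) := @GQuo m W Z B.

Lemma restr_eta T : restr (cyc T) (bnd T) = T.
Proof. by case: T. Qed.

Lemma noeth_restr T (Z B : forall n, set (T n)) :
  (forall n, Z n `<=` cyc T n) -> (forall n, bnd T n `<=` B n) ->
  noeth T -> noeth (restr Z B).
Proof.
move=> ZZ BB h c hc cc; apply: h cc => k; split=> [n|]; last exact: (hc k).2.
have [sU BU UZ] := (hc k).1 n; split=> //.
  exact: subset_trans BU.
exact: subset_trans (ZZ n).
Qed.

Lemma noeth_quot T U : subfam T U -> noeth T -> noeth (restr (cyc T) U).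
Proof.
by move=> [s _]; apply: noeth_restr => n; [exact: subset_refl|case: (s n)].
Qed.

Lemma noeth_sub T U : subfam T U -> noeth T -> noeth (restr U (bnd T)).
Proof.
by move=> [s _]; apply: noeth_restr => n; [case: (s n)|exact: subset_refl].
Qed.

Lemma noeth_max T (P : (forall n, set (T n)) -> Prop) U0 :
  noeth T -> subfam T U0 -> P U0 -> exists U, [/\ subfam T U, P U &
    forall U', subfam T U' -> (forall n, U n `<=` U' n) -> P U' ->
      forall n, U' n `<=` U n].
Proof.
move=> hn s0 p0; apply: contrapT => hno.
pose St := {U : forall n, set (T n) | subfam T U /\ P U}.
have step (s : St) : exists s' : St, (forall n, sval s n `<=` sval s' n) /\
    ~ forall n, sval s' n `<=` sval s n.
  case: s => U [sU PU] /=; apply: contrapT => hs; apply: hno; exists U.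
  split=> // U' sU' UU' PU'; apply: contrapT => hnU.
  by apply: hs; exists (exist _ U' (conj sU' PU')).
pose nxt s := projT1 (cid (step s)).
pose c k := iter k nxt (exist _ U0 (conj s0 p0)).
have [k|k n|k hk] := hn (fun k => sval (c k)).
- exact: (svalP (c k)).1.
- exact: (projT2 (cid (step (c k)))).1.
apply: (projT2 (cid (step (c k)))).2 => n.
exact: (hk k.+1 n (leqnSn k)).
Qed.

(* When some [U' >= U] with [P U'] must be proved equal to [U], the maximality
   is used contrapositively. *)
Lemma noeth_ind T (P : (forall n, set (T n)) -> Prop) :
  noeth T -> gwf T ->
  (forall U, subfam T U -> (forall U', subfam T U' -> (forall n, U n `<=` U' n) ->
     ~ (forall n, U' n `<=` U n) -> P U') -> P U) -> P (bnd T).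
Proof.
move=> hn w IH; apply: contrapT => hP.
have sB : subfam T (bnd T).
  split=> [n|]; last by case: w.
  by split=> //; [exact: bnd_sub|exact: bnd_cyc].
have [U [sU PU hU]] := noeth_max (P := fun U => ~ P U) hn sB hP.
apply: PU; apply: IH => // U' sU' UU' hne; apply: contrapT => PU'.
exact/hne/hU.
Qed.

Lemma subfam_wf T U : gwf T -> subfam T U -> gwf (restr U (bnd T)) /\ gwf (restr (cyc T) U).
Proof.
move=> [w1 w2 w3] [s1 s2]; split; split=> //= n; have [sZ sB BZ] := w1 n;
  by have [sU BU UZ] := s1 n; split.
Qed.

Definition gshift_sys W : gsys m := @GSys m (fun n => W n.+1) (fun j n => gop W j n.+1).
Definition gshift T : gquo m :=
  @GQuo m (gshift_sys T) (fun n => cyc T n.+1) (fun n => bnd T n.+1).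

Lemma gshift_wf T : gwf T -> gwf (gshift T).
Proof.
by case=> w1 w2 w3; split=> [n|j n x|j n x]; [exact: w1|exact: w2|exact: w3].
Qed.
Lemma gshift_comm W : comm W -> comm (gshift_sys W).
Proof. by move=> h i j n x; apply: h. Qed.

Definition unsh W (B : set (W 0%N)) (U : forall n, set (W n.+1)) n : set (W n) :=
  match n with 0%N => B | k.+1 => U k end.

Lemma gshift_noeth T : gwf T -> noeth T -> noeth (gshift T).
Proof.
move=> w hn c hc cc.
have [k|k [|n]|k hk] := hn (fun k => unsh (bnd T 0%N) (c k)).
- split=> [[|n]|j [|n] x] /=.
  + by split=> //; [exact: bnd_sub|exact: bnd_cyc].
  + exact: (hc k).1.
  + move=> Bx; have [_ h _] := (hc k).1 0%N; apply: h.
    by case: w => _ _; apply.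
  + exact: (hc k).2.
- by [].
- exact: cc.
by exists k => l n kl; apply: (hk l n.+1 kl).
Qed.

Definition lin W (l : 'I_m -> A) n (x : W n) : W n.+1 := \sum_j l j *: gop W j n x.

Lemma linP W l n a (x y : W n) : lin l (a *: x + y) = a *: lin l x + lin l y.
Proof.
rewrite /lin scaler_sumr -big_split /=; apply: eq_bigr => j _.
by rewrite linearP scalerDr !scalerA mulrC.
Qed.
Fact lin_linear W l n : linear (@lin W l n).
Proof. by move=> a x y; apply: linP. Qed.
HB.instance Definition _ W l n :=
  GRing.isLinear.Build A (W n) (W n.+1) *:%R (@lin W l n) (@lin_linear W l n).

Lemma lin_closed W l (P : forall n, set (W n)) n x : issub (P n.+1) ->
  (forall j x, P n x -> P n.+1 (gop W j n x)) -> P n x -> P n.+1 (lin l x).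
Proof. by move=> s h Px; apply: issub_sum => // j _; apply: issubZ => //; apply: h. Qed.
Lemma lin_cyc T l n x : gwf T -> cyc T n x -> cyc T n.+1 (lin l x).
Proof.
move=> w; apply: lin_closed; first exact: cyc_sub.
by move=> j y; case: w => _ h _; apply: h.
Qed.
Lemma lin_bnd T l n x : gwf T -> bnd T n x -> bnd T n.+1 (lin l x).
Proof.
move=> w; apply: lin_closed; first exact: bnd_sub.
by move=> j y; case: w => _ _ h; apply: h.
Qed.
Lemma lin_gop W l j n (x : W n) : comm W -> gop W j n.+1 (lin l x) = lin l (gop W j n x).
Proof.
by move=> c; rewrite /lin linear_sum; apply: eq_bigr => i _; rewrite linearZ c.
Qed.
Lemma lin_lin W l l' n (x : W n) : comm W -> lin l (lin l' x) = lin l' (lin l x).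
Proof.
move=> c; rewrite /lin.
under eq_bigr => i _ do rewrite linear_sum /= scaler_sumr.
under [RHS]eq_bigr => i _ do rewrite linear_sum /= scaler_sumr.
rewrite exchange_big /=; apply: eq_bigr => i _; apply: eq_bigr => j _.
by rewrite !linearZ /= !scalerA mulrC c.
Qed.
Lemma lin_hom T T' R l n x x' : @ghom T T' R -> R n x x' -> R n.+1 (lin l x) (lin l x').
Proof.
move=> [h1 h2] Rx; rewrite /lin; elim/big_rec2: _ => [|j y z _ Ryz].
  exact: mhom0 (h1 _).
by apply: (mhomL (h1 _)) => //; apply: h2.
Qed.

Definition formquo T l : gquo m := @GQuo m T (cyc T) (fun n =>
  match n return set (T n) with
  | 0%N => bnd T 0%N
  | k.+1 => [set x | exists b z, [/\ bnd T k.+1 b, cyc T k z & x = b + lin l z]]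
  end).

Lemma formquo_bnd T l n : gwf T -> bnd T n `<=` bnd (formquo T l) n.
Proof.
move=> w; case: n => [|n] //= x Bx; exists x, 0; split=> //.
  by apply: issub0; apply: cyc_sub.
by rewrite linear0 addr0.
Qed.

Lemma formquo_sub T l : gwf T -> comm T -> subfam T (bnd (formquo T l)).
Proof.
move=> w c; have w' := w; case: w' => w1 w2 w3; split=> [[|n]|j [|n] x] /=.
- by split=> //; [exact: bnd_sub|exact: bnd_cyc].
- split.
  + split; first exact: (@formquo_bnd T l n.+1 w 0 (issub0 (bnd_sub n.+1 w))).
    move=> a u v [b [z [Bb Zz ->]]] [b' [z' [Bb' Zz' ->]]].
    exists (a *: b + b'), (a *: z + z'); split.
    * by case: (bnd_sub n.+1 w) => _; apply.
    * by case: (cyc_sub n w) => _; apply.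
    * by rewrite linP scalerDr addrACA.
  + exact: (@formquo_bnd T l n.+1 w).
  + move=> x [b [z [Bb Zz ->]]]; apply: issubD; first exact: cyc_sub.
      exact: bnd_cyc.
    exact: lin_cyc.
- by move=> Bx; apply: (@formquo_bnd T l 1 w); apply: w3.
- move=> [b [z [Bb Zz ->]]]; exists (gop T j n.+1 b), (gop T j n z); split.
  + exact: w3.
  + exact: w2.
  + by rewrite linearD /= lin_gop.
Qed.

Lemma formquo_wf T l : gwf T -> comm T -> gwf (formquo T l).
Proof. by move=> w c; apply: (subfam_wf w (formquo_sub l w c)).2. Qed.

Lemma formquo_noeth T l : gwf T -> noeth T -> noeth (formquo T l).
Proof.
move=> w; apply: (@noeth_restr T (cyc T) (bnd (formquo T l))) => n.
  exact: subset_refl.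
exact: (@formquo_bnd T l n w).
Qed.

Definition formker T l : gquo m := @GQuo m T
  (fun n => [set x | cyc T n x /\ bnd T n.+1 (lin l x)]) (bnd T).

Lemma formker_sub T l : gwf T -> comm T -> subfam T (cyc (formker T l)).
Proof.
move=> w c; have w' := w; case: w' => w1 w2 w3; split=> [n|j n x] /=.
  split=> [|x Bx|x []] //.
    split; first by split; [exact: (issub0 (cyc_sub n w))|rewrite linear0; exact: (issub0 (bnd_sub n.+1 w))].
    move=> a u v [Zu Bu] [Zv Bv]; rewrite /= linP; split.
      by case: (cyc_sub n w) => _; apply.
    by case: (bnd_sub n.+1 w) => _; apply.
  by split; [apply: bnd_cyc|apply: lin_bnd].
by move=> [Zx Bx]; rewrite -lin_gop //; split; [apply: w2|apply: w3].
Qed.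

Lemma formker_wf T l : gwf T -> comm T -> gwf (formker T l).
Proof. by move=> w c; apply: (subfam_wf w (formker_sub l w c)).1. Qed.

Definition evzero T := exists n0, forall n, (n0 <= n)%N -> cyc T n `<=` bnd T n.

Definition giso T T' (R : forall n, T n -> T' n -> Prop) :=
  [/\ ghom R, forall n x x', R n x x' -> bnd T' n x' -> bnd T n x
    & forall n x', cyc T' n x' -> exists x, R n x x'].

(* Noetherian induction reduces a property of graded modules to those on which every
   linear form acts either as zero or injectively. *)
Lemma devissage (Phi : gquo m -> Prop) :
  (forall T U, gwf T -> comm T -> subfam T U ->
     Phi (restr U (bnd T)) -> Phi (restr (cyc T) U) -> Phi T) ->
  (forall T T' R, gwf T -> gwf T' -> @giso T (gshift T') R ->
     cyc T' 0%N `<=` bnd T' 0%N -> Phi T -> Phi T') ->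
  (forall T, gwf T -> comm T -> noeth T ->
     (forall l, (forall n x, cyc T n x -> bnd T n.+1 (lin l x)) \/
                (forall n x, cyc T n x -> bnd T n.+1 (lin l x) -> bnd T n x)) ->
     (forall U, subfam T U -> ~ (forall n, U n `<=` bnd T n) ->
        Phi (restr (cyc T) U)) -> Phi T) ->
  forall T, gwf T -> comm T -> noeth T -> Phi T.
Proof.
move=> hext htr hbase T w c hn.
pose P U := Phi (restr (cyc T) U); suff: P (bnd T) by rewrite /P restr_eta.
apply: noeth_ind => // U sU IH; pose T1 := restr (cyc T) U.
have w1 : gwf T1 by apply: (subfam_wf w sU).2.
have n1 : noeth T1 by exact: noeth_quot.
have sub1 V : subfam T1 V -> subfam T V.
  move=> [s1 s2]; split=> // n; have [sV UV VZ] := s1 n; split=> //.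
  by apply: subset_trans UV; case: (sU.1 n).
have IH1 V : subfam T1 V -> ~ (forall n, V n `<=` U n) -> Phi (restr (cyc T) V).
  by move=> sV; apply: IH; [apply: sub1|move=> n; case: (sV.1 n)].
apply: contrapT => hP; apply: hP.
have [hlin|] := pselect (forall l,
   (forall n x, cyc T1 n x -> bnd T1 n.+1 (lin l x)) \/
   (forall n x, cyc T1 n x -> bnd T1 n.+1 (lin l x) -> bnd T1 n x)).
  exact: hbase.
move=> /existsNP [l /not_orP [h1 h2]].
(* The form [l] is neither zero nor injective on [T1], so [T1 / l T1] and [T1 / ker l] are proper
   quotients; the latter, shifted by one degree, is [l T1]. *)
have sK := @formker_sub T1 l w1 c; have sQ := @formquo_sub T1 l w1 c.
have pK : Phi (restr (cyc T) (cyc (formker T1 l))).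
  apply: IH1 => // h; apply: h2 => n x Zx Bx; apply: h; by split.
have pQ : Phi (restr (cyc T) (bnd (formquo T1 l))).
  apply: IH1 => // h; apply: h1 => n x Zx; apply: (h n.+1).
  by exists 0, x; rewrite add0r; split=> //; exact: (issub0 (bnd_sub n.+1 w1)).
apply: (hext T1 _ w1 c sQ); last exact: pQ.
pose K1 := restr (cyc T) (cyc (formker T1 l)).
pose Q1 : gquo m := restr (bnd (formquo T1 l)) (bnd T1).
pose R n (x : K1 n) (y' : gshift Q1 n) := cyc T n x /\ U n.+1 (y' - lin l x).
apply: (htr K1 Q1 R) => //.
- exact: (subfam_wf w1 sK).2.
- exact: (subfam_wf w1 sQ).1.
have sU' n : issub (U n) by case: (sU.1 n).
split; first split=> [n|j n x x' [Zx Ux]] /=.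
- split=> /=.
  + by rewrite /R linear0 subrr; split; [exact: (issub0 (cyc_sub n w))|exact: (issub0 (sU' n.+1))].
  + move=> a x y x' y' [Zx Ux] [Zy Uy]; split.
      by case: (cyc_sub n w) => _; apply.
    by rewrite linP opprD addrACA -scalerBr; case: (sU' n.+1) => _; apply.
  + move=> x x' [Zx Ux]; split=> //; exists (x' - lin l x), x.
    by rewrite subrK.
  + by move=> x Zx; exists (lin l x); rewrite /R subrr; split=> //; exact: (issub0 (sU' n.+1)).
  + by move=> x x' [Zx Ux] [_ /= Ulx]; apply: (issubBr (sU' _) Ux).
- split; first by case: w => _ + _; apply.
  by rewrite -lin_gop // -linearB; apply: sU.2.
- by move=> n x x' [Zx Ux] Ux'; split=> //; apply: (issubBl (sU' _) Ux).
- move=> n x' [b [z [Ub Zz ->]]]; exists z; split=> //.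
  by rewrite addrK.
Qed.
End FixOps.
End Graded.
Arguments cyc {A m} T n _ : rename.
Arguments bnd {A m} T n _ : rename.
Arguments subfam {A m} T U.
Arguments exact3 {A m} T1 T2 T3.

(** * The Hilbert basis theorem *)

Section Polynomials.
Variable A : comNzRingType.

Section Extend.
Variables (m : nat) (W : gsys A m).

(* [W[X]]: in degree [n], the coefficient of [X^(n-i)] is the [i]-th component. *)
Fixpoint pxob (n : nat) : lmodType A :=
  match n with
  | 0%N => W 0%N
  | k.+1 => GRing.Lmodule.clone A (pxob k * W k.+1)%type _
  end.

Definition pxnew n (p : pxob n) : pxob n.+1 := (p, 0).
Fact pxnew_linear n : linear (@pxnew n).
Proof. by move=> a x y; rewrite /pxnew -[RHS]/(a *: x + y, a *: 0 + 0) scaler0 addr0. Qed.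
HB.instance Definition _ n :=
  GRing.isLinear.Build A (pxob n) (pxob n.+1) *:%R (@pxnew n) (@pxnew_linear n).

Fixpoint pxold (j : 'I_m) n : pxob n -> pxob n.+1 :=
  match n return pxob n -> pxob n.+1 with
  | 0%N => fun w => (0, gop W j 0%N w)
  | k.+1 => fun p => (pxold j p.1, gop W j k.+1 p.2)
  end.
Fact pxold_linear j n : linear (@pxold j n).
Proof.
elim: n => [|n IH] a x y /=.
  by rewrite linearP -[RHS]/(a *: 0 + 0, a *: gop W j 0%N x + gop W j 0%N y) scaler0 addr0.
by rewrite IH linearP.
Qed.
HB.instance Definition _ j n :=
  GRing.isLinear.Build A (pxob n) (pxob n.+1) *:%R (@pxold j n) (@pxold_linear j n).

Definition pxop (j : 'I_m.+1) n : {linear pxob n -> pxob n.+1} :=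
  match unlift ord0 j with Some i => @pxold i n | None => @pxnew n end.

Definition PX : gsys A m.+1 := GSys pxop.

Lemma PX_comm : comm W -> comm PX.
Proof.
move=> c i j n x /=; rewrite /pxop.
case: (unliftP ord0 i) => [i' _|_]; case: (unliftP ord0 j) => [j' _|_] //=;
  last by rewrite /pxnew linear0.
- by elim: n x => [|n IH] x /=; rewrite ?linear0 c ?IH.
- by rewrite /pxnew linear0.
Qed.

Definition pxset (Z : forall n, set (W n)) : forall n, set (pxob n) :=
  fix f n := match n return set (pxob n) with
  | 0%N => Z 0%N
  | k.+1 => [set p | f k p.1 /\ Z k.+1 p.2]
  end.

Arguments pxset : clear implicits.

Definition emb n : W n -> pxob n :=
  match n return W n -> pxob n with 0%N => id | k.+1 => fun w => (0, w) end.

Lemma emb_old j n (w : W n) : emb (gop W j n w) = pxold j (emb w).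
Proof. by case: n w => [|n] w //=; rewrite linear0. Qed.

Section Sets.
Variable Z : forall n, set (W n).
Arguments Z : clear implicits.
Hypothesis sZ : forall n, issub (Z n).

Lemma pxset_issub n : issub (pxset Z n).
Proof.
elim: n => [|n [h0 hL]]; [exact: (sZ 0%N)|split]; first exact: (conj h0 (issub0 (sZ n.+1))).
move=> a u v [Pu Zu] [Pv Zv]; split; first exact: hL.
by case: (sZ n.+1) => _; apply.
Qed.
Lemma pxset_new n p : pxset Z n p -> pxset Z n.+1 (pxnew p).
Proof. by move=> h; split=> //; apply: (issub0 (sZ n.+1)). Qed.
Lemma pxset_emb n w : Z n w -> pxset Z n (emb w).
Proof. by case: n w => [|n] w //= h; split=> //; apply: issub0 (pxset_issub n). Qed.
Lemma pxset_embV n w : pxset Z n (emb w) -> Z n w.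
Proof. by case: n w => [|n] w //= []. Qed.
Lemma pxset_old j n p : (forall n x, Z n x -> Z n.+1 (gop W j n x)) ->
  pxset Z n p -> pxset Z n.+1 (pxold j p).
Proof.
move=> h; elim: n p => [|n IH] p /=.
  by move=> Zp; split; [apply: (issub0 (sZ 0%N))|apply: h].
by move=> [Pp Zp]; split; [apply: IH|apply: h].
Qed.
End Sets.

Lemma pxsetS (Z Z' : forall n, set (W n)) n :
  (forall n, Z n `<=` Z' n) -> pxset Z n `<=` pxset Z' n.
Proof.
move=> h; elim: n => [|n IH] p /=; first exact: h.
by move=> [/IH ? /h ?].
Qed.

Lemma emb_lin n a (x y : W n) : emb (a *: x + y) = a *: emb x + emb y.
Proof.
case: n x y => [|n] x y //=; rewrite -[RHS]/(a *: 0 + 0, a *: x + y).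
by rewrite scaler0 addr0.
Qed.
End Extend.

Arguments pxset {m W} Z n _ : rename.

Definition PXq m (T : gquo A m) : gquo A m.+1 :=
  @GQuo A m.+1 (PX T) (pxset (cyc T)) (pxset (bnd T)).

Section Hilbert.
Variables (m : nat) (T : gquo A m).
Hypothesis w : gwf T.
Let sZ n : issub (cyc T n). Proof. exact: cyc_sub. Qed.
Let sB n : issub (bnd T n). Proof. exact: bnd_sub. Qed.

Lemma PXq_wf : gwf (PXq T).
Proof.
case: (w) => w1 w2 w3; split=> [n|j n x|j n x] /=.
- split; [exact: pxset_issub|exact: pxset_issub|].
  by apply: pxsetS => k; apply: bnd_cyc.
- rewrite /pxop; case: (unlift _ _) => [i|] /= h; last exact: pxset_new.
  by apply: pxset_old h => // k y; apply: w2.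
- rewrite /pxop; case: (unlift _ _) => [i|] /= h; last exact: pxset_new.
  by apply: pxset_old h => // k y; apply: w3.
Qed.

(** Closure under the new variable is left out because [down] does not preserve it. *)
Definition half (V : forall n, set (pxob T n)) :=
  (forall n, between (pxset (cyc T) n) (pxset (bnd T) n) (V n)) /\
  forall j n p, V n p -> V n.+1 (pxold j p).

(** Division by the new variable [X] with the constant term forgotten. Thus [low (iter i down V) n]
    consists of the coefficients of [X^i], lying in [T n], of the elements of [V] that have degree
    at most [i] in [X]: the leading coefficients of Hilbert's proof. *)
Definition down (V : forall n, set (pxob T n)) n : set (pxob T n) :=
  [set p | exists u : T n.+1, V n.+1 ((p, u) : pxob T n.+1)].

Arguments down : clear implicits.
Definition low (V : forall n, set (pxob T n)) n : set (T n) :=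
  [set u | V n (emb u)].

Arguments low : clear implicits.

Lemma half_down V : half V -> half (down V).
Proof.
move=> [h1 h2]; split=> [n|j n p [u Vu]]; last first.
  by exists (gop T j n.+1 u); apply: (h2 j n.+1 _ Vu).
have [sV BV VZ] := h1 n.+1; split.
- split; first by exists 0; exact: (issub0 sV).
  move=> a p p' [u Vu] [u' Vu']; exists (a *: u + u').
  by case: sV => _ h; exact: (h a _ _ Vu Vu').
- by move=> p Bp; exists 0; apply: BV; split=> //; exact: (issub0 (sB n.+1)).
- by move=> p [u /VZ []].
Qed.

Lemma low_sub V : half V -> subfam T (low V).
Proof.
move=> [h1 h2]; split=> [n|j n u]; last by move=> Vu; have := h2 j n _ Vu; rewrite -emb_old.
have [sV BV VZ] := h1 n; split.
- split; rewrite /low /=; first by case: n {h1} sV BV VZ => [|n] sV _ _; apply: issub0 sV.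
  by move=> a x y Vx Vy; rewrite emb_lin; case: sV => _; apply.
- by move=> u Bu; apply/BV/pxset_emb.
- by move=> u /VZ /pxset_embV.
Qed.

Lemma down_mono V V' : (forall n, V n `<=` V' n) -> forall n, down V n `<=` down V' n.
Proof. by move=> h n p [u /h Vu]; exists u. Qed.

(** The reduction step of Hilbert's basis theorem: subtracting an element of the smaller family with
    the same part above the constant term leaves [u - u'], which [low] controls. *)
Lemma px_compare (V V' : nat -> forall n, set (pxob T n)) :
  (forall i, half (V i)) -> (forall i, half (V' i)) ->
  (forall i, V i.+1 = down (V i)) -> (forall i, V' i.+1 = down (V' i)) ->
  (forall i n, V i n `<=` V' i n) -> (forall i n, low (V' i) n `<=` low (V i) n) ->
  forall n i, V' i n `<=` V i n.
Proof.
move=> hV hV' eV eV' VV' hlow; elim=> [|n IH] i p; first exact: (hlow i 0%N).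
case: p => p u V'p; have : V' i.+1 n p by rewrite eV'; exists u.
move/IH; rewrite eV => -[u' Vp].
have [[sV _ _] _] := ((hV i).1 n.+1, tt); have [[sV' _ _] _] := ((hV' i).1 n.+1, tt).
have : low (V' i) n.+1 (u - u').
  rewrite /low /=; have := issubB sV' V'p (VV' _ _ _ Vp).
  by rewrite -[X in V' i n.+1 X]/(p - p, u - u') subrr.
move/hlow => Vu; have := issubD sV Vu Vp.
by rewrite -[X in V i n.+1 X]/(0 + p, u - u' + u') add0r subrK.
Qed.

Lemma PX_noeth : noeth T -> noeth (PXq T).
Proof.
move=> hn c hc cc.
pose V k i := iter i down (c k).
have hV k i : half (V k i).
  elim: i => [|i IH] /=; last exact: half_down.
  split; first exact: (hc k).1.
  move=> j n p Vp; have := (hc k).2 (lift ord0 j) n p Vp.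
  by rewrite /= /pxop liftK.
have Vk k i n : V k i n `<=` V k.+1 i n.
  by elim: i n => [|i IH] n /=; [apply: cc|apply: down_mono].
have Vi k i n : V k i n `<=` V k i.+1 n.
  elim: i n => [|i IH] n /=; last exact: down_mono.
  move=> p Vp; exists 0; have := (hc k).2 ord0 n p Vp.
  by rewrite /= /pxop unlift_none.
have Vki k l i j n : (k <= l)%N -> (i <= j)%N -> V k i n `<=` V l j n.
  move=> kl ij; apply: (@subset_trans _ (V l i n)).
    exact: (@asc_le A m.+1 (PXq T) (fun k => V k i) k l n (fun k n => @Vk k i n) kl).
  exact: (@asc_le A m.+1 (PXq T) (fun i => V l i) i j n (fun i n => @Vi l i n) ij).
(* The diagonal stabilises at [K], which settles all exponents [i >= K] at once; the finitely many
   [i < K] are stabilised one at a time. *)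
have [|k n|K hK] := hn (fun k => low (V k k)).
- by move=> k; apply: low_sub.
- by move=> u; apply: Vki.
have [k1 hk1] : exists k1, forall i l n, (i < K)%N -> (k1 <= l)%N ->
    low (V l i) n `<=` low (V k1 i) n.
  elim: (K) => [|K' [k1 hk1]]; first by exists 0%N.
  have [|k n|k2 hk2] := hn (fun k => low (V k K')).
  - by move=> k; apply: low_sub.
  - by move=> u; apply: Vk.
  exists (maxn k1 k2) => i l n; rewrite ltnS leq_eqVlt geq_max => ilt /andP[k1l k2l].
  case/orP: ilt => [/eqP ->|iK] u.
    by move/(hk2 _ _ k2l); apply: Vki => //; apply: leq_maxr.
  by move/(hk1 _ _ _ iK k1l); apply: Vki => //; apply: leq_maxl.
exists (maxn K k1) => l n; rewrite geq_max => /andP[Kl k1l].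
apply: (@px_compare (V (maxn K k1)) (V l) (hV _) (hV _) _ _ _ _ n 0%N) => //.
  by move=> i k; apply: Vki => //; rewrite geq_max Kl.
move=> i k u; have [Ki|iK] := leqP K i; last first.
  by move/(hk1 _ _ _ iK k1l); apply: Vki => //; apply: leq_maxr.
move=> Vu; have : low (V (maxn l i) (maxn l i)) k u.
  by move: Vu; apply: Vki; [apply: leq_maxl|apply: leq_maxr].
move/hK => /(_ (leq_trans Kl (leq_maxl _ _))); apply: Vki => //.
exact: leq_maxl.
Qed.
End Hilbert.

Fixpoint PXqs m (T : gquo A 0) : gquo A m :=
  match m with 0%N => T | k.+1 => PXq (PXqs k T) end.

Lemma PXqs_comm m T : comm (PXqs m T).
Proof. by elim: m => [|m IH] => [[]|] //; apply: PX_comm. Qed.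

Lemma PXqs_wf m T : gwf T -> gwf (PXqs m T).
Proof. by move=> w; elim: m => //= m; apply: PXq_wf. Qed.

Lemma PXqs_noeth m T : gwf T -> noeth T -> noeth (PXqs m T).
Proof. by move=> w n; elim: m => //= m; apply/PX_noeth/PXqs_wf. Qed.
End Polynomials.
Arguments pxset {A m W} Z n _ : rename.

(** * Maps out of polynomial extensions *)

Section Universal.
Variable A : comNzRingType.

Definition gcompat m (W W' : gsys A m) (f : forall n, {linear W n -> W' n}) :=
  forall j n x, f n.+1 (gop W j n x) = gop W' j n (f n x).

Section Step.
Variables (m : nat) (W : gsys A m) (W' : gsys A m.+1).
Definition gtail : gsys A m := @GSys A m W' (fun j n => gop W' (lift ord0 j) n).
Variable u : forall n, {linear W n -> W' n}.

Fixpoint pxext n : pxob W n -> W' n :=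
  match n return pxob W n -> W' n with
  | 0%N => u 0%N
  | k.+1 => fun p => gop W' ord0 k (pxext p.1) + u k.+1 p.2
  end.
Fact pxext_linear n : linear (@pxext n).
Proof.
elim: n => [|n IH] a x y /=; first exact: linearP.
by rewrite IH !linearP scalerDr addrACA.
Qed.
HB.instance Definition _ n :=
  GRing.isLinear.Build A (pxob W n) (W' n) *:%R (@pxext n) (@pxext_linear n).

Lemma pxext_compat : comm W' -> @gcompat m W gtail u ->
  @gcompat m.+1 (PX W) W' (fun n => @pxext n).
Proof.
move=> c hu j n p /=; rewrite /pxop; case: (unliftP ord0 j) => [i ->|->] /=; last first.
  by rewrite linear0 addr0.
elim: n p => [|n IH] p /=; first by rewrite !linear0 add0r hu.
by rewrite IH hu linearD /= c.
Qed.

Lemma pxext_emb n x : pxext (emb x) = u n x.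
Proof. by case: n x => [|n] x //=; rewrite !linear0 add0r. Qed.

Lemma pxext_set (Z : forall n, set (W n)) (P : forall n, set (W' n)) n p :
  (forall n, issub (P n)) -> (forall j n x, P n x -> P n.+1 (gop W' j n x)) ->
  (forall n x, Z n x -> P n (u n x)) -> pxset Z n p -> P n (pxext p).
Proof.
move=> sP cP hu; elim: n p => [|n IH] p /=; first exact: hu.
by move=> [Pp Zp]; apply: issubD => //; [apply/cP/IH|apply: hu].
Qed.
End Step.

(** The universal property of the polynomial extension of [T0]. The last two clauses allow a family
    stable under the operators to be tested on [T0] alone, once for cycles and once for
    boundaries. *)
Lemma PXqs_ext m (T0 : gquo A 0) (W : gsys A m) (f : forall n, {linear T0 n -> W n}) :
  comm W -> gwf T0 -> exists (F : forall n, {linear PXqs m T0 n -> W n})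
     (e : forall n, T0 n -> PXqs m T0 n),
  [/\ gcompat F, forall n x, F n (e n x) = f n x,
      forall n x, cyc T0 n x -> cyc (PXqs m T0) n (e n x),
      forall P : forall n, set (W n), (forall n, issub (P n)) ->
        (forall j n x, P n x -> P n.+1 (gop W j n x)) ->
        (forall n x, cyc T0 n x -> P n (f n x)) ->
        forall n p, cyc (PXqs m T0) n p -> P n (F n p)
    & forall P : forall n, set (W n), (forall n, issub (P n)) ->
        (forall j n x, P n x -> P n.+1 (gop W j n x)) ->
        (forall n x, bnd T0 n x -> P n (f n x)) ->
        forall n p, bnd (PXqs m T0) n p -> P n (F n p)].
Proof.
move=> c w; elim: m W f c => [|m IH] W f c.
  by exists f, (fun n => id); split=> // -[].
have [//|F [e [Fc Fe ec Fz Fb]]] := IH (gtail W) f.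
  by move=> i j n x; apply: c.
exists (fun n => @pxext m (PXqs m T0) W F n), (fun n x => emb (e n x)); split.
- exact: pxext_compat.
- by move=> n x; apply: etrans (@pxext_emb m (PXqs m T0) W F n (e n x)) (Fe n x).
- move=> n x /ec h; apply: pxset_emb => // k; exact/cyc_sub/PXqs_wf.
- move=> P sP cP hf n p; apply: pxext_set => // k x.
  by apply: Fz => // j q y; apply: cP.
- move=> P sP cP hf n p; apply: pxext_set => // k x.
  by apply: Fb => // j q y; apply: cP.
Qed.
End Universal.

(** * Noetherian graded modules and generation in bounded degree *)

Section Noetherian.
Variable A : comNzRingType.
Implicit Types V : lmodType A.

Definition acc V (Z B : set V) := forall c : nat -> set V,
  (forall k, between Z B (c k)) -> (forall k, c k `<=` c k.+1) ->
  exists k, forall l, (k <= l)%N -> c l `<=` c k.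

Lemma asc_leq V (c : nat -> set V) k l :
  (forall k, c k `<=` c k.+1) -> (k <= l)%N -> c k `<=` c l.
Proof.
move=> h /subnKC <-; elim: (l - k)%N => [|p IH]; first by rewrite addn0.
by rewrite addnS; apply: subset_trans IH _; apply: h.
Qed.

Lemma acc_exact V1 V2 V3 (Z1 B1 : set V1) (Z2 B2 : set V2) (Z3 B3 : set V3) R S :
  mwf Z1 B1 -> mwf Z2 B2 -> mwf Z3 B3 -> mexact Z1 B1 Z2 B2 Z3 B3 R S ->
  acc Z1 B1 -> acc Z3 B3 -> acc Z2 B2.
Proof.
move=> w1 w2 w3 ex n1 n3 c hc cc.
have [k|k|k1 hk1] := n1 (fun k => mpre Z1 R (c k)).
- exact: (between_mpre w1 w2 ex).
- exact/mpreS.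
have [k|k|k3 hk3] := n3 (fun k => mim B3 S (c k)).
- exact: (between_mim w2 w3 ex).
- exact/mimS.
exists (maxn k1 k3) => l kl.
have [k1l k3l] : (k1 <= l)%N /\ (k3 <= l)%N.
  by split; apply: leq_trans kl; rewrite ?leq_maxl ?leq_maxr.
apply: (mexact_cmp w1 w2 w3 ex) => //.
- exact: asc_leq.
- by apply: (subset_trans (hk1 _ k1l)); apply/mpreS/(asc_leq cc)/leq_maxl.
- by apply: (subset_trans (hk3 _ k3l)); apply/mimS/(asc_leq cc)/leq_maxr.
Qed.

Definition gzero m (W : nat -> lmodType A) : gsys A m :=
  @GSys A m W (fun _ n => (\0 : {linear W n -> W n.+1})).

Definition base (W : nat -> lmodType A) (Z B : forall n, set (W n)) : gquo A 0 :=
  @GQuo A 0 (gzero 0 W) Z B.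

Lemma base_wf W Z B : (forall n, mwf (Z n) (B n)) -> gwf (@base W Z B).
Proof. by move=> h; split=> [//|[]|[]]. Qed.

Lemma base_noeth W Z B n0 : (forall n, mwf (Z n) (B n)) ->
  (forall n, (n <= n0)%N -> acc (Z n) (B n)) ->
  (forall n, (n0 < n)%N -> Z n `<=` B n) -> noeth (@base W Z B).
Proof.
move=> w h0 h1 c hc cc.
have [K hK] : exists K, forall n l, (n <= n0)%N -> (K <= l)%N -> c l n `<=` c K n.
  elim: n0 h0 {h1} => [|p IH] h0.
    have [k|k|K hK] := h0 0%N isT (fun k => c k 0%N).
    - exact: (hc k).1.
    - exact: cc.
    by exists K => n l; rewrite leqn0 => /eqP -> /hK.
  have [|K1 h1] := IH; first by move=> n np; apply: h0; apply: leqW.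
  have [k|k|K2 h2] := h0 p.+1 (leqnn _) (fun k => c k p.+1).
  - exact: (hc k).1.
  - exact: cc.
  exists (maxn K1 K2) => n l np; rewrite geq_max => /andP[l1 l2].
  move: np; rewrite leq_eqVlt => /orP[/eqP ->|np].
    by apply: subset_trans (h2 _ l2) _; apply: (asc_le cc); apply: leq_maxr.
  by apply: subset_trans (h1 _ _ np l1) _; apply: (asc_le cc); apply: leq_maxl.
exists K => l n Kl; have [np|np] := leqP n n0; first exact: hK.
have [_ _ h] := (hc l).1 n; have [_ h' _] := (hc K).1 n.
by apply: subset_trans h _; apply: subset_trans (h1 _ np) _.
Qed.

Lemma noeth_slice m (T : gquo A m) n : gwf T -> noeth T -> acc (cyc T n) (bnd T n).
Proof.
elim: n T => [|n IH] T w hn; last exact: (IH (gshift T) (gshift_wf w) (gshift_noeth w hn)).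
move=> c hc cc.
(* A chain in degree 0 becomes one of graded submodules by taking everything in positive degrees. *)
have [k|k [|p]|k hk] := hn (fun k => unsh (c k) (fun p => cyc T p.+1)).
- split=> [[|p]|j [|p] x]; first exact: hc.
  + by split; [exact: cyc_sub|exact: bnd_cyc|].
  + by move=> cx; have [_ _ h] := hc k; case: w => _ h1 _; apply: h1; apply: h.
  + by case: w => _ h1 _; apply: h1.
- exact: cc.
- exact: subset_refl.
by exists k => l kl; apply: (hk l 0%N).
Qed.

(** [T] is the image of the polynomial extension of its truncation to degrees [<= n0], and that
    extension is noetherian by Hilbert's theorem. *)
Lemma noeth_gen m (T : gquo A m) n0 : gwf T -> comm T ->
  (forall n, (n <= n0)%N -> acc (cyc T n) (bnd T n)) ->
  (forall n x, (n0 <= n)%N -> cyc T n.+1 x -> exists z : 'I_m -> T n,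
     (forall j, cyc T n (z j)) /\ bnd T n.+1 (x - \sum_j gop T j n (z j))) ->
  noeth T.
Proof.
move=> w c h0 hgen.
pose Z n := if (n <= n0)%N then cyc T n else bnd T n.
have hZ n : mwf (Z n) (bnd T n).
  rewrite /Z; case: ifP => _; first exact: gwf_m.
  by split; [exact: bnd_sub|exact: bnd_sub|].
pose T0 := @base T Z (bnd T); have w0 : gwf T0 by apply: base_wf.
have nT0 : noeth T0.
  apply: (@base_noeth _ _ _ n0) => // n hn; rewrite /Z; first by rewrite hn; apply: h0.
  by rewrite leqNgt hn.
have [F [e [Fc Fe ec Fz Fb]]] := @PXqs_ext A m T0 T (fun n => idfun) c w0.
have nP := @PXqs_noeth A m T0 w0 nT0; have wP := @PXqs_wf A m T0 w0.
have FZ n p : cyc (PXqs m T0) n p -> cyc T n (F n p).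
  apply: (Fz (cyc T)) => [k|j k x|k x]; [exact: cyc_sub|by case: w => _ + _; apply|].
  by rewrite /= /Z; case: ifP => // _ /bnd_cyc; apply.
have FB n p : bnd (PXqs m T0) n p -> bnd T n (F n p).
  apply: (Fb (bnd T)) => [k|j k x|k x] //; [exact: bnd_sub|by case: w => _ _; apply].
pose R n (p : PXqs m T0 n) x := cyc (PXqs m T0) n p /\ F n p = x.
have hR : ghom R.
  split=> [n|j n p _ [Zp <-]].
  - split=> [|a p q _ _ [Zp <-] [Zq <-]|p _ [Zp <-]|p Zp|p _ [_ <-]].
    + by split; [apply: (issub0 (cyc_sub n wP))|rewrite linear0].
    + by split; [case: (cyc_sub n wP) => _; apply|rewrite linearP].
    + by split=> //; apply: FZ.
    + by exists (F n p).
    + exact: FB.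
  - by split; [case: wP => _ + _; apply|apply: Fc].
pose Im n x := exists p b, [/\ cyc (PXqs m T0) n p, bnd T n b & x = F n p + b].
have ImZ n x : cyc T n x -> Im n x.
  elim: n x => [|n IH] x Zx.
    exists (e 0%N x), 0; split; [exact: ec|exact: (issub0 (bnd_sub 0%N w))|].
    by rewrite Fe addr0.
  have [nn|nn] := leqP n.+1 n0.
    exists (e n.+1 x), 0; split; [|exact: (issub0 (bnd_sub n.+1 w))|].
      by apply: ec; rewrite /= /Z nn.
    by rewrite Fe addr0.
  have [z [Zz Bx]] := hgen _ _ nn Zx.
  have /choice [pb hpb] j : exists pb : PXqs m T0 n * T n,
      [/\ cyc (PXqs m T0) n pb.1, bnd T n pb.2 & z j = F n pb.1 + pb.2].
    by have [p [b h]] := IH _ (Zz j); exists (p, b).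
  exists (\sum_j gop (PXqs m T0) j n (pb j).1),
    ((x - \sum_j gop T j n (z j)) + \sum_j gop T j n (pb j).2); split.
  - apply: issub_sum; first exact: cyc_sub.
    by move=> j _; case: wP => _ + _; apply; case: (hpb j).
  - apply: issubD => //; first exact: bnd_sub.
    apply: issub_sum; first exact: bnd_sub.
    by move=> j _; case: w => _ _; apply; case: (hpb j).
  have -> : \sum_j gop T j n (z j) = F n.+1 (\sum_j gop (PXqs m T0) j n (pb j).1)
      + \sum_j gop T j n (pb j).2.
    rewrite linear_sum /= -big_split /=; apply: eq_bigr => j _.
    by have [_ _ ->] := hpb j; rewrite linearD /= Fc.
  by rewrite addrC opprD addrA !subrK.
apply: (@noeth_exact _ _ (PXqs m T0) T (restr (bnd T) (bnd T))) nP _ => //.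
- by split=> [n|j n x|j n x] /=; [split=> //; apply: bnd_sub|case: w => _ _; apply..].
- exists R, (fun n x y => cyc T n x /\ y = 0); split=> // [|n x _ [Zx ->] _].
    split=> [n|j n x x' [Zx ->]]; last first.
      by split; [case: w => _ + _; apply|rewrite linear0].
    have s0 := issub0 (bnd_sub n w).
    split=> [|a x y _ _ [Zx ->] [Zy ->]|x _ [Zx ->]|x Zx|x _ [Zx ->]] //=.
    + by split=> //; apply: (issub0 (cyc_sub n w)).
    + by split; [case: (cyc_sub n w) => _; apply|rewrite scaler0 addr0].
    + by exists 0.
  have [p [b [Zp Bb ->]]] := ImZ _ _ Zx; exists p, (F n p); split=> //.
  by rewrite addrC addKr.
- move=> ch hch _; exists 0%N => l n _.
  have [_ _ h] := (hch l).1 n; have [_ h' _] := (hch 0%N).1 n.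
  exact: subset_trans h h'.
Qed.
End Noetherian.

(** * Finitely generated modules *)

Section FinGen.
Variable A : comNzRingType.
Implicit Types V : lmodType A.

Definition spanset V n (e : 'I_n -> V) : set V :=
  [set x | exists c : 'I_n -> A, x = \sum_i c i *: e i].

Lemma spanset_sub V n (e : 'I_n -> V) : issub (spanset e).
Proof.
split; first by exists (fun=> 0); rewrite big1 // => i _; rewrite scale0r.
move=> a _ _ [c ->] [c' ->]; exists (fun i => a * c i + c' i).
rewrite scaler_sumr -big_split; apply: eq_bigr => i _ /=.
by rewrite scalerDl scalerA.
Qed.

Lemma spanset_gen V n (e : 'I_n -> V) i : spanset e (e i).
Proof.
exists (fun j => (j == i)%:R); rewrite (bigD1 i) //= eqxx scale1r big1 ?addr0 //.
by move=> j /negPf ->; rewrite scale0r.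
Qed.

Lemma spanset_least V n (e : 'I_n -> V) U :
  issub U -> (forall i, U (e i)) -> spanset e `<=` U.
Proof. by move=> sU h x [c ->]; apply: issub_sum => // i _; apply: issubZ. Qed.

Lemma span_spansetE V n (e : 'I_n -> V) (x : V) : (x \in Defs.span (range e)) <-> spanset e x.
Proof.
split=> [/asboolP[k [c [f [hf ->]]]]|[c ->]].
  apply: issub_sum; first exact: spanset_sub.
  move=> i _; apply: issubZ; first exact: spanset_sub.
  by have [j _ <-] := hf i; apply: spanset_gen.
by apply/asboolP; exists n, c, e; split=> // i; exists i.
Qed.

Lemma fin_genE V : fin_gen V <-> exists n (e : 'I_n -> V), setT `<=` spanset e.
Proof.
split=> -[n [e h]]; exists n, e => x; first by move=> _; apply/span_spansetE/h.
exact/span_spansetE/h.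
Qed.

Definition scons V n (x : V) (e : 'I_n -> V) : 'I_n.+1 -> V :=
  fun i => oapp e x (unlift ord0 i).

Lemma spanset_cons V n (x : V) (e : 'I_n -> V) y :
  spanset (scons x e) y <-> exists a z, spanset e z /\ y = a *: x + z.
Proof.
split=> [[c ->]|[a [_ [[c ->] ->]]]].
  exists (c ord0), (\sum_i c (lift ord0 i) *: e i); split; first by exists (fun i => c (lift ord0 i)).
  rewrite big_ord_recl /scons unlift_none; congr (_ + _).
  by apply: eq_bigr => i _; rewrite liftK.
exists (fun i => oapp c a (unlift ord0 i)); rewrite big_ord_recl /scons unlift_none /=.
by congr (_ + _); apply: eq_bigr => i _; rewrite liftK.
Qed.

Definition smp V (U : set V) of issub U : pred V := fun x => `[< U x >].
Fact smp_closed V (U : set V) (h : issub U) : submod_closed (smp h).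
Proof.
split; first exact/asboolP/(issub0 h).
by move=> a u v /asboolP Uu /asboolP Uv; apply/asboolP; case: h => _; apply.
Qed.
HB.instance Definition _ V (U : set V) (h : issub U) :=
  GRing.isSubmodClosed.Build A V (smp h) (smp_closed h).
Definition smod V (U : set V) (h : issub U) : submodClosed V :=
  GRing.SubmodClosed.clone A V (smp h) _.
Lemma smodE V (U : set V) (h : issub U) (x : V) : (x \in smod h) <-> U x.
Proof. by split=> [/asboolP|/asboolP]. Qed.

Lemma submodClosed_issub V (W : submodClosed V) : issub [set x | x \in W].
Proof. by have [h0 h] := submodClosedP W; split=> // a u v; apply: h. Qed.

Lemma issub_zero V : issub [set (0 : V)].
Proof. by split=> // a u v /= -> ->; rewrite scaler0 addr0. Qed.

Lemma acc_max V (Z : set V) (P : set V -> Prop) U0 : issub Z ->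
  acc Z [set 0] -> issub U0 -> U0 `<=` Z -> P U0 -> exists U, [/\ issub U, U `<=` Z, P U &
    forall U', issub U' -> U' `<=` Z -> U `<=` U' -> P U' -> U' `<=` U].
Proof.
move=> sZ hn s0 Z0 P0.
(* [Z] placed in degree 0, with zero elsewhere and no operators, so that [noeth_max] applies. *)
pose T := @base A (fun _ => V) (fun n => if n is 0%N then Z else [set 0]) (fun _ => [set 0]).
have nT : noeth T.
  apply: (@base_noeth _ _ _ _ 0%N) => [n|n|n].
  - split; [by case: n => [|n] //; exact: issub_zero|exact: issub_zero|].
    by case: n => [|n] y //= ->; exact: issub0.
  - by rewrite leqn0 => /eqP ->.
  - by case: n => //= n _; exact: subset_refl.
pose ext (U : set V) (n : nat) : set V := if n is 0%N then U else [set 0].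
have sext U : issub U -> U `<=` Z -> subfam T (ext U).
  move=> sU UZ; split=> [[|n]|[]] //.
    by split=> // y /= ->; exact: issub0.
  by split; [exact: issub_zero|exact: subset_refl|exact: subset_refl].
have [U [[sU _] PU hU]] := @noeth_max A 0 T (fun U => P (U 0%N)) _ nT (sext _ s0 Z0) P0.
have [sU0 _ UZ] := sU 0%N.
exists (U 0%N); split=> // U' sU' UZ' UU' PU'.
apply: (hU (ext U') (sext _ sU' UZ') _ _ 0%N) => //.
by case=> [|n] //; have [_ _] := sU n.+1.
Qed.

Lemma acc_fg V (Z : set V) : issub Z -> acc Z [set 0] ->
  exists n (e : 'I_n -> V), (forall i, Z (e i)) /\ Z `<=` spanset e.
Proof.
move=> sZ hn.
have [U [sU UZ [n [e eU]] hU]] := @acc_max V Z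
   (fun U => exists n (e : 'I_n -> V), U = spanset e) (spanset (fun i : 'I_0 => (0 : V)))
   sZ hn (spanset_sub _) (spanset_least sZ (fun i => issub0 sZ))
   (ex_intro _ 0%N (ex_intro _ (fun i : 'I_0 => (0 : V)) erefl)).
exists n, e; split=> [i|x Zx]; first by apply: UZ; rewrite eU; apply: spanset_gen.
have hs : forall i, Z (scons x e i).
  move=> i; rewrite /scons; case: (unlift _ _) => [j|] //=.
  by apply: UZ; rewrite eU; apply: spanset_gen.
have : spanset (scons x e) `<=` U.
  apply: hU; [exact: spanset_sub|exact: spanset_least| |by exists n.+1, (scons x e)].
  by rewrite eU => y ey; apply/spanset_cons; exists 0, y; rewrite scale0r add0r.
rewrite eU; apply; apply/spanset_cons; exists 1, 0.
by rewrite scale1r addr0; split=> //; apply: issub0 (spanset_sub _).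
Qed.

Lemma acc_ring : noetherian A -> @acc A A^o setT [set 0].
Proof.
move=> hA c hc cc; pose U := [set x : A^o | exists k, c k x].
have cle k l x : (k <= l)%N -> c k x -> c l x by move=> kl; apply: (asc_leq cc kl).
have sc k : issub (c k) by case: (hc k).
have sU : issub U.
  split; first by exists 0%N; apply: issub0.
  move=> a u v [k ck] [l cl]; exists (maxn k l); case: (sc (maxn k l)) => _; apply.
    by apply: cle ck; apply: leq_maxl.
  by apply: cle cl; apply: leq_maxr.
have [n [e he]] := hA (smod sU).
have ee i : U (e i) by apply/(smodE sU); rewrite he; apply/span_spansetE/spanset_gen.
have [k hk] : exists k, forall i, c k (e i).
  have /choice [f hf] := ee; exists (\max_i f i)%N => i.
  by apply: cle (hf i); apply: leq_bigmax.
exists k => l kl x cx.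
have : U x by exists l.
move/(smodE sU); rewrite he => /span_spansetE.
exact: spanset_least.
Qed.

Lemma acc_lin V V' (Z B : set V) (Z' B' : set V') (f : {linear V -> V'}) :
  mwf Z B -> mwf Z' B' ->
  (forall x, Z x -> Z' (f x)) -> (forall x, B x -> B' (f x)) ->
  (forall y, Z' y -> exists2 x, Z x & B' (y - f x)) -> acc Z B -> acc Z' B'.
Proof.
move=> w w' fZ fB fs hn.
case: (w) => sZ sB BZ; case: (w') => sZ' sB' BZ'.
have s0 := issub0 sB'; have s0Z := issub0 sZ.
have hR : mhom Z B Z' B' (fun x y => Z x /\ y = f x).
  split=> [|a x y _ _ [Zx ->] [Zy ->]|x _ [Zx ->]|x Zx|x _ [_ ->]].
  + by rewrite linear0.
  + by split; [case: sZ => _; apply|rewrite linearP].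
  + by split=> //; apply: fZ.
  + by exists (f x).
  + exact: fB.
have hS : mhom Z' B' B' B' (fun x y => Z' x /\ y = 0).
  split=> [|a x y _ _ [Zx ->] [Zy ->]|x _ [Zx ->]|x Zx|x _ [_ ->]] //.
  + by split=> //; apply: (issub0 sZ').
  + by split; [case: sZ' => _; apply|rewrite scaler0 addr0].
  + by exists 0.
have wB : mwf B' B' by split.
have ex : mexact Z B Z' B' B' B' (fun x y => Z x /\ y = f x) (fun x y => Z' x /\ y = 0).
  split=> //.
  by move=> x _ [Zx ->] _; have [y Zy By] := fs _ Zx; exists y, (f y).
apply: (acc_exact w w' wB ex hn).
move=> c hc cc; exists 0%N => l _; have [_ _ h] := hc l; have [_ h' _] := hc 0%N.
exact: subset_trans h h'.
Qed.

Definition fmap V V' p (f : {linear V -> V'}) (v : {ffun 'I_p -> V}) : {ffun 'I_p -> V'} :=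
  [ffun k => f (v k)].
Fact fmap_linear V V' p (f : {linear V -> V'}) : linear (@fmap V V' p f).
Proof. by move=> a u v; apply/ffunP => k; rewrite !ffunE linearP. Qed.
HB.instance Definition _ V V' p (f : {linear V -> V'}) :=
  GRing.isLinear.Build A {ffun 'I_p -> V} {ffun 'I_p -> V'} *:%R
    (@fmap V V' p f) (@fmap_linear V V' p f).

Definition gpow_sys m (W : gsys A m) p : gsys A m :=
  @GSys A m (fun n => {ffun 'I_p -> W n}) (fun j n => @fmap (W n) (W n.+1) p (gop W j n)).

Definition gpow m (T : gquo A m) p : gquo A m := @GQuo A m (gpow_sys T p)
  (fun n => [set v | forall k, cyc T n (v k)]) (fun n => [set v | forall k, bnd T n (v k)]).

Lemma gpow_comm m (W : gsys A m) p : comm W -> comm (gpow_sys W p).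
Proof. by move=> c i j n v; apply/ffunP => k; rewrite !ffunE c. Qed.

Lemma pow_issub V (U : set V) p : issub U -> issub [set v : {ffun 'I_p -> V} | forall k, U (v k)].
Proof.
move=> sU; split=> [k|a u v Uu Uv k]; rewrite !ffunE; first exact: issub0.
by case: sU => _; apply.
Qed.

Lemma gpow_wf m (T : gquo A m) p : gwf T -> gwf (gpow T p).
Proof.
move=> w; split=> [n|j n v h k|j n v h k] /=.
- split; [exact/pow_issub/cyc_sub|exact/pow_issub/bnd_sub|].
  by move=> v h k; apply: bnd_cyc.
- by rewrite ffunE; case: w => _ + _; apply.
- by rewrite ffunE; case: w => _ _; apply.
Qed.

Lemma noeth_triv m (T : gquo A m) : (forall n, cyc T n `<=` bnd T n) -> noeth T.
Proof.
move=> h c hc _; exists 0%N => l n _.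
have [_ _ h1] := (hc l).1 n; have [_ h2 _] := (hc 0%N).1 n.
by apply: subset_trans h1 _; apply: subset_trans (h n) _.
Qed.

Lemma ghom_lin m (T T' : gquo A m) (f : forall n, {linear T n -> T' n}) :
  gwf T -> gcompat f -> (forall n x, cyc T n x -> cyc T' n (f n x)) ->
  (forall n x, bnd T n x -> bnd T' n (f n x)) ->
  ghom (fun n x y => cyc T n x /\ y = f n x).
Proof.
move=> w c hZ hB; split=> [n|j n x _ [Zx ->]]; last first.
  by split; [case: w => _ + _; apply|rewrite c].
split=> [|a x y _ _ [Zx ->] [Zy ->]|x _ [Zx ->]|x Zx|x _ [_ ->]].
- by split; [apply: (issub0 (cyc_sub n w))|rewrite linear0].
- by split; [case: (cyc_sub n w) => _; apply|rewrite linearP].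
- by split=> //; apply: hZ.
- by exists (f n x).
- exact: hB.
Qed.

Definition fproj V p (k : 'I_p) (v : {ffun 'I_p -> V}) : V := v k.
Fact fproj_linear V p (k : 'I_p) : linear (@fproj V p k).
Proof. by move=> a u v; rewrite /fproj !ffunE. Qed.
HB.instance Definition _ V p (k : 'I_p) :=
  GRing.isLinear.Build A {ffun 'I_p -> V} V *:%R (@fproj V p k) (@fproj_linear V p k).

Lemma gpow_noeth m (T : gquo A m) p : gwf T -> noeth T -> noeth (gpow T p).
Proof.
move=> w hn; have wp := gpow_wf p w.
(* The filtration of [T^p] by the coordinates below [q]; projection to coordinate [q] identifies the
   next factor with [T]. *)
pose Z (q : nat) n : set {ffun 'I_p -> T n} :=
  [set v : {ffun 'I_p -> T n} | forall k : 'I_p, cyc T n (v k) /\ ((q <= k)%N -> bnd T n (v k))].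
have sZ q : subfam (gpow T p) (Z q).
  split=> [n|j n v h k] /=; last first.
    rewrite ffunE; have [Zv Bv] := h k; split; first by case: w => _ + _; apply.
    by move=> /Bv; case: w => _ _; apply.
  split; last by move=> v h k; case: (h k).
    split=> [k|a u v hu hv k]; rewrite !ffunE.
      by split=> [|_]; [apply: (issub0 (cyc_sub n w))|apply: (issub0 (bnd_sub n w))].
    have [Zu Bu] := hu k; have [Zv Bv] := hv k.
    by split=> [|qk]; [case: (cyc_sub n w)|case: (bnd_sub n w)] => _; apply; auto.
  by move=> v h k; split=> // ; apply: bnd_cyc.
pose G q : gquo A m := @restr A m (gpow_sys T p) (Z q) (bnd (gpow T p)).
have wZ q : gwf (G q) := (subfam_wf wp (sZ q)).1.
suff h q : (q <= p)%N -> noeth (G q).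
  apply: noeth_restr (h p (leqnn p)) => n /= v hv k //.
  by split; [apply: hv|rewrite leqNgt ltn_ord].
elim: q => [|q IH] qp; first by apply: noeth_triv => n /= v hv k; apply: (hv k).2.
pose R n (u v : {ffun 'I_p -> T n}) := Z q n u /\ v = u.
pose S n (v : {ffun 'I_p -> T n}) x := Z q.+1 n v /\ x = v (Ordinal qp).
apply: (@noeth_exact _ _ _ _ T (wZ q) (wZ q.+1) w _ (IH (ltnW qp)) hn).
exists R, S; split.
- apply: (@ghom_lin _ (G q) (G q.+1)
    (fun n => idfun)) => // n v hv k.
  by have [Zv Bv] := hv k; split=> // /ltnW.
- apply: (@ghom_lin _ (G q.+1) T
    (fun n => @fproj (T n) p (Ordinal qp))).
  + exact: wZ.
  + by move=> j n v; rewrite /= /fproj ffunE.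
  + by move=> n v /(_ (Ordinal qp)) [].
  + by move=> n v /(_ (Ordinal qp)).
- move=> n v _ [hv ->] Bv; exists v, v; split; last first.
    by rewrite subrr; apply: issub0 (bnd_sub n wp).
  split=> // k; have [Zk Bk] := hv k; split=> //.
  rewrite leq_eqVlt => /orP[/eqP e|/Bk //].
  by have -> : k = Ordinal qp by apply/val_inj; rewrite /= -e.
Qed.

Lemma acc_pow V p : @acc A V setT [set 0] -> @acc A {ffun 'I_p -> V} setT [set 0].
Proof.
move=> hn.
pose T := @base A (fun _ => V) (fun n => if n is 0%N then setT else [set 0]) (fun _ => [set 0]).
have w : gwf T.
  by apply: base_wf => n; split; [case: n => [|n] //; exact: issub_zero|exact: issub_zero|case: n => [|n] y].
have nT : noeth T.
  apply: (@base_noeth _ _ _ _ 0%N) => [n|n|n].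
  - exact: (gwf_m n w).
  - by rewrite leqn0 => /eqP ->.
  - by case: n => //= n _; exact: subset_refl.
have := @noeth_slice A 0 (gpow T p) 0 (gpow_wf p w) (@gpow_noeth 0 T p w nT).
have -> : cyc (gpow T p) 0%N = setT by apply/seteqP; split.
have -> // : bnd (gpow T p) 0%N = [set 0].
by apply/seteqP; split=> v /= => [h|->] => [|k]; [apply/ffunP => k; rewrite h|]; rewrite ffunE.
Qed.

Lemma issubT V : issub [set: V]. Proof. by []. Qed.

Lemma mwf_full V : mwf [set: V] [set 0].
Proof. by split=> //; exact: issub_zero. Qed.

Definition comb V p (e : 'I_p -> V) (v : {ffun 'I_p -> A^o}) : V := \sum_i (v i : A) *: e i.
Fact comb_linear V p (e : 'I_p -> V) : linear (comb e).
Proof.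
move=> a u v; rewrite /comb scaler_sumr -big_split; apply: eq_bigr => i _ /=.
by rewrite !ffunE scalerDl scalerA.
Qed.
HB.instance Definition _ V p (e : 'I_p -> V) :=
  GRing.isLinear.Build A {ffun 'I_p -> A^o} V *:%R (comb e) (comb_linear e).

Lemma fg_acc V : noetherian A -> fin_gen V -> @acc A V setT [set 0].
Proof.
move=> hA /fin_genE [p [e he]].
apply: (acc_lin (f := comb e) (mwf_full _) (mwf_full _) _ _ _ (acc_pow (p := p) (acc_ring hA))) => //.
- by move=> x ->; rewrite linear0.
- move=> y _; have [c ->] := he y I; exists [ffun i => c i] => //=.
  by apply/eqP; rewrite subr_eq0; apply/eqP; apply: eq_bigr => i _; rewrite ffunE.
Qed.

Lemma acc_subset V (Z Z' B B' : set V) : Z `<=` Z' -> B' `<=` B -> acc Z' B' -> acc Z B.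
Proof.
move=> ZZ BB h c hc; apply: h => k; have [s b z] := hc k; split=> //.
  exact: subset_trans b.
exact: subset_trans ZZ.
Qed.

Lemma fg_sub V (Z : set V) : noetherian A -> fin_gen V -> issub Z ->
  exists n (e : 'I_n -> V), (forall i, Z (e i)) /\ Z `<=` spanset e.
Proof.
move=> hA hV sZ; apply: acc_fg => //.
by apply: acc_subset (fg_acc hA hV).
Qed.

Section Inclusion.
Variables (V : lmodType A) (W : submodClosed V).
Definition sinc (x : submod W) : V := val x.
Fact sinc_linear : linear sinc.
Proof. by move=> a x y; rewrite /sinc linearP. Qed.
HB.instance Definition _ := GRing.isLinear.Build A (submod W) V *:%R sinc sinc_linear.
Lemma sinc_inj : injective sinc. Proof. exact: val_inj. Qed.
Lemma sincP x : sinc x \in W. Proof. exact: (valP x). Qed.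
Definition smk (x : V) (h : x \in W) : submod W := exist _ x h.
Lemma smkK x h : sinc (@smk x h) = x. Proof. by []. Qed.
End Inclusion.

Lemma fg_submod V (W : submodClosed V) : noetherian A -> fin_gen V -> fin_gen (submod W).
Proof.
move=> hA hV; have [n [e [We he]]] := fg_sub hA hV (submodClosed_issub W).
apply/fin_genE; exists n, (fun i => smk (We i)) => x _.
have [c hc] := he _ (sincP x); exists c; apply: sinc_inj.
by rewrite hc linear_sum; apply: eq_bigr => i _; rewrite linearZ.
Qed.

Lemma fg_prod V V' : noetherian A -> fin_gen V -> fin_gen V' -> fin_gen (V * V')%type.
Proof.
move=> hA /fin_genE [p [e he]] /fin_genE [q [f hf]]; apply/fin_genE.
exists (p + q)%N, (fun i => match fintype.split i with inl j => (e j, 0) | inr j => (0, f j) end).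
move=> [x y] _; have [c ->] := he x I; have [b ->] := hf y I.
exists (fun i => match fintype.split i with inl j => c j | inr j => b j end).
have E1 (i : 'I_p) : fintype.split (lshift q i) = inl i := unsplitK (inl i).
have E2 (i : 'I_q) : fintype.split (rshift p i) = inr i := unsplitK (inr i).
rewrite big_split_ord /=.
under [X in _ = X + _]eq_bigr => i _ do rewrite E1.
under [X in _ = _ + X]eq_bigr => i _ do rewrite E2.
rewrite -[LHS]/(_, _); apply/eqP; rewrite -pair_eqE /pair_eq /= !raddf_sum /=.
by rewrite [X in _ == _ + X]big1 ?[X in _ && (_ == X + _)]big1 ?addr0 ?add0r ?eqxx // => i _; rewrite scaler0.
Qed.

Lemma fg_surj V V' (f : {linear V -> V'}) : (forall y, exists x, f x = y) ->
  fin_gen V -> fin_gen V'.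
Proof.
move=> fs /fin_genE [n [e he]]; apply/fin_genE; exists n, (fun i => f (e i)) => y _.
have [x <-] := fs y; have [c ->] := he x I; exists c.
by rewrite linear_sum; apply: eq_bigr => i _; rewrite linearZ.
Qed.

Lemma fg_row p : fin_gen 'rV[A]_p.
Proof.
apply/fin_genE; exists p, (fun i => delta_mx 0 i) => x _.
by exists (fun i => x 0 i); apply: row_sum_delta.
Qed.
End FinGen.

(** * Tensor products and free resolutions *)

Section Tensor.
Variable A : comNzRingType.
Implicit Types V : lmodType A.

Lemma tensor_mxE V p q (D : 'M[A]_(p, q)) (v : {ffun 'I_p -> V}) k :
  tensor_mx D v k = \sum_(j < p) D j k *: v j.
Proof. by rewrite ffunE. Qed.

Lemma tensor_mxM V p q r (D : 'M[A]_(p, q)) (E : 'M[A]_(q, r)) (v : {ffun 'I_p -> V}) :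
  tensor_mx (D *m E) v = tensor_mx E (tensor_mx D v).
Proof.
apply/ffunP => k; rewrite !tensor_mxE.
under [RHS]eq_bigr => j _ do rewrite tensor_mxE scaler_sumr.
rewrite exchange_big /=; apply: eq_bigr => i _.
rewrite mxE scaler_suml; apply: eq_bigr => j _.
by rewrite scalerA mulrC.
Qed.

Lemma tensor_mxDl V p q (D E : 'M[A]_(p, q)) (v : {ffun 'I_p -> V}) :
  tensor_mx (D + E) v = tensor_mx D v + tensor_mx E v.
Proof.
apply/ffunP => k; rewrite !ffunE -big_split; apply: eq_bigr => j _ /=.
by rewrite mxE scalerDl.
Qed.

Lemma tensor_mx0l V p q (v : {ffun 'I_p -> V}) : tensor_mx (0 : 'M[A]_(p, q)) v = 0.
Proof. by apply/ffunP => k; rewrite !ffunE big1 // => j _; rewrite mxE scale0r. Qed.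

Lemma tensor_mxNl V p q (D : 'M[A]_(p, q)) (v : {ffun 'I_p -> V}) :
  tensor_mx (- D) v = - tensor_mx D v.
Proof. by apply/eqP; rewrite -addr_eq0 -tensor_mxDl addNr tensor_mx0l. Qed.

Lemma tensor_mx1 V p (v : {ffun 'I_p -> V}) : tensor_mx (1%:M : 'M[A]_p) v = v.
Proof.
apply/ffunP => k; rewrite !ffunE (bigD1 k) //= mxE eqxx scale1r big1 ?addr0 //.
by move=> j /negPf jk; rewrite mxE jk scale0r.
Qed.

Lemma tensor_scalar V p (a : A) (v : {ffun 'I_p -> V}) :
  tensor_mx (a%:M : 'M[A]_p) v = a *: v.
Proof.
apply/ffunP => k; rewrite !ffunE (bigD1 k) //= mxE eqxx big1 ?addr0 //.
by move=> j /negPf jk; rewrite mxE jk scale0r.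
Qed.

Lemma tensor_nat V V' p q (D : 'M[A]_(p, q)) (f : {linear V -> V'}) v :
  tensor_mx D (fmap f v) = fmap f (tensor_mx D v).
Proof.
apply/ffunP => k; rewrite !ffunE linear_sum; apply: eq_bigr => j _.
by rewrite ffunE linearZ.
Qed.

Definition fl V p q (v : {ffun 'I_(p + q) -> V}) : {ffun 'I_p -> V} :=
  [ffun j => v (lshift q j)].
Definition fr V p q (v : {ffun 'I_(p + q) -> V}) : {ffun 'I_q -> V} :=
  [ffun j => v (rshift p j)].
Definition fjoin V p q (u : {ffun 'I_p -> V}) (w : {ffun 'I_q -> V}) : {ffun 'I_(p + q) -> V} :=
  [ffun k => match fintype.split k with inl j => u j | inr j => w j end].

Fact fl_linear V p q : linear (@fl V p q).
Proof. by move=> a u v; apply/ffunP => k; rewrite !ffunE. Qed.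
HB.instance Definition _ V p q :=
  GRing.isLinear.Build A {ffun 'I_(p + q) -> V} {ffun 'I_p -> V} *:%R (@fl V p q) (@fl_linear V p q).
Fact fr_linear V p q : linear (@fr V p q).
Proof. by move=> a u v; apply/ffunP => k; rewrite !ffunE. Qed.
HB.instance Definition _ V p q :=
  GRing.isLinear.Build A {ffun 'I_(p + q) -> V} {ffun 'I_q -> V} *:%R (@fr V p q) (@fr_linear V p q).

Lemma fl_join V p q (u : {ffun 'I_p -> V}) (w : {ffun 'I_q -> V}) : fl (fjoin u w) = u.
Proof. by apply/ffunP => k; rewrite !ffunE (unsplitK (inl k)). Qed.
Lemma fr_join V p q (u : {ffun 'I_p -> V}) (w : {ffun 'I_q -> V}) : fr (fjoin u w) = w.
Proof. by apply/ffunP => k; rewrite !ffunE (unsplitK (inr k)). Qed.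
Lemma fjoin_eq V p q (v v' : {ffun 'I_(p + q) -> V}) : fl v = fl v' -> fr v = fr v' -> v = v'.
Proof.
move=> /ffunP hl /ffunP hr; apply/ffunP => k; rewrite -[k]splitK.
case: (fintype.split k) => j; first by have := hl j; rewrite !ffunE.
by have := hr j; rewrite !ffunE.
Qed.

Section Block.
Variables (V : lmodType A) (p1 p2 q1 q2 : nat).
Variables (a : 'M[A]_(p1, q1)) (b : 'M[A]_(p1, q2)) (c : 'M[A]_(p2, q1)) (d : 'M[A]_(p2, q2)).
Lemma fl_block (v : {ffun 'I_(p1 + p2) -> V}) :
  fl (tensor_mx (block_mx a b c d) v) = tensor_mx a (fl v) + tensor_mx c (fr v).
Proof.
apply/ffunP => k; rewrite !ffunE big_split_ord /=.
by congr (_ + _); apply: eq_bigr => j _; rewrite ?block_mxEul ?block_mxEdl ffunE.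
Qed.
Lemma fr_block (v : {ffun 'I_(p1 + p2) -> V}) :
  fr (tensor_mx (block_mx a b c d) v) = tensor_mx b (fl v) + tensor_mx d (fr v).
Proof.
apply/ffunP => k; rewrite !ffunE big_split_ord /=.
by congr (_ + _); apply: eq_bigr => j _; rewrite ?block_mxEur ?block_mxEdr ffunE.
Qed.
End Block.

(** Flatness in matrix form: exactness of [A^p -> A^q -> A^r] survives the tensor product.
    Resolutions by free modules of finite rank ask for nothing more. *)
Definition flat V := forall p q r (D' : 'M[A]_(p, q)) (D : 'M[A]_(q, r)),
  (forall x : 'rV_q, x *m D = 0 -> exists y, x = y *m D') ->
  forall v : {ffun 'I_q -> V}, tensor_mx D v = 0 -> exists w, v = tensor_mx D' w.

Lemma flat_row n : flat 'rV[A]_n.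
Proof.
move=> p q r D' D ex v hv.
have /choice [y hy] (k : 'I_n) : exists y : 'rV_p, \row_j v j 0 k = y *m D'.
  apply: ex; apply/rowP => l; rewrite !mxE.
  have := congr1 (fun u : {ffun 'I_r -> 'rV[A]_n} => u l 0 k) hv.
  rewrite !ffunE /= !mxE summxE => h; rewrite -[RHS]h; apply: eq_bigr => j _.
  by rewrite !mxE mulrC.
exists [ffun i => \row_k y k 0 i]; apply/ffunP => j; apply/rowP => k.
have := congr1 (fun u : 'rV_q => u 0 j) (hy k); rewrite !mxE => ->.
rewrite ffunE summxE; apply: eq_bigr => i _.
by rewrite !mxE ffunE mxE mulrC.
Qed.

Lemma flat_prod V V' : flat V -> flat V' -> flat (V * V')%type.
Proof.
move=> h h' p q r D' D ex v hv.
have [w1 hw1] := h p q r D' D ex (fmap fst v)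
  (etrans (tensor_nat D fst v) (etrans (congr1 (fmap fst) hv) (linear0 _))).
have [w2 hw2] := h' p q r D' D ex (fmap snd v)
  (etrans (tensor_nat D snd v) (etrans (congr1 (fmap snd) hv) (linear0 _))).
exists [ffun i => (w1 i, w2 i)]; apply/ffunP => k.
have e1 : fmap fst [ffun i => (w1 i, w2 i)] = w1 by apply/ffunP => i; rewrite !ffunE.
have e2 : fmap snd [ffun i => (w1 i, w2 i)] = w2 by apply/ffunP => i; rewrite !ffunE.
rewrite -e1 tensor_nat in hw1; rewrite -e2 tensor_nat in hw2.
have := congr1 (fun f : {ffun _} => f k) hw1; have := congr1 (fun f : {ffun _} => f k) hw2.
by rewrite !ffunE; case: (v k) => a b /= -> ->; case: (\sum_i _).
Qed.

Lemma flat_retract V V' (f : {linear V -> V'}) (g : {linear V' -> V}) :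
  (forall x, f (g x) = x) -> flat V -> flat V'.
Proof.
move=> fg h p q r D' D ex v hv.
have [w hw] := h p q r D' D ex (fmap g v)
  (etrans (tensor_nat D g v) (etrans (congr1 (fmap g) hv) (linear0 _))).
exists (fmap f w); rewrite tensor_nat -hw; apply/ffunP => k.
by rewrite !ffunE fg.
Qed.
End Tensor.

(** * Free resolutions, lifts of maps and mapping cones *)

Section Resolutions.
Variable A : comNzRingType.
Implicit Types U V : lmodType A.

Definition rowcomb U p (e : 'I_p -> U) (x : 'rV[A]_p) : U := \sum_i x 0 i *: e i.
Fact rowcomb_linear U p (e : 'I_p -> U) : linear (rowcomb e).
Proof.
move=> a u v; rewrite /rowcomb scaler_sumr -big_split; apply: eq_bigr => i _ /=.
by rewrite !mxE scalerDl scalerA.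
Qed.
HB.instance Definition _ U p (e : 'I_p -> U) :=
  GRing.isLinear.Build A 'rV[A]_p U *:%R (rowcomb e) (rowcomb_linear e).

Lemma fg_cover U : fin_gen U ->
  exists p (f : {linear 'rV[A]_p -> U}), forall u, exists x, f x = u.
Proof.
move=> /fin_genE [p [e he]]; exists p, (rowcomb e) => u.
have [c ->] := he u I; exists (\row_i c i); apply: eq_bigr => i _.
by rewrite mxE.
Qed.

Lemma ker_matrix U p (f : {linear 'rV[A]_p -> U}) : noetherian A ->
  exists q (D : 'M[A]_(q, p)), forall x, f x = 0 <-> exists y, x = y *m D.
Proof.
move=> hA; have sK : issub [set x | f x = 0].
  split=> [|a u v /= hu hv]; first exact: linear0.
  by rewrite linearP hu hv scaler0 addr0.
have [q [e [He he]]] := fg_sub hA (fg_row A p) sK.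
exists q, (\matrix_i e i) => x; split=> [/he [c ->]|[y ->]].
  exists (\row_i c i); rewrite mulmx_sum_row; apply: eq_bigr => i _.
  by rewrite rowK mxE.
rewrite mulmx_sum_row linear_sum big1 // => i _.
by rewrite linearZ /= rowK (He i : f (e i) = 0) scaler0.
Qed.

Section Existence.
Hypothesis hA : noetherian A.
Variables (U : lmodType A) (p0 : nat) (f : {linear 'rV[A]_p0 -> U}).

(** The state of the recursion is a matrix with its two sizes; each step presents the kernel of the
    previous matrix. *)
Let st := {p : nat & {q : nat & 'M[A]_(p, q)}}.
Definition kerm p (V : lmodType A) (g : {linear 'rV[A]_p -> V}) := cid (ker_matrix g hA).
Definition st0 : st := existT _ (projT1 (kerm f)) (existT _ p0 (projT1 (cid (projT2 (kerm f))))).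
Definition stn (s : st) : st :=
  let D := projT2 (projT2 s) in
  existT _ (projT1 (kerm (mulmxr D)))
   (existT _ (projT1 s) (projT1 (cid (projT2 (kerm (mulmxr D)))))).
Definition sts i : st := iter i stn st0.
Definition srk i : nat := if i is j.+1 then projT1 (sts j) else p0.
Definition sdiff i : 'M[A]_(srk i.+1, srk i) :=
  match i return 'M[A]_(srk i.+1, srk i) with
  | 0%N => projT2 (projT2 st0)
  | j.+1 => projT2 (projT2 (stn (sts j)))
  end.

Lemma sdiff0 x : f x = 0 <-> exists y, x = y *m sdiff 0.
Proof. exact: (projT2 (cid (projT2 (kerm f)))). Qed.

Lemma sdiffS i (x : 'rV_(srk i.+1)) :
  x *m sdiff i = 0 <-> exists y, x = y *m sdiff i.+1.
Proof.
case: i x => [|i] x.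
  exact: (projT2 (cid (projT2 (kerm (mulmxr (projT2 (projT2 st0))))))).
exact: (projT2 (cid (projT2 (kerm (mulmxr (projT2 (projT2 (sts i.+1)))))))).
Qed.
End Existence.

Lemma free_resolution_exists U : noetherian A -> fin_gen U -> exists F : free_resolution U, True.
Proof.
move=> hA /fg_cover [p [f fs]].
by exists (FreeResolution fs (sdiff0 hA f) (@sdiffS hA U p f)).
Qed.

Lemma lift_matrix p q r (M : 'M[A]_(p, q)) (D : 'M[A]_(r, q)) :
  (forall x : 'rV_p, exists y, x *m M = y *m D) -> exists N : 'M[A]_(p, r), M = N *m D.
Proof.
move=> h; have /choice [y hy] (i : 'I_p) := h (delta_mx 0 i).
exists (\matrix_i y i); apply/row_matrixP => i.
by rewrite row_mul rowK -hy rowE.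
Qed.

Lemma diff_mul0 U (F : free_resolution U) i : diff F i.+1 *m diff F i = 0.
Proof.
apply/row_matrixP => j; rewrite row_mul row0.
by apply/diff_exact; exists (delta_mx 0 j); rewrite rowE.
Qed.

Lemma aug_diff0 U (F : free_resolution U) x : aug F (x *m diff F 0) = 0.
Proof. by apply/aug_exact; exists x. Qed.

Section Lift.
Variables (U' U : lmodType A) (F' : free_resolution U') (F : free_resolution U).
Variable f : {linear U' -> U}.

Lemma lift0 : exists N : 'M[A]_(rk F' 0, rk F 0), forall x, f (aug F' x) = aug F (x *m N).
Proof.
have /choice [y hy] (i : 'I_(rk F' 0)) := aug_surj F (f (aug F' (delta_mx 0 i))).
exists (\matrix_i y i) => x; rewrite {1}(row_sum_delta x) !linear_sum mulmx_sum_row linear_sum.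
by apply: eq_bigr => i _; rewrite !linearZ /= -hy rowK.
Qed.

Lemma lift1 (N : 'M[A]_(rk F' 0, rk F 0)) : (forall x, f (aug F' x) = aug F (x *m N)) ->
  exists N' : 'M[A]_(rk F' 1, rk F 1), N' *m diff F 0 = diff F' 0 *m N.
Proof.
move=> h; suff [N' ->] : exists N' : 'M[A]_(rk F' 1, rk F 1), diff F' 0 *m N = N' *m diff F 0.
  by exists N'.
apply: lift_matrix => x; apply/aug_exact.
by rewrite mulmxA -h aug_diff0 linear0.
Qed.

Definition sq i (N : 'M[A]_(rk F' i, rk F i)) (N' : 'M[A]_(rk F' i.+1, rk F i.+1)) :=
  N' *m diff F i = diff F' i *m N.

Lemma liftS i N N' : @sq i N N' -> exists N'', @sq i.+1 N' N''.
Proof.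
move=> h; suff [N'' e] : exists N'', diff F' i.+1 *m N' = N'' *m diff F i.+1 by exists N''.
apply: lift_matrix => x; apply/diff_exact.
by rewrite -!mulmxA h mulmxA mulmxA -(mulmxA x) diff_mul0 mulmx0 mul0mx.
Qed.

Lemma lift_exists : exists phi : forall i, 'M[A]_(rk F' i, rk F i),
  (forall x, f (aug F' x) = aug F (x *m phi 0%N)) /\ forall i, sq (phi i) (phi i.+1).
Proof.
have [N0 h0] := lift0; have [N1 h1] := lift1 h0.
(* A state is a pair of consecutive lifts with its commuting square, which is what the choice of the
   next lift requires. *)
pose T i := {N : 'M[A]_(rk F' i, rk F i) * 'M[A]_(rk F' i.+1, rk F i.+1) | sq N.1 N.2}.
pose next i (t : T i) : T i.+1 :=
  let h := cid (liftS (svalP t)) in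
  @exist _ (fun N : 'M[A]_(rk F' i.+1, rk F i.+1) * 'M[A]_(rk F' i.+2, rk F i.+2) => sq N.1 N.2)
    ((sval t).2, projT1 h) (projT2 h).
pose t0 : T 0%N :=
  @exist _ (fun N : 'M[A]_(rk F' 0, rk F 0) * 'M[A]_(rk F' 1, rk F 1) => @sq 0 N.1 N.2) (N0, N1) h1.
pose t := fix t i : T i := match i return T i with 0%N => t0 | j.+1 => next j (t j) end.
by exists (fun i => (sval (t i)).1); split=> // i; apply: (svalP (t i)).
Qed.
End Lift.

Section Cone.
Variables (U' U U'' : lmodType A) (F' : free_resolution U') (F : free_resolution U).
Variables (f : {linear U' -> U}) (g : {linear U -> U''}).
Hypotheses (f_inj : injective f) (g_surj : forall u, exists x, g x = u).
Hypothesis fg_exact : forall x, g x = 0 <-> exists y, f y = x.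
Variable phi : forall i, 'M[A]_(rk F' i, rk F i).
Hypothesis phi0 : forall x, f (aug F' x) = aug F (x *m phi 0%N).
Hypothesis phiS : forall i, sq (phi i) (phi i.+1).

(** The complex [F'] moved up by one index, with rank 0 at the bottom, so that [cone_diff] below is
    the mapping cone of [phi] and resolves the cokernel [U''] of [f]. *)
Definition prk i : nat := if i is j.+1 then rk F' j else 0%N.
Definition pdiff i : 'M[A]_(rk F' i, prk i) :=
  match i return 'M[A]_(rk F' i, prk i) with 0%N => 0 | j.+1 => diff F' j end.
Definition cone_rk i : nat := (rk F i + prk i)%N.
Definition cone_diff i : 'M[A]_(cone_rk i.+1, cone_rk i) :=
  block_mx (diff F i) 0 (phi i) (- pdiff i).
Definition cone_aug (x : 'rV[A]_(cone_rk 0)) : U'' := g (aug F (lsubmx x)).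
Fact cone_aug_linear : linear cone_aug.
Proof. by move=> a x y; rewrite /cone_aug !linearP. Qed.
HB.instance Definition _ :=
  GRing.isLinear.Build A 'rV[A]_(cone_rk 0) U'' *:%R cone_aug cone_aug_linear.

Lemma cone_mul i (x : 'rV[A]_(rk F i.+1)) (y : 'rV_(rk F' i)) :
  row_mx x y *m cone_diff i = row_mx (x *m diff F i + y *m phi i) (- (y *m pdiff i)).
Proof. by rewrite mul_row_block mulmx0 add0r mulmxN. Qed.

Lemma cone_surj u : exists x, cone_aug x = u.
Proof.
have [v <-] := g_surj u; have [x <-] := aug_surj F v; exists (row_mx x 0).
by rewrite /cone_aug row_mxKl.
Qed.

Lemma row_mx_eq0 p q (x : 'rV[A]_p) (y : 'rV[A]_q) : row_mx x y = 0 -> x = 0 /\ y = 0.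
Proof. by rewrite -row_mx0 => /eq_row_mx. Qed.

Lemma cone_aug_exact x : cone_aug x = 0 <-> exists y, x = y *m cone_diff 0.
Proof.
split=> [/fg_exact [u' hu']|[y ->]].
  have [v hv] := aug_surj F' u'.
  have : aug F (lsubmx x - v *m phi 0%N) = 0.
    by rewrite linearB /= -phi0 hv hu' subrr.
  move/aug_exact => [s hs]; exists (row_mx s v); rewrite cone_mul -hs subrK.
  by rewrite -[LHS]hsubmxK; congr row_mx; apply/rowP => -[].
rewrite -[y]hsubmxK cone_mul /cone_aug row_mxKl linearD /= aug_diff0 add0r.
by apply/fg_exact; exists (aug F' (rsubmx y)); rewrite phi0.
Qed.

Lemma cone_diff_mul0 i : cone_diff i.+1 *m cone_diff i = 0.
Proof.
rewrite /cone_diff mulmx_block !mul0mx !mulmx0 !addr0 diff_mul0 add0r mulNmx.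
rewrite (phiS i) subrr mulNmx mulmxN opprK.
have -> : pdiff i.+1 *m pdiff i = 0.
  by case: i => [|i] /=; rewrite ?mulmx0 ?diff_mul0.
by rewrite block_mx0.
Qed.

Lemma cone_exact i (x : 'rV_(cone_rk i.+1)) :
  x *m cone_diff i = 0 <-> exists y, x = y *m cone_diff i.+1.
Proof.
split=> [|[y ->]]; last by rewrite -mulmxA cone_diff_mul0 mulmx0.
rewrite -[x]hsubmxK; move: (lsubmx x) (rsubmx x) => u v {x}.
rewrite cone_mul => /row_mx_eq0 [h1 /eqP]; rewrite oppr_eq0 => /eqP h2.
(* At the bottom this is exactness of [F'] at its augmentation, reached through injectivity of
   [f]. *)
have [w hw] : exists w, v = w *m diff F' i.
  case: i u v h1 h2 => [|i] u v h1 h2 /=; last exact/diff_exact.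
  apply/aug_exact; apply: f_inj; rewrite phi0 linear0.
  move/eqP: h1; rewrite addrC addr_eq0 => /eqP ->.
  by rewrite linearN /= aug_diff0 oppr0.
have : (u + w *m phi i.+1) *m diff F i = 0.
  by rewrite mulmxDl -mulmxA (phiS i) mulmxA -hw.
move/diff_exact => [s hs]; exists (row_mx s (- w)); rewrite cone_mul -hs mulNmx addrK.
by rewrite mulNmx opprK -hw.
Qed.

Definition cone_res : free_resolution U'' :=
  @FreeResolution A U'' cone_rk cone_diff cone_aug cone_surj cone_aug_exact cone_exact.
End Cone.

(** This is [Tor_{i+1}(U, V) = 0]; the index is the one used by [torsys] below. *)
Definition hexact V U (F : free_resolution U) i :=
  forall v : {ffun 'I_(rk F i.+1) -> V}, tensor_mx (diff F i) v = 0 ->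
    exists w, v = tensor_mx (diff F i.+1) w.

Lemma tensor_diff0 V U (F : free_resolution U) i (w : {ffun 'I_(rk F i.+2) -> V}) :
  tensor_mx (diff F i) (tensor_mx (diff F i.+1) w) = 0.
Proof. by rewrite -tensor_mxM diff_mul0 tensor_mx0l. Qed.

Lemma flat_hexact V U (F : free_resolution U) i : flat V -> hexact V F i.
Proof. by move=> h v; apply: h => x /diff_exact. Qed.

(* A free resolution of [0] is contractible. *)
Lemma zero_hexact V U (F : free_resolution U) i : (forall u : U, u = 0) -> hexact V F i.
Proof.
move=> hU.
have [s0 hs0] : exists s : 'M[A]_(rk F 0, rk F 1), 1%:M = s *m diff F 0.
  by apply: lift_matrix => x; rewrite mulmx1; apply/aug_exact/hU.
have step j (s : 'M[A]_(rk F j, rk F j.+1)) : diff F j *m s *m diff F j = diff F j ->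
    exists s' : 'M[A]_(rk F j.+1, rk F j.+2), diff F j *m s + s' *m diff F j.+1 = 1%:M.
  move=> hs; have [x|s' hs'] := @lift_matrix _ _ _ (1%:M - diff F j *m s) (diff F j.+1).
    by apply/diff_exact; rewrite -mulmxA mulmxBl mul1mx hs subrr mulmx0.
  by exists s'; rewrite -hs' addrC subrK.
have [s [s' hs]] : exists s s', diff F i *m s + s' *m diff F i.+1 = 1%:M.
  elim: i => [|i [s [s' hs]]].
    by exists s0; apply: step; rewrite -mulmxA -hs0 mulmx1.
  exists s'; apply: step; rewrite -[RHS]mulmx1 -hs mulmxDr !mulmxA diff_mul0.
  by rewrite !mul0mx add0r.
move=> v hv; exists (tensor_mx s' v).
by rewrite -[LHS]tensor_mx1 -hs tensor_mxDl !tensor_mxM hv linear0 add0r.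
Qed.
End Resolutions.

(** * Finite projective dimension *)

Section Projective.
Variable A : comNzRingType.
Implicit Types V : lmodType A.

Section FreeCover.
Variable P : lmodType A.
Definition fdelta (p : P) : P -> A^o := fun x => (x == p)%:R.
Definition fgen (p : P) : (P -> A^o) * P := (fdelta p, p).
(* The free module on the set [P], as the graph of its evaluation map to [P]. *)
Definition graph_free : submodClosed ((P -> A^o) * P)%type := Defs.span (range fgen).

Lemma graph_freeP (x : (P -> A^o) * P) : x \in graph_free <->
  exists n (c : 'I_n -> A) (e : 'I_n -> P), x = \sum_i c i *: fgen (e i).
Proof.
split=> [/asboolP[n [c [e [he ->]]]]|[n [c [e ->]]]].
  have /choice [e' he'] (i : 'I_n) : exists p, fgen p = e i by have [p _ <-] := he i; exists p.
  by exists n, c, e'; apply: eq_bigr => i _; rewrite he'.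
apply/asboolP; by exists n, c, (fun i => fgen (e i)).
Qed.

Lemma sum_fgen n (c : 'I_n -> A) (e : 'I_n -> P) :
  \sum_i c i *: fgen (e i) = (fun x => \sum_i c i * (x == e i)%:R, \sum_i c i *: e i).
Proof.
elim: n c e => [|n IH] c e.
  rewrite !big_ord0; congr (_, _); apply/funext => x; by rewrite big_ord0.
rewrite big_ord_recl IH; congr (_, _) => /=; last by rewrite big_ord_recl.
by apply/funext => x; rewrite big_ord_recl.
Qed.

Lemma graph_free_inj (x : (P -> A^o) * P) : x \in graph_free -> x.1 = (fun _ => 0) -> x.2 = 0.
Proof.
move=> /graph_freeP [n [c [e ->]]]; rewrite sum_fgen /= => /funeqP hc.
have [|n0] := posnP n; first by move=> n0; subst n; rewrite big_ord0.
(* [h] picks one index for each value of [e]; grouping the sum along it makes each coefficient a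
   value of the first component, hence 0. *)
pose h (i : 'I_n) : 'I_n := odflt i [pick j | e j == e i].
have eh i : e (h i) = e i.
  by rewrite /h; case: pickP => [j /eqP //|/(_ i)]; rewrite eqxx.
have hh i j : e i = e j -> h i = h j.
  move=> eij; rewrite /h -eij; case: pickP => [//|/(_ i)]; by rewrite eqxx.
rewrite (partition_big h predT) //= big1 // => j _.
have [/existsP [i0 /eqP hi0]|/existsPn hj] := boolP [exists i, h i == j]; last first.
  by rewrite big1 // => i hij; have := hj i; rewrite hij.
rewrite (eq_bigr (fun i => c i *: e j)) => [|i /eqP <-]; last by rewrite eh.
rewrite -scaler_suml; suff -> : \sum_(i | h i == j) c i = 0 by rewrite scale0r.
rewrite -[RHS](hc (e j)) /= big_mkcond /=; apply: eq_bigr => i _.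
have -> : (h i == j) = (e j == e i).
  apply/eqP/eqP => [<-|eji]; first by rewrite eh.
  by rewrite (hh i i0) ?hi0 // -eji -hi0 eh.
by case: (_ == _); rewrite ?mulr1 ?mulr0.
Qed.

Lemma graph_free_supp (x : (P -> A^o) * P) : x \in graph_free ->
  exists s : seq P, forall k, x.1 k != 0 -> k \in s.
Proof.
move=> /graph_freeP [n [c [e ->]]]; rewrite sum_fgen /=; exists (map e (enum 'I_n)) => k.
apply: contra_neqT => hk; rewrite big1 // => i _.
case: eqP => [ki|]; last by rewrite mulr0.
by move: hk; rewrite ki map_f // mem_enum.
Qed.

Lemma graph_free_build (s : seq P) (y : P -> A) : uniq s ->
  exists x : (P -> A^o) * P, x \in graph_free /\
    forall k, x.1 k = if k \in s then y k else 0.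
Proof.
move=> us; exists (\sum_(i < size s) y (tnth (in_tuple s) i) *: fgen (tnth (in_tuple s) i)).
split; first by apply/graph_freeP; exists (size s), (fun i => y (tnth (in_tuple s) i)), (tnth (in_tuple s)).
move=> k; rewrite sum_fgen /=; case: ifPn => ks.
  have ki : (index k s < size s)%N by rewrite index_mem.
  have tk : tnth (in_tuple s) (Ordinal ki) = k by rewrite (tnth_nth k) /= nth_index.
  rewrite (bigD1 (Ordinal ki)) //= tk eqxx mulr1 big1 ?addr0 // => i ik.
  case: eqP => [e|]; last by rewrite mulr0.
  case/eqP: ik; apply/val_inj => /=; rewrite e (tnth_nth k) /= index_uniq //.
rewrite big1 // => i _; case: eqP => [e|]; last by rewrite mulr0.
by move: ks; rewrite e mem_tnth.
Qed.

Definition gfst (x : submod graph_free) : P -> A^o := (sinc x).1.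
Fact gfst_linear : linear gfst.
Proof. by move=> a x y; rewrite /gfst linearP. Qed.
HB.instance Definition _ :=
  GRing.isLinear.Build A (submod graph_free) (P -> A^o) *:%R gfst gfst_linear.

Lemma gfst_inj (x y : submod graph_free) : gfst x = gfst y -> x = y.
Proof.
move=> h; apply/eqP; rewrite -subr_eq0; apply/eqP.
have h1 : gfst (x - y) = 0 by rewrite linearB /= h subrr.
have h2 := graph_free_inj (sincP (x - y)) h1.
apply: sinc_inj; rewrite linear0; move: h1 h2; rewrite /gfst.
by case: (sinc _) => a b /= -> ->.
Qed.

Lemma gfst_tensor p q (D : 'M[A]_(p, q)) (v : {ffun 'I_p -> submod graph_free}) j k :
  gfst (tensor_mx D v j) k = \sum_i D i j * gfst (v i) k.
Proof.
rewrite ffunE linear_sum fct_sumE; apply: eq_bigr => i _.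
by rewrite linearZ.
Qed.

Lemma flat_graph : flat (submod graph_free).
Proof.
move=> p q r D' D ex v hv.
(* The system is solved at each point [k] separately; the zero solution is taken where all [v j]
   vanish, so that the family has finite support. *)
have /choice [y hy] k : exists y : 'rV[A]_p, \row_j (gfst (v j) k : A) = y *m D' /\
    ((forall j, gfst (v j) k = 0) -> y = 0).
  have [h0|h0] := pselect (forall j, gfst (v j) k = 0).
    by exists 0; split=> //; rewrite mul0mx; apply/rowP => j; rewrite !mxE h0.
  have [|y hy] := ex (\row_j (gfst (v j) k : A)); last by exists y.
  apply/rowP => l; rewrite !mxE.
  have := congr1 (fun u : {ffun 'I_r -> _} => gfst (u l) k) hv.
  rewrite gfst_tensor ffunE linear0 => e; apply: etrans e.
  by apply: eq_bigr => j _; rewrite mxE mulrC.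
have /choice [s hs] j := graph_free_supp (sincP (v j)).
pose S := undup (flatten [seq s j | j <- enum 'I_q]).
have hS j k : gfst (v j) k != 0 -> k \in S.
  move=> /hs ks; rewrite mem_undup; apply/flattenP; exists (s j) => //.
  by rewrite map_f // mem_enum.
have /choice [w hw] (i : 'I_p) := graph_free_build (fun k => y k 0 i) (undup_uniq _ : uniq S).
exists [ffun i => smk (hw i).1]; apply/ffunP => j; apply: gfst_inj; apply/funext => k.
rewrite gfst_tensor.
have := congr1 (fun u : 'rV_q => u 0 j) (hy k).1; rewrite !mxE => ->.
apply: eq_bigr => i _; rewrite ffunE /gfst smkK (hw i).2 mulrC.
case: ifPn => // kS; rewrite (hy k).2 ?mxE // => j'.
by apply/eqP; apply: contraNT kS; apply: hS.
Qed.
End FreeCover.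

(** A projective module is a retract of the free module on its underlying set; the modules in
    [pd_le] may be infinitely generated, so a cover of finite rank would not do. *)
Lemma projective_flat (P : lmodType A) : is_projective P -> flat P.
Proof.
move=> hP; pose X := submod (graph_free P).
pose pi : {linear X -> P} := (snd \o @sinc A _ (graph_free P))%FUN.
have pis y : exists x, pi x = y.
  have hy : fgen y \in graph_free P.
    apply/graph_freeP; exists 1%N, (fun=> 1), (fun=> y).
    by rewrite big_ord_recl big_ord0 addr0 scale1r.
  by exists (smk hy).
have [h hh] := hP X P pi idfun pis.
exact: (flat_retract hh (@flat_graph P)).
Qed.
End Projective.

(** * Vanishing of Tor above the projective dimension *)

Section ProjectiveDimension.
Variable A : comNzRingType.
Implicit Types V : lmodType A.

Section Corestriction.
Variables (V V' : lmodType A) (W : submodClosed V') (f : {linear V -> V'}).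
Hypothesis fW : forall x, f x \in W.
Definition cores (x : V) : submod W := smk (fW x).
Fact cores_linear : linear cores.
Proof. by move=> a x y; apply: sinc_inj; rewrite linearP !smkK linearP. Qed.
HB.instance Definition _ := GRing.isLinear.Build A V (submod W) *:%R cores cores_linear.
End Corestriction.

Lemma fmap_surj V V' p (f : {linear V -> V'}) : (forall y, exists x, f x = y) ->
  forall v : {ffun 'I_p -> V'}, exists u, fmap f u = v.
Proof.
move=> fs v; have /choice [u hu] (k : 'I_p) := fs (v k).
by exists [ffun k => u k]; apply/ffunP => k; rewrite !ffunE hu.
Qed.

Lemma fmap_inj V V' p (f : {linear V -> V'}) : injective f -> injective (@fmap A V V' p f).
Proof.
move=> fi u v /ffunP huv; apply/ffunP => k; apply: fi.
by have := huv k; rewrite !ffunE.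
Qed.

Lemma kernelP V V' (f : {linear V -> V'}) x : (x \in kernel f) <-> f x = 0.
Proof. by split=> [/eqP|/eqP]. Qed.

Lemma pd_kernel V n (P : nat -> lmodType A) (d : forall i, {linear P i.+1 -> P i})
    (e : {linear P 0%N -> V}) :
  (forall i, is_projective (P i)) -> 
  (forall x, e x = 0 <-> exists y, d 0%N y = x) ->
  (forall i x, d i x = 0 <-> exists y, d i.+1 y = x) ->
  (forall i, (n.+1 < i)%N -> forall x : P i, x = 0) -> pd_le (submod (kernel e)) n.
Proof.
move=> pP he hd h0.
have dk x : d 0%N x \in kernel e by apply/kernelP/he; exists x.
exists (fun i => P i.+1), (fun i => d i.+1), (cores dk); split=> //.
- move=> v; have /kernelP/he [y hy] := sincP v.
  by exists y; apply: sinc_inj; rewrite smkK.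
- move=> x; split=> [h|/hd h]; first by apply/hd; have := congr1 (@sinc A _ _) h; rewrite linear0.
  by apply: sinc_inj; rewrite smkK h linear0.
- by move=> i ni; apply: h0.
Qed.

(** Dimension shifting along [0 -> ker e -> P_0 -> V -> 0] with [P_0] flat, carried out as a diagram
    chase: each induction step trades one index for one unit of projective dimension. *)
Lemma pd_hexact V n : pd_le V n ->
  forall U (F : free_resolution U) i, (n <= i)%N -> hexact V F i.
Proof.
elim: n V => [|n IH] V [P [d [e [pP es he hd h0]]]] U F i ni v hv.
  have [p hp] := fmap_surj es v.
  have ei : injective e.
    move=> x y /eqP; rewrite -subr_eq0 -linearB => /eqP /he [z].
    rewrite (h0 1%N isT z) linear0 => /esym/eqP; by rewrite subr_eq0 => /eqP.
  have : tensor_mx (diff F i) p = 0.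
    by apply: (fmap_inj ei); rewrite -tensor_nat hp hv linear0.
  move/(flat_hexact (projective_flat (pP 0%N))) => [w hw].
  by exists (fmap e w); rewrite tensor_nat -hw hp.
have pK := pd_kernel pP he hd h0.
case: i ni v hv => [//|i] ni v hv.
have [p hp] := fmap_surj es v.
have hk k : tensor_mx (diff F i.+1) p k \in kernel e.
  apply/kernelP; have := congr1 (fun u : {ffun _ -> V} => u k) hv.
  by rewrite -hp tensor_nat !ffunE.
pose z : {ffun _ -> submod (kernel e)} := [ffun k => smk (hk k)].
have hz : fmap (@sinc A _ (kernel e)) z = tensor_mx (diff F i.+1) p.
  by apply/ffunP => k; rewrite [LHS]ffunE [z k]ffunE.
have [|w hw] := IH _ pK U F i ni z.
  by apply: (fmap_inj (@sinc_inj A _ (kernel e))); rewrite -tensor_nat hz tensor_diff0 linear0.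
have : tensor_mx (diff F i.+1) (p - fmap (@sinc A _ (kernel e)) w) = 0.
  by rewrite linearB /= tensor_nat -hw hz subrr.
move/(flat_hexact (projective_flat (pP 0%N))) => [q hq].
exists (fmap e q); rewrite tensor_nat -hq linearB /= hp.
have -> : fmap e (fmap (@sinc A _ (kernel e)) w) = 0.
  by apply/ffunP => k; rewrite !ffunE; apply/kernelP/sincP.
by rewrite subr0.
Qed.
End ProjectiveDimension.

(** * Tor as a graded module *)

Section TorSystems.
Variables (A : comNzRingType) (m : nat).
Implicit Types (W : gsys A m) (T : gquo A m) (U V : lmodType A).

(* [torsys F i W] is the graded system [n |-> Tor_{i+1}(U, W n)]. *)
Definition torsys U (F : free_resolution U) i W : gquo A m :=
  @GQuo A m (gpow_sys W (rk F i.+1))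
    (fun n => [set v | tensor_mx (diff F i) v = 0])
    (fun n => [set v | exists w, v = tensor_mx (diff F i.+1) w]).

Lemma torsys_mwf V U (F : free_resolution U) i :
  mwf [set v : {ffun 'I_(rk F i.+1) -> V} | tensor_mx (diff F i) v = 0]
      [set v | exists w, v = tensor_mx (diff F i.+1) w].
Proof.
split.
- split=> [|a u v /= hu hv]; first exact: linear0.
  by rewrite linearP /= hu hv scaler0 addr0.
- split=> [|a u v [w hw] [w' hw']]; first by exists 0; rewrite linear0.
  by exists (a *: w + w'); rewrite linearP /= -hw -hw'.
- by move=> v [w ->]; apply: tensor_diff0.
Qed.

Lemma torsys_wf U (F : free_resolution U) i W : gwf (torsys F i W).
Proof.
split=> [n|j n v /= hv|j n v [w hw]]; first exact: torsys_mwf.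
  by rewrite tensor_nat hv linear0.
by exists (fmap (gop W j n) w); rewrite tensor_nat -hw.
Qed.

Lemma torsys_comm U (F : free_resolution U) i W : comm W -> comm (torsys F i W).
Proof. exact: gpow_comm. Qed.

Definition full W : gquo A m := @GQuo A m W (fun n => setT) (fun n => [set 0]).
Lemma full_wf W : gwf (full W).
Proof.
split=> [n|//|j n x /= ->]; last exact: linear0.
exact: mwf_full.
Qed.

Lemma torsys_noeth U (F : free_resolution U) i W : noeth (full W) -> noeth (torsys F i W).
Proof.
move=> hn; have := @gpow_noeth A m (full W) (rk F i.+1) (full_wf W) hn.
apply: (@noeth_restr A m (gpow (full W) (rk F i.+1)) (cyc (torsys F i W)) (bnd (torsys F i W))) => n v //=.
by move=> hv; exists 0; rewrite linear0; apply/ffunP => k; rewrite ffunE; apply: hv.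
Qed.

Lemma gcompat_tensor W p q (D : 'M[A]_(p, q)) :
  @gcompat A m (gpow_sys W p) (gpow_sys W q)
    (fun n => @tensor_mx A (W n) p q D).
Proof. by move=> j n v; rewrite /= tensor_nat. Qed.

Definition gfun T T' (f : forall n, {linear T n -> T' n}) n (x : T n) (y : T' n) :=
  cyc T n x /\ y = f n x.

Lemma gfun_hom T T' (f : forall n, {linear T n -> T' n}) :
  gwf T -> gcompat f -> (forall n x, cyc T n x -> cyc T' n (f n x)) ->
  (forall n x, bnd T n x -> bnd T' n (f n x)) -> ghom (gfun f).
Proof. exact: ghom_lin. Qed.

(** A zero module on the ambient system of [T]; with it injectivity becomes an instance of
    [exact3]. *)
Definition nullsys T : gquo A m := restr (bnd T) (bnd T).
Lemma nullsys_wf T : gwf T -> gwf (nullsys T).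
Proof.
move=> w; split=> [n|j n x|j n x] /=; first by split=> //; exact: bnd_sub.
  by case: w => _ _; apply.
by case: w => _ _; apply.
Qed.

Lemma exact3_inj T T' R : gwf T -> @ghom A m T T' R ->
  (forall n x x', R n x x' -> bnd T' n x' -> bnd T n x) -> exact3 (nullsys T) T T'.
Proof.
move=> w hR hi; exists (fun n x y => bnd T n x /\ y = x), R; split=> //.
  apply: (@ghom_lin A m (nullsys T) T (fun n => idfun)) => //; first exact: nullsys_wf.
  by move=> n x /= /bnd_cyc; apply.
move=> n x x' Rx /(hi _ _ _ Rx) Bx; exists x, x; rewrite subrr; split=> //.
exact: (issub0 (bnd_sub n w)).
Qed.

(** As [exact3] is exactness at the middle term only, closure under submodules and quotients is
    included: put a zero module at the other end. *)
Definition serre (C : gquo A m -> Prop) :=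
  (forall T, gwf T -> comm T -> (forall n, cyc T n `<=` bnd T n) -> C T) /\
  forall T1 T2 T3, gwf T1 -> gwf T2 -> gwf T3 -> comm T1 -> comm T2 -> comm T3 ->
    exact3 T1 T2 T3 -> C T1 -> C T3 -> C T2.

Lemma serre_inj C T T' R : serre C -> gwf T -> comm T -> gwf T' -> comm T' ->
  @ghom A m T T' R ->
  (forall n x x', R n x x' -> bnd T' n x' -> bnd T n x) -> C T' -> C T.
Proof.
move=> [C0 C3] w c w' c' hR hi CT'.
have wt := nullsys_wf w.
apply: (C3 _ _ _ wt w w' c c c' (exact3_inj w hR hi)) => //.
by apply: C0 => // n x.
Qed.

Section FirstVariable.
Variables (U' U U'' : lmodType A) (F' : free_resolution U') (F : free_resolution U).
Variables (f : {linear U' -> U}) (g : {linear U -> U''}).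
Hypotheses (f_inj : injective f) (g_surj : forall u, exists x, g x = u).
Hypothesis fg_exact : forall x, g x = 0 <-> exists y, f y = x.
Variable phi : forall i, 'M[A]_(rk F' i, rk F i).
Hypothesis phi0 : forall x, f (aug F' x) = aug F (x *m phi 0%N).
Hypothesis phiS : forall i, sq (phi i) (phi i.+1).
Let G := cone_res f_inj g_surj fg_exact phi0 phiS.

Lemma tensor_sq V i (v : {ffun 'I_(rk F' i.+1) -> V}) :
  tensor_mx (diff F i) (tensor_mx (phi i.+1) v) = tensor_mx (phi i) (tensor_mx (diff F' i) v).
Proof. by rewrite -!tensor_mxM (phiS i). Qed.

Lemma cone_fl V i (x : {ffun 'I_(rk F i.+1 + rk F' i) -> V}) :
  fl (tensor_mx (diff G i) x) = tensor_mx (diff F i) (fl x) + tensor_mx (phi i) (fr x).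
Proof. exact: fl_block. Qed.
Lemma cone_fr V i (x : {ffun 'I_(rk F i.+1 + rk F' i) -> V}) :
  fr (tensor_mx (diff G i) x) = - tensor_mx (pdiff F' i) (fr x).
Proof. by rewrite [LHS]fr_block tensor_mx0l add0r tensor_mxNl. Qed.

Definition finl V p q (v : {ffun 'I_p -> V}) : {ffun 'I_(p + q) -> V} := fjoin v 0.
Fact finl_linear V p q : linear (@finl V p q).
Proof.
move=> a u v; apply: fjoin_eq; rewrite linearP /= /finl ?fl_join ?fr_join //.
by rewrite scaler0 addr0.
Qed.
HB.instance Definition _ (V : lmodType A) p q :=
  GRing.isLinear.Build A {ffun 'I_p -> V} {ffun 'I_(p + q) -> V} *:%R (@finl V p q)
    (@finl_linear V p q).

Definition rphi i W := @gfun (torsys F' i W) (torsys F i W) (fun n => @tensor_mx A (W n) _ _ (phi i.+1)).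
Lemma ghom_phi i W : ghom (@rphi i W).
Proof.
apply: gfun_hom.
- exact: torsys_wf.
- exact: gcompat_tensor.
- by move=> n x /= hx; rewrite tensor_sq hx linear0.
- by move=> n x [w ->]; exists (tensor_mx (phi i.+2) w); rewrite tensor_sq.
Qed.

Definition rinl i W := @gfun (torsys F i W) (torsys G i W) (fun n => @finl (W n) _ (rk F' i)).
Lemma ghom_inl i W : ghom (@rinl i W).
Proof.
apply: gfun_hom.
- exact: torsys_wf.
- move=> j n x; apply: fjoin_eq; apply/ffunP => k; rewrite !ffunE /=.
    by rewrite (unsplitK (inl k)) ffunE.
  by rewrite (unsplitK (inr k)) !ffunE linear0.
- move=> n x /= hx; apply: fjoin_eq.
    by rewrite (@cone_fl _ i) /finl fl_join fr_join hx !linear0 ?addr0.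
  by rewrite (@cone_fr _ i) /finl fr_join !linear0 ?oppr0.
- move=> n x [w ->]; exists (finl (rk F' i.+1) w); apply: fjoin_eq.
    by rewrite (@cone_fl _ i.+1) /finl !fl_join fr_join linear0 ?addr0.
  by rewrite (@cone_fr _ i.+1) /finl !fr_join linear0 ?oppr0.
Qed.

Lemma exact_first i W : exact3 (torsys F' i W) (torsys F i W) (torsys G i W).
Proof.
exists (@rphi i W), (@rinl i W); split.
- exact: ghom_phi.
- exact: ghom_inl.
move=> n x _ [Zx ->] [w hw].
have h1 : x = tensor_mx (diff F i.+1) (fl w) + tensor_mx (phi i.+1) (fr w).
  by rewrite -(@cone_fl _ i.+1) -hw /finl fl_join.
have h2 : tensor_mx (diff F' i) (fr w) = 0.
  have := congr1 (@fr _ _ _ _) hw; rewrite (@cone_fr _ i.+1) /finl fr_join => /eqP.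
  by rewrite eq_sym oppr_eq0 => /eqP.
exists (fr w), (tensor_mx (phi i.+1) (fr w)); split=> //.
by exists (fl w); rewrite h1 addrK.
Qed.

(** The connecting map of the long exact sequence is the projection of the cone to its [F']
    summand. *)
Lemma exact_conn i W : exact3 (torsys G i.+1 W) (torsys F' i W) (torsys F i W).
Proof.
exists (@gfun (torsys G i.+1 W) (torsys F' i W) (fun n => @fr A (W n) _ (rk F' i.+1))),
  (@rphi i W); split.
- apply: gfun_hom.
  + exact: torsys_wf.
  + by move=> j n x; apply/ffunP => k; rewrite !ffunE.
  + move=> n x /= hx; have := congr1 (@fr _ _ _ _) hx.
    by rewrite (@cone_fr _ i.+1) linear0 => /eqP; rewrite oppr_eq0 => /eqP.
  + move=> n x [w ->]; exists (- fr w).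
    by rewrite /= (@cone_fr _ i.+2) linearN.
- exact: ghom_phi.
move=> n x _ [Zx ->] [s hs]; exists (fjoin (- s) x), x; split; last first.
  by exists 0; rewrite linear0 subrr.
split; last by rewrite /= fr_join.
apply: fjoin_eq; rewrite linear0.
  by rewrite (@cone_fl _ i.+1) fl_join fr_join linearN /= -hs addNr.
by rewrite (@cone_fr _ i.+1) fr_join [tensor_mx _ x]Zx oppr0.
Qed.
End FirstVariable.
End TorSystems.

(** * Cones of linear forms on graded systems *)

Section SecondVariable.
Variables (A : comNzRingType) (m : nat).
Implicit Types (W : gsys A m) (T : gquo A m) (U V : lmodType A).

(** Free covers of the single pieces are extended polynomially, which gives operators compatible
    with [pi] while every piece stays flat and finitely generated. *)
Lemma cover_exists W : noetherian A -> comm W -> (forall n, fin_gen (W n)) ->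
  exists (G : gsys A m) (pi : forall n, {linear G n -> W n}),
  [/\ comm G, gcompat pi, forall n y, exists x, pi n x = y,
      forall n, flat (G n) & forall n, fin_gen (G n)].
Proof.
move=> hA c hW; have /choice [p hp] n := fg_cover (hW n).
pose L n : lmodType A := 'rV[A]_(p n).
pose f n : {linear L n -> W n} := projT1 (cid (hp n)).
have hf n : forall u, exists x, f n x = u := projT2 (cid (hp n)).
pose T0 := @base A L (fun n => setT) (fun n => [set 0]).
have w0 : gwf T0 by apply: base_wf => n; exact: mwf_full.
have [F [e [Fc Fe _ _ _]]] := @PXqs_ext A m T0 W f c w0.
exists (PXqs m T0), F; split=> //.
- exact: PXqs_comm.
- by move=> n y; have [x <-] := hf n y; exists (e n x).
- move=> n; elim: (m) n => [|k IH] n /=; first exact: flat_row.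
  by elim: n => [|n IHn] /=; [exact: IH|exact: (flat_prod IHn (IH _))].
- move=> n; elim: (m) n => [|k IH] n /=; first exact: fg_row.
  by elim: n => [|n IHn] /=; [exact: IH|exact: (fg_prod hA IHn (IH _))].
Qed.

Section ConeSystem.
Variables (W G : gsys A m) (pi : forall n, {linear G n -> W n.+1}) (l : 'I_m -> A).

(* [csys] is the mapping cone of [l : W -> W(1)], up to a shift: as [G] is flat, the
   kernel of [W_n + G_n -> W_(n+1)] computes its Tor in positive degrees. *)
Definition cmap n (x : (W n * G n)%type) : W n.+1 := lin l x.1 + pi n x.2.
Fact cmap_linear n : linear (@cmap n).
Proof. by move=> a x y; rewrite /cmap !linearP scalerDr addrACA. Qed.
HB.instance Definition _ n :=
  GRing.isLinear.Build A (W n * G n)%type (W n.+1) *:%R (@cmap n) (@cmap_linear n).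

Hypotheses (cW : comm W) (pic : @gcompat A m G (gshift_sys W) pi).

Definition cob n : lmodType A := submod (kernel (@cmap n)).
Definition cfst n (x : cob n) : W n := (sinc x).1.
Definition csnd n (x : cob n) : G n := (sinc x).2.
Fact cfst_linear n : linear (@cfst n).
Proof. by move=> a x y; rewrite /cfst linearP. Qed.
HB.instance Definition _ n :=
  GRing.isLinear.Build A (cob n) (W n) *:%R (@cfst n) (@cfst_linear n).
Fact csnd_linear n : linear (@csnd n).
Proof. by move=> a x y; rewrite /csnd linearP. Qed.
HB.instance Definition _ n :=
  GRing.isLinear.Build A (cob n) (G n) *:%R (@csnd n) (@csnd_linear n).

Lemma cobE n (x : cob n) : lin l (cfst x) + pi n (csnd x) = 0.
Proof. by apply/(kernelP (@cmap n) (sinc x))/sincP. Qed.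

Definition cmk n (w : W n) (g : G n) (h : lin l w + pi n g = 0) : cob n :=
  smk (proj2 (kernelP (@cmap n) (w, g)) h).
Lemma cfstK n w g h : cfst (@cmk n w g h) = w. Proof. by []. Qed.
Lemma csndK n w g h : csnd (@cmk n w g h) = g. Proof. by []. Qed.
Lemma cob_eq n (x y : cob n) : cfst x = cfst y -> csnd x = csnd y -> x = y.
Proof.
rewrite /cfst /csnd => h1 h2; apply: sinc_inj.
by move: h1 h2; case: (sinc x) => a b; case: (sinc y) => a' b' /= -> ->.
Qed.

Lemma cop_ker j n (x : cob n) : lin l (gop W j n (cfst x)) + pi n.+1 (gop G j n (csnd x)) = 0.
Proof.
rewrite pic /= -lin_gop // -linearD /= cobE; exact: linear0.
Qed.
Definition cop j n (x : cob n) : cob n.+1 := cmk (cop_ker j x).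
Fact cop_linear j n : linear (@cop j n).
Proof. by move=> a x y; apply: cob_eq; rewrite ?cfstK ?csndK !linearP. Qed.
HB.instance Definition _ j n :=
  GRing.isLinear.Build A (cob n) (cob n.+1) *:%R (@cop j n) (@cop_linear j n).

Definition csys : gsys A m := @GSys A m cob (fun j n => @cop j n).

Lemma csys_comm : comm G -> comm csys.
Proof. by move=> cG i j n x; apply: cob_eq; [apply: cW|apply: cG]. Qed.

Lemma csys_fg : noetherian A -> (forall n, fin_gen (W n)) -> (forall n, fin_gen (G n)) ->
  forall n, fin_gen (csys n).
Proof. by move=> hA fW fG n; apply: fg_submod => //; apply: fg_prod. Qed.

Hypotheses (pis : forall n y, exists x, pi n x = y) (Gflat : forall n, flat (G n)).
Variables (U : lmodType A) (F : free_resolution U) (i : nat).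

Lemma lin_gpow p n (v : {ffun 'I_p -> W n}) :
  lin (W := gpow_sys W p) l v = fmap (@lin A m W l n) v.
Proof.
apply/ffunP => k; rewrite ffunE /lin sum_ffunE; apply: eq_bigr => j _.
by rewrite !ffunE.
Qed.

Lemma ffun_cmk p n (w : {ffun 'I_p -> W n}) (g : {ffun 'I_p -> G n}) :
  fmap (@lin A m W l n) w + fmap (pi n) g = 0 -> exists c : {ffun 'I_p -> cob n},
    fmap (@cfst n) c = w /\ fmap (@csnd n) c = g.
Proof.
move=> h; have hk k : lin l (w k) + pi n (g k) = 0.
  by have := congr1 (fun u : {ffun _ -> W n.+1} => u k) h; rewrite !ffunE.
exists [ffun k => cmk (hk k)]; split; apply/ffunP => k; rewrite !ffunE //.
Qed.

Lemma ffun_cob_eq p n (c c' : {ffun 'I_p -> cob n}) :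
  fmap (@cfst n) c = fmap (@cfst n) c' -> fmap (@csnd n) c = fmap (@csnd n) c' -> c = c'.
Proof.
move=> /ffunP h1 /ffunP h2; apply/ffunP => k; apply: cob_eq.
  by have := h1 k; rewrite !ffunE.
by have := h2 k; rewrite !ffunE.
Qed.

Lemma ffun_cobE p n (c : {ffun 'I_p -> cob n}) :
  fmap (@lin A m W l n) (fmap (@cfst n) c) + fmap (pi n) (fmap (@csnd n) c) = 0.
Proof. by apply/ffunP => k; rewrite !ffunE cobE. Qed.

Let HW := torsys F i W.
Let HW1 := torsys F i.+1 W.
Let HC := torsys F i csys.
(** The left end of the exact sequence of the cone: the cokernel of [l] one homological index higher
    and one degree up. The right end is the kernel of [l] in index [i] itself. *)
Definition coker_l := gshift (formquo HW1 l).
Definition ker_l := formker HW l.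

(** The snake map without choices: a cycle over [W n.+1] is written as the image of [(w, g)], and
    the boundary of [(w, g)] then lies in the cone. *)
Definition rconn n (z : coker_l n) (c : HC n) := cyc coker_l n z /\
  exists (w : {ffun 'I_(rk F i.+2) -> W n}) (g : {ffun 'I_(rk F i.+2) -> G n}),
  [/\ z = fmap (@lin A m W l n) w + fmap (pi n) g,
      fmap (@cfst n) c = tensor_mx (diff F i.+1) w
    & fmap (@csnd n) c = tensor_mx (diff F i.+1) g].

Definition rfst := @gfun A m HC ker_l (fun n => @fmap A (cob n) (W n) _ (@cfst n)).

Lemma cyc_HC n (c : {ffun 'I_(rk F i.+1) -> cob n}) :
  tensor_mx (diff F i) (fmap (@cfst n) c) = 0 ->
  tensor_mx (diff F i) (fmap (@csnd n) c) = 0 -> cyc HC n c.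
Proof.
by move=> h1 h2; apply: ffun_cob_eq; rewrite linear0 -tensor_nat.
Qed.

Lemma rconn_cyc n z c : @rconn n z c -> cyc HC n c.
Proof.
by move=> [_ [w [g [_ h1 h2]]]]; apply: cyc_HC; rewrite ?h1 ?h2 tensor_diff0.
Qed.

Lemma pi_lift p n (v : {ffun 'I_p -> W n.+1}) : exists g, fmap (pi n) g = v.
Proof. exact/fmap_surj/pis. Qed.

Lemma rconn_tot n z : cyc coker_l n z -> exists c, @rconn n z c.
Proof.
(* As [pi] is surjective, a lift with [w = 0] exists. *)
move=> hz; have [g hg] := pi_lift z.
have [|c [h1 h2]] := @ffun_cmk _ n 0 (tensor_mx (diff F i.+1) g).
  by rewrite linear0 add0r -tensor_nat hg.
exists c; split=> //; exists 0, g; split=> //; last by rewrite h1 linear0.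
by rewrite linear0 add0r.
Qed.

Lemma rconn_lin n a x y x' y' : @rconn n x x' -> @rconn n y y' ->
  @rconn n (a *: x + y) (a *: x' + y').
Proof.
move=> [Zx [w [g [h1 h2 h3]]]] [Zy [w' [g' [h1' h2' h3']]]]; split.
  by case: (cyc_sub n.+1 (torsys_wf F i.+1 W)) => _; apply.
exists (a *: w + w'), (a *: g + g'); split.
- by rewrite h1 h1' !linearP scalerDr addrACA.
- by rewrite linearP /= h2 h2' linearP.
- by rewrite linearP /= h3 h3' linearP.
Qed.

Lemma coker_wf : gwf coker_l.
Proof. exact/gshift_wf/formquo_wf/torsys_comm/cW/torsys_wf. Qed.
Lemma ker_wf : gwf ker_l.
Proof. exact/formker_wf/torsys_comm/cW/torsys_wf. Qed.

(** From left to right this is well-definedness of the connecting map, from right to left its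
    injectivity, where flatness of [G] makes the difference of two [G]-components a boundary. *)
Lemma rconn_bnd n z c : @rconn n z c -> bnd coker_l n z <-> bnd HC n c.
Proof.
move=> [Zz [w [g [h1 h2 h3]]]]; split.
  move=> [_ [w0 [[b ->] Zw0 hz]]]; have [beta hb] := pi_lift b.
  have [|c' [e1 e2]] := @ffun_cmk _ n (w - w0) (g - tensor_mx (diff F i.+2) beta).
    have hz' : fmap (@lin A m W l n) w + fmap (pi n) g =
        tensor_mx (diff F i.+2) b + fmap (@lin A m W l n) w0.
      by rewrite -h1 -lin_gpow.
    by rewrite !linearB /= addrACA -opprD -tensor_nat hb hz' [X in _ - X]addrC subrr.
  exists c'; apply: ffun_cob_eq; rewrite -tensor_nat ?e1 ?e2 linearB /=.
    by rewrite h2 [X in _ - X]Zw0 subr0.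
  by rewrite h3 tensor_diff0 subr0.
move=> [c' hc']; have := ffun_cobE c'; move: hc'.
set w1 := fmap _ c'; set g1 := fmap (@csnd n) c' => hc' e.
have hw1 : tensor_mx (diff F i.+1) w1 = tensor_mx (diff F i.+1) w.
  by rewrite -h2 hc' -tensor_nat.
have hg1 : tensor_mx (diff F i.+1) g1 = tensor_mx (diff F i.+1) g.
  by rewrite -h3 hc' -tensor_nat.
have [|beta hb] := @flat_hexact A (G n) U F i.+1 (@Gflat n) (g - g1).
  by rewrite linearB /= hg1 subrr.
exists (fmap (pi n) (tensor_mx (diff F i.+2) beta)), (w - w1); split.
- by exists (fmap (pi n) beta); rewrite tensor_nat.
- by rewrite /= linearB /= hw1 subrr.
- rewrite -hb lin_gpow !linearB /= h1 -[LHS]subr0 -e opprD.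
  by rewrite addrACA addrC.
Qed.

Lemma rconn_hom : ghom rconn.
Proof.
split=> [n|j n z c [Zz [w [g [h1 h2 h3]]]]].
  split.
  - split; first by rewrite /= linear0.
    by exists 0, 0; rewrite !linear0 addr0.
  - exact: rconn_lin.
  - by move=> z c h; split; [case: h|apply: rconn_cyc h].
  - exact: rconn_tot.
  - by move=> z c /rconn_bnd [].
split; first by case: coker_wf => _ + _; apply.
exists (fmap (gop W j n) w), (fmap (gop G j n) g); split.
- rewrite h1 linearD /=; congr (_ + _); apply/ffunP => k; rewrite !ffunE.
    by rewrite lin_gop.
  by rewrite pic.
- rewrite tensor_nat -h2; apply/ffunP => k; rewrite !ffunE //.
- rewrite tensor_nat -h3; apply/ffunP => k; rewrite !ffunE //.
Qed.

Lemma rfst_hom : ghom rfst.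
Proof.
apply: gfun_hom.
- exact: torsys_wf.
- by move=> j n c; apply/ffunP => k; rewrite !ffunE.
- move=> n c /= hc; split; first by rewrite tensor_nat hc linear0.
  have [g' hg'] : exists g', fmap (@csnd n) c = tensor_mx (diff F i.+1) g'.
    by apply: (@flat_hexact A (G n) U F i (@Gflat n)); rewrite tensor_nat hc linear0.
  exists (- fmap (pi n) g'); rewrite linearN /= tensor_nat -hg'.
  by apply/eqP; rewrite lin_gpow -addr_eq0; apply/eqP/ffun_cobE.
- by move=> n c [c' ->]; exists (fmap (@cfst n) c'); rewrite tensor_nat.
Qed.

Lemma rfst_exact n c : cyc HC n c -> bnd HW n (fmap (@cfst n) c) ->
  exists z, @rconn n z c.
Proof.
move=> hc [w1 hw1].
have [g1 hg1] : exists g', fmap (@csnd n) c = tensor_mx (diff F i.+1) g'.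
  by apply: (@flat_hexact A (G n) U F i (@Gflat n)); rewrite tensor_nat [tensor_mx _ c]hc linear0.
exists (fmap (@lin A m W l n) w1 + fmap (pi n) g1); split; last by exists w1, g1.
rewrite /= linearD /= !tensor_nat -hw1 -hg1; exact: ffun_cobE.
Qed.

Lemma rfst_surj n w : cyc ker_l n w -> exists c, rfst c w.
Proof.
move=> [Zw [b hb]]; have [beta hbeta] := pi_lift b.
have [|c [h1 h2]] := @ffun_cmk _ n w (- tensor_mx (diff F i.+1) beta).
  by rewrite linearN /= -tensor_nat hbeta -hb lin_gpow subrr.
exists c; split=> //; apply: cyc_HC; rewrite ?h1 ?h2 //.
by rewrite linearN /= tensor_diff0 oppr0.
Qed.

Lemma exact_second : exact3 coker_l HC ker_l.
Proof.
exists rconn, rfst; split; [exact: rconn_hom|exact: rfst_hom|].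
move=> n c _ [Zc ->] Bc; have [z Rz] := rfst_exact Zc Bc.
by exists z, c; split=> //; rewrite subrr; apply: (issub0 (bnd_sub n (torsys_wf F i csys))).
Qed.

Lemma exact_coker : exact3 (nullsys coker_l) coker_l HC.
Proof.
by apply: (exact3_inj coker_wf rconn_hom) => n z c /rconn_bnd [].
Qed.

(** The exact sequence read in a single degree, for degrees fixed beforehand: vanishing of the cone
    in degree [n] makes [l] injective there in index [i], and [slice_coker] makes it surjective onto
    degree [n + 1] in index [i + 1]. *)
Lemma slice_ker n : cyc HC n `<=` bnd HC n ->
  forall w, cyc HW n w -> bnd HW n.+1 (lin l w) -> bnd HW n w.
Proof.
move=> h w Zw Bw; have [c [Zc ->]] := rfst_surj (conj Zw Bw).
have /= [c' ->] := h _ Zc; exists (fmap (@cfst n) c'); by rewrite tensor_nat.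
Qed.

Lemma slice_coker n : cyc HC n `<=` bnd HC n -> cyc coker_l n `<=` bnd coker_l n.
Proof.
move=> h z /rconn_tot [c Rc]; apply/(rconn_bnd Rc); apply: h.
exact: rconn_cyc Rc.
Qed.
End ConeSystem.
End SecondVariable.

(** * Hilbert polynomials *)

Section PolynomialGrowth.
Import Order.TTheory Num.Theory.
Implicit Types p q : {poly rat}.

Lemma poly_pos p : 0 < lead_coef p -> exists n0, forall n, (n0 <= n)%N -> 0 < p.[n%:R].
Proof.
(* Horner induction needs a positive lower bound: if [q] stays above [b > 0], then [q X + c] is at
   least 1 once [b n >= 1 + |c|]. *)
suff h : forall p, 0 < lead_coef p -> exists2 c, 0 < c &
    exists n0, forall n, (n0 <= n)%N -> c <= p.[n%:R].
  by move=> /h [c c0 [n0 hn]]; exists n0 => n /hn; apply: lt_le_trans.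
elim/poly_ind => [|q c IH]; first by rewrite lead_coef0 ltxx.
have [->|q0] := eqVneq q 0.
  rewrite mul0r add0r lead_coefC => c0; exists c => //; exists 0%N => n _.
  by rewrite hornerC.
have -> : lead_coef (q * 'X + c%:P) = lead_coef q.
  rewrite lead_coefDl ?lead_coefMX // size_mulX // size_polyC.
  by case: (c != 0); rewrite //= ltnS size_poly_gt0.
move=> /IH [b b0 [n0 hn]]; exists 1 => //.
pose k := Num.bound ((1 + `|c|) / b).
exists (maxn n0 k) => n; rewrite geq_max => /andP[n0n kn].
rewrite hornerMXaddC; have := hn _ n0n => hq.
have h1 : b * n%:R <= q.[n%:R] * n%:R by apply: ler_wpM2r.
have h2 : (1 + `|c|) <= b * n%:R.
  rewrite mulrC -ler_pdivrMr //; apply: (@le_trans _ _ k%:R); last by rewrite ler_nat.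
  by apply/ltW/archi_boundP; rewrite divr_ge0 ?addr_ge0 // ltW.
have h3 : - `|c| <= c by rewrite lerNl -normrN ler_norm.
by have := lerD (le_trans h2 h1) h3; rewrite addrK.
Qed.

Lemma poly_le_size p q : (exists n0, forall n, (n0 <= n)%N ->
  0 <= p.[n%:R] /\ p.[n%:R] <= q.[n%:R]) -> (size p <= size q)%N.
Proof.
move=> [n0 h]; rewrite leqNgt; apply/negP => qp.
have p0 : p != 0 by rewrite -size_poly_gt0 (leq_ltn_trans _ qp).
have [lp|] := ltP 0 (lead_coef p); last first.
  rewrite le_eqVlt lead_coef_eq0 (negPf p0) /= => lp.
  have [|n1 h1] := @poly_pos (- p); first by rewrite lead_coefN oppr_gt0.
  have := h1 _ (leq_maxr n0 n1); rewrite hornerN oppr_gt0 ltNge.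
  by have [-> _] := h _ (leq_maxl n0 n1).
have [|n1 h1] := @poly_pos (p - q).
  by rewrite lead_coefDl // size_polyN.
have := h1 _ (leq_maxr n0 n1); rewrite hornerD hornerN subr_gt0 ltNge.
by have [_ ->] := h _ (leq_maxl n0 n1).
Qed.

Lemma size_shift p c : size (p \Po ('X + c%:P)) = size p.
Proof. by apply: size_comp_poly2; rewrite size_XaddC. Qed.

Lemma lead_coef_shift p c : lead_coef (p \Po ('X + c%:P)) = lead_coef p.
Proof.
by rewrite lead_coef_comp ?size_XaddC // lead_coefXaddC expr1n mulr1.
Qed.

Lemma size_sub_lt p q (e : nat) : size p = size q :> nat -> lead_coef p = lead_coef q ->
  (size p <= e.+1)%N -> (size (p - q)%R <= e)%N.
Proof.
move=> sz lc pe; apply/leq_sizeP => j ej; rewrite coefB.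
have [jp|jp] := leqP (size p) j; first by rewrite !nth_default ?subrr // -sz.
have ej' : j = e by apply/eqP; rewrite eqn_leq ej andbT -ltnS (leq_trans jp).
have sp : size p = e.+1 by apply/eqP; rewrite eqn_leq pe -ej' jp.
by move: lc; rewrite /lead_coef -sz sp /= ej' => ->; rewrite subrr.
Qed.

Lemma poly_sum q : exists p, (size p <= (size q).+1)%N /\
  forall n : nat, p.[n.+1%:R] - p.[n%:R] = q.[n%:R].
Proof.
move: {2}(size q) (leqnn (size q)) => s; elim: s q => [|s IH] q hq.
  move: hq; rewrite leqn0 size_poly_eq0 => /eqP ->.
  by exists 0; rewrite size_poly0; split=> // n; rewrite !horner0 subrr.
have [qs|qs] := leqP (size q) s; first exact: IH.
have {qs}sq : size q = s.+1 by apply/eqP; rewrite eqn_leq hq.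
(* The difference of [X^(s+1)] starts with [(s+1) X^s]; the factor [b] makes it cancel the leading
   term of [q]. *)
pose b : rat := lead_coef q / s.+1%:R; pose p1 : {poly rat} := b *: 'X^(s.+1).
pose d := p1 \Po ('X + 1%:P) - p1.
have dE n : d.[n%:R] = p1.[n.+1%:R] - p1.[n%:R].
  by rewrite hornerD hornerN horner_comp hornerD hornerX hornerC natr1.
have dcoef j : d`_j = b * ('C(s.+1, j)%:R - (j == s.+1)%:R).
  rewrite /d /p1 comp_polyZ comp_Xn_poly coefB !coefZ -mulrBr; congr (_ * (_ - _)).
    rewrite addrC exprDn coef_sum.
    under eq_bigr => i _ do rewrite expr1n mul1r coefMn coefXn.
    have [js|js] := leqP j s.+1.
      rewrite (bigD1 (Ordinal (js : (j < s.+2)%N))) //= eqxx big1 ?addr0 // => i ij.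
      by rewrite eq_sym; case: eqP => [e|_]; [case/eqP: ij; apply/val_inj|rewrite mul0rn].
    rewrite big1 ?bin_small // => i _.
    by case: eqP => [e|_]; [move: (ltn_ord i); rewrite -e ltnS leqNgt js|rewrite mul0rn].
  by rewrite coefXn.
have [|p [sp hp]] := IH (q - d).
  apply/leq_sizeP => j; rewrite leq_eqVlt coefB dcoef => /orP[/eqP <-|sj].
    rewrite (ltn_eqF (ltnSn s)) subr0 -bin_sub ?subSnn ?bin1 ; last exact: leqnSn.
    by rewrite divfK ?pnatr_eq0 // /lead_coef sq /= subrr.
  rewrite nth_default ?sq //; move: sj; rewrite leq_eqVlt => /orP[/eqP <-|sj].
    by rewrite binn eqxx subrr mulr0 subr0.
  by rewrite bin_small // gtn_eqF // subrr mulr0 subrr.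
exists (p + p1); split.
  apply: leq_trans (size_polyD _ _) _; rewrite geq_max sq; apply/andP; split.
    apply: (leq_trans sp); rewrite ltnS.
    apply/leq_sizeP => j sj; rewrite coefB dcoef nth_default ?sq //.
    move: sj; rewrite leq_eqVlt => /orP[/eqP <-|sj]; first by rewrite binn eqxx subrr mulr0 subr0.
    by rewrite bin_small // gtn_eqF // subrr mulr0 subrr.
  by apply: (leq_trans (size_scale_leq _ _)); rewrite size_polyXn.
move=> n; rewrite !hornerD opprD addrACA hp hornerD hornerN -dE.
by rewrite subrK.
Qed.
End PolynomialGrowth.

(** * Hilbert polynomials and growth of graded modules *)

Section Growth.
Import Order.TTheory Num.Theory.
Variables (A : comNzRingType) (m : nat).
Implicit Types (T : gquo A m) (p q : {poly rat}).

Definition finlen T := forall n, exists l, lenle (cyc T n) (bnd T n) l.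

Definition hilb T p := exists n0, forall n, (n0 <= n)%N ->
  exists l : nat, len (cyc T n) (bnd T n) l /\ p.[n%:R] = l%:R.

(** [size q <= e] means degree below [e], so this is growth of order at most [n^(e-1)], and eventual
    vanishing for [e = 0]. *)
Definition growth_le (e : nat) T := exists q, (size q <= e)%N /\
  exists n0, forall n, (n0 <= n)%N ->
    exists l : nat, lenle (cyc T n) (bnd T n) l /\ l%:R <= q.[n%:R].

Definition opform (j : 'I_m) : 'I_m -> A := fun i => (i == j)%:R.

Lemma lin_opform (W : gsys A m) j n (x : W n) : lin (opform j) x = gop W j n x.
Proof.
rewrite /lin (bigD1 j) //= /opform eqxx scale1r big1 ?addr0 // => i /negPf ->.
by rewrite scale0r.
Qed.

Definition opzero T := forall j n x, cyc T n x -> bnd T n.+1 (gop T j n x).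

Lemma evzero_of_zero T : gwf T -> noeth T -> opzero T -> evzero T.
Proof.
(* Truncations to degrees [<= k] are graded submodules because the operators are zero. *)
move=> w hn h0; pose c k n := if (n <= k)%N then cyc T n else bnd T n.
have [k|k n|k hk] := hn c.
- split=> [n|j n x]; rewrite /c.
    case: ifP => _; first by split; [exact: cyc_sub|exact: (bnd_cyc w)|exact: subset_refl].
    by split; [exact: bnd_sub|exact: subset_refl|exact: (bnd_cyc w)].
  case: ifP => _ Zx.
    have := h0 j _ _ Zx; case: ifP => // _; exact: (bnd_cyc w).
  have : bnd T n.+1 (gop T j n x) by case: w => _ _; apply.
  by case: ifP => // _; apply: (bnd_cyc w).
- rewrite /c; case: ifP => nk; first by rewrite leqW //; exact: subset_refl.
  by case: ifP => _; [exact: (bnd_cyc w)|exact: subset_refl].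
exists k.+1 => n kn; have := hk n n (ltnW kn).
by rewrite /c leqnn leqNgt kn.
Qed.

Lemma subfam_wf1 T U : gwf T -> subfam T U -> gwf (restr U (bnd T)).
Proof. by move=> w /(subfam_wf w) []. Qed.
Lemma subfam_wf2 T U : gwf T -> subfam T U -> gwf (restr (cyc T) U).
Proof. by move=> w /(subfam_wf w) []. Qed.

Lemma lenle_sub (V : lmodType A) (Z B Z' B' : set V) l :
  Z' `<=` Z -> B `<=` B' -> lenle Z B l -> lenle Z' B' l.
Proof.
move=> ZZ BB h [c [c1 c2]]; apply: h; exists c; split=> // i il.
have [s b z] := c1 i il; split=> //; first exact: subset_trans b.
exact: subset_trans ZZ.
Qed.

Lemma finlen_restr T (Z B : forall n, set (T n)) : (forall n, Z n `<=` cyc T n) ->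
  (forall n, bnd T n `<=` B n) -> finlen T -> finlen (restr Z B).
Proof. by move=> ZZ BB h n; have [l hl] := h n; exists l; apply: lenle_sub hl. Qed.

Lemma finlen_subfam T U : subfam T U -> finlen T -> finlen (restr U (bnd T)) /\ finlen (restr (cyc T) U).
Proof.
move=> [s _] h; split; apply: finlen_restr => // n; have [_ b z] := s n => //.
Qed.

Lemma len_shift T l n k : gwf T -> comm T ->
  (forall x, cyc T n x -> bnd T n.+1 (lin l x) -> bnd T n x) ->
  len (cyc T n) (bnd T n) k <-> len (bnd (formquo T l) n.+1) (bnd T n.+1) k.
Proof.
move=> w c hi; have wq := subfam_wf1 w (formquo_sub l w c).
apply: (len_iso k (R := fun x y => cyc T n x /\ bnd T n.+1 (y - lin l x)) (gwf_m n w)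
  (gwf_m n.+1 wq)) => /=.
- have sB := bnd_sub n.+1 w; split.
  + by split; [exact: (issub0 (cyc_sub n w))|rewrite linear0 subrr; exact: (issub0 sB)].
  + move=> a x y x' y' [Zx Bx] [Zy By]; split; first by case: (cyc_sub n w) => _; apply.
    by rewrite linP opprD addrACA -scalerBr; case: sB => _; apply.
  + move=> x x' [Zx Bx]; split=> //; exists (x' - lin l x), x; split=> //.
    by rewrite subrK.
  + by move=> x Zx; exists (lin l x); rewrite subrr; split=> //; exact: (issub0 sB).
  + move=> x x' [Zx Bx] /(lin_bnd l w) Bl; exact: (issubBr sB Bx).
- move=> x x' [Zx Bx] Bx'; apply: hi => //.
  exact: (issubBl (bnd_sub n.+1 w) Bx).
- move=> x' [b [z [Bb Zz ->]]]; exists z; split=> //.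
  by rewrite addrK.
Qed.

Lemma hilb_add T U p q : gwf T -> subfam T U -> hilb (restr U (bnd T)) p ->
  hilb (restr (cyc T) U) q -> hilb T (p + q).
Proof.
move=> w sU [n1 h1] [n2 h2]; exists (maxn n1 n2) => n; rewrite geq_max => /andP[k1 k2].
have [a [ha ea]] := h1 _ k1; have [b [hb eb]] := h2 _ k2; exists (a + b)%N; split.
  have w1 := gwf_m n (subfam_wf1 w sU); have w2 := gwf_m n (subfam_wf2 w sU).
  exact: (len_add w2 w1 ha hb).
by rewrite hornerD ea eb natrD.
Qed.

Lemma evzero_hilb T : gwf T -> evzero T -> hilb T 0.
Proof.
move=> w [n0 h]; exists n0 => n /h ZB; exists 0%N; rewrite horner0; split=> //.
have [k] := lenle_len (gwf_m n w) (lenle0 ZB).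
by rewrite leqn0 => /eqP ->.
Qed.

Lemma hilb_step T l q : gwf T -> comm T -> finlen T ->
  (exists n0, forall n, (n0 <= n)%N -> forall x, cyc T n x -> bnd T n.+1 (lin l x) -> bnd T n x) ->
  hilb (formquo T l) q -> exists p, hilb T p.
Proof.
move=> w c fl [n1 hi] [n2 hq].
have [p [_ hp]] := poly_sum (q \Po ('X + 1%:P)).
pose n0 := maxn n1 n2.
have hl n : exists a, len (cyc T n) (bnd T n) a.
  by have [a] := fl n; move/(lenle_len (gwf_m n w)) => [k _ hk]; exists k.
have /choice [f hf] := hl.
have hstep n : (n0 <= n)%N -> (f n.+1)%:R - (f n)%:R = q.[n.+1%:R] :> rat.
  rewrite geq_max => /andP[k1 k2].
  have [b [hb eb]] := hq n.+1 (leq_trans k2 (leqnSn n)).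
  have ha := (len_shift (f n) w c (hi n k1)).1 (hf n).
  have wq := formquo_sub l w c.
  have := len_add (gwf_m n.+1 (subfam_wf2 w wq)) (gwf_m n.+1 (subfam_wf1 w wq)) ha hb.
  move/(len_uniq (hf n.+1)) => ->.
  by rewrite natrD addrC addKr eb.
(* The recursion fixes the polynomial up to a constant, which is read off the length in degree
   [n0]. *)
exists (p + ((f n0)%:R - p.[n0%:R])%:P), n0 => n n0n; exists (f n); split; first exact: hf.
rewrite -(subnKC n0n); elim: (n - n0)%N => [|k IH].
  by rewrite addn0 hornerD hornerC addrC subrK.
have hk : (n0 <= n0 + k)%N by apply: leq_addr.
have := hp (n0 + k)%N; rewrite horner_comp hornerD hornerX hornerC natr1 -(hstep _ hk).
move/eqP; rewrite subr_eq -addrA => /eqP e1.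
rewrite addnS hornerD e1 hornerC -addrA -[RHS](subrK (f (n0 + k)%N)%:R) -[RHS]addrA -IH.
by rewrite hornerD hornerC; congr (_ + _); rewrite !addrA.
Qed.

Lemma hilb_exists T : gwf T -> comm T -> noeth T -> finlen T -> exists p, hilb T p.
Proof.
move: T; apply: (@devissage A m (fun T => finlen T -> exists p, hilb T p)).
- move=> T U w c sU h1 h2 fT; have [f1 f2] := finlen_subfam sU fT.
  have [p hp] := h1 f1; have [q hq] := h2 f2; exists (p + q).
  exact: hilb_add hp hq.
- move=> T T' R w w' [[hR _] hi hs] _ hT fT'.
  have wn n := gwf_m n w; have wn' n := gwf_m n.+1 w'.
  have [|p [n0 hp]] := hT.
    move=> n; have [l hl] := fT' n.+1; exists l.
    exact: (lenle_inj (wn n) (wn' n) (hR n) (@hi n)).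
  exists (p \Po ('X - 1%:P)), n0.+1 => -[//|n] nn.
  have [l [hl el]] := hp n nn; exists l; split.
    exact: (len_iso l (wn n) (wn' n) (hR n) (@hi n) (@hs n)).1.
  by rewrite horner_comp !hornerE -natr1 addrK.
- move=> T w c hn hinj hq fT; have [h0|] := pselect (opzero T).
    by exists 0; apply: evzero_hilb => //; apply: evzero_of_zero.
  (* Some variable is not zero, hence injective by the dichotomy, and its cokernel is a proper
     quotient. *)
  move=> /existsNP [j hj].
  have hz : ~ (forall n x, cyc T n x -> bnd T n.+1 (lin (opform j) x)).
    by move=> h; apply: hj => n x /h; rewrite lin_opform.
  have hin : forall n x, cyc T n x -> bnd T n.+1 (lin (opform j) x) -> bnd T n x.
    by case: (hinj (opform j)).
  have sQ := formquo_sub (opform j) w c.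
  have [||q hqq] := hq _ sQ.
  + move=> h; apply: hz => n x Zx; apply: (h n.+1); exists 0, x.
    by rewrite add0r; split=> //; exact: (issub0 (bnd_sub n.+1 w)).
  + by have [] := finlen_subfam sQ fT.
  by apply: (hilb_step w c fT _ hqq); exists 0%N => n _ x; apply: hin.
Qed.

Lemma hilb_growth_le T p e : hilb T p -> growth_le e T -> (size p <= e)%N.
Proof.
move=> [n1 h1] [q [qe [n2 h2]]]; apply: leq_trans qe; apply: poly_le_size.
exists (maxn n1 n2) => n; rewrite geq_max => /andP[k1 k2].
have [a [ha ->]] := h1 _ k1; have [b [hb lb]] := h2 _ k2; split; first exact: ler0n.
by apply: le_trans lb; rewrite ler_nat; apply: len_lenle ha hb.
Qed.

Lemma growth_le_hilb T p e : hilb T p -> (size p <= e)%N -> growth_le e T.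
Proof.
move=> [n1 h1] pe; exists p; split=> //; exists n1 => n /h1 [l [[_ hl] ->]].
by exists l.
Qed.

Lemma growth_le_serre e : serre (@growth_le e).
Proof.
split=> [T w c h|T1 T2 T3 w1 w2 w3 _ _ _ [R [S [hR hS ex]]]].
  exists 0; rewrite size_poly0; split=> //; exists 0%N => n _; exists 0%N.
  by rewrite horner0; split=> //; apply: lenle0.
move=> [q1 [e1 [n1 h1]]] [q3 [e3 [n3 h3]]]; exists (q1 + q3); split.
  by apply: (leq_trans (size_polyD _ _)); rewrite geq_max e1.
exists (maxn n1 n3) => n; rewrite geq_max => /andP[k1 k3].
have [a [ha la]] := h1 _ k1; have [b [hb lb]] := h3 _ k3; exists (a + b)%N; split.
  exact: (lenle_exact (gwf_m n w1) (gwf_m n w2) (gwf_m n w3) (mexact_slice n hR hS ex)).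
by rewrite natrD hornerD lerD.
Qed.

Lemma evzero_growth_le T e : evzero T -> growth_le e T.
Proof.
move=> [n0 h]; exists 0; rewrite size_poly0; split=> //; exists n0 => n /h ZB.
by exists 0%N; rewrite horner0; split=> //; apply: lenle0.
Qed.

Lemma Ble0_evzero T : gwf T -> growth_le 0 T -> evzero T.
Proof.
move=> w [q [+ [n0 h]]]; rewrite leqn0 size_poly_eq0 => /eqP q0; exists n0 => n /h [l [hl]].
rewrite q0 horner0 lern0 => /eqP l0; rewrite l0 in hl.
have [k] := lenle_len (gwf_m n w) hl; rewrite leqn0 => /eqP ->.
exact: len0 (gwf_m n w).
Qed.

Definition filter_regular l T := exists n0, forall n, (n0 <= n)%N ->
  forall x, cyc T n x -> bnd T n.+1 (lin l x) -> bnd T n x.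

(** In large degrees [l] is injective, so the cokernel has the lengths [p(n+1) - p(n)], and taking
    differences lowers the degree of the Hilbert polynomial [p]. *)
Lemma hilb_formquo T l e : gwf T -> comm T -> noeth T -> finlen T -> filter_regular l T -> growth_le e.+1 T ->
  growth_le e (gshift (formquo T l)).
Proof.
move=> w c hn fl [n1 hi] hB; have [p hp] := hilb_exists w c hn fl.
have pe := hilb_growth_le hp hB; have {hp}[n2 hp] := hp.
exists (p \Po ('X + 1%:P) - p); split.
  by apply: size_sub_lt; rewrite ?size_shift ?lead_coef_shift.
have sQ := formquo_sub l w c.
exists (maxn n1 n2) => n; rewrite geq_max => /andP[k1 k2].
have [a [ha ea]] := hp _ k2; have [b [hb eb]] := hp n.+1 (leq_trans k2 (leqnSn n)).
have h1 := (len_shift a w c (hi n k1)).1 ha.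
have [f1 f2] := finlen_subfam sQ fl.
have [r] := f2 n.+1; move/(lenle_len (gwf_m n.+1 (subfam_wf2 w sQ))) => [k _ hk].
have := len_add (gwf_m n.+1 (subfam_wf2 w sQ)) (gwf_m n.+1 (subfam_wf1 w sQ)) h1 hk.
move/(len_uniq hb) => e1; exists k; split; first by case: hk.
rewrite hornerD hornerN horner_comp hornerD hornerX hornerC natr1 ea eb e1.
by rewrite natrD addrC addKr.
Qed.

Lemma growth_le_gshift T e : growth_le e (gshift T) -> growth_le e T.
Proof.
move=> [q [qe [n0 h]]]; exists (q \Po ('X + (-1)%:P)); split; first by rewrite size_shift.
exists n0.+1 => -[//|n] nn; have [l [hl le]] := h n nn; exists l; split=> //.
by rewrite horner_comp hornerD hornerX hornerC -natr1 addrK.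
Qed.

(** For any form [l], the length in degree [n + 1] exceeds that in degree [n] by at most the length
    of the cokernel; summing a polynomial bound raises its degree by at most one. *)
Lemma growth_le_descend T l e : gwf T -> comm T -> finlen T -> growth_le e (gshift (formquo T l)) -> growth_le e.+1 T.
Proof.
move=> w c fl [q [qe [n0 hq]]]; have [p [ps hp]] := poly_sum q.
have [a0 ha0] := fl n0.
exists (p + (a0%:R - p.[n0%:R])%:P); split.
  apply: (leq_trans (size_polyD _ _)); rewrite geq_max (leq_trans ps) //=.
  by apply: (leq_trans (size_polyC_leq1 _)).
exists n0 => n n0n; rewrite -(subnKC n0n); elim: (n - n0)%N => [|k [a [ha la]]].
  by rewrite addn0; exists a0; split=> //; rewrite hornerD hornerC addrC subrK.
have [b [hb lb]] := hq (n0 + k)%N (leq_addr _ _); rewrite addnS; exists (a + b)%N; split.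
  pose S (x y : T (n0 + k).+1) := cyc T (n0 + k).+1 x /\ y = x.
  pose R (x : T (n0 + k)%N) (y : T (n0 + k).+1) := cyc T (n0 + k) x /\ y = lin l x.
  have sZ n' := cyc_sub n' w.
  have w3 : mwf (cyc T (n0 + k).+1) (bnd (formquo T l) (n0 + k).+1).
    exact: (gwf_m (n0 + k).+1 (formquo_wf l w c)).
  apply: (lenle_exact (gwf_m _ w) (gwf_m _ w) w3 (R := R) (S := S)) => //; split.
  - split=> [|a1 x y _ _ [Zx ->] [Zy ->]|x _ [Zx ->]|x Zx|x _ [_ ->]].
    + by split; [exact: (issub0 (sZ _))|rewrite linear0].
    + by split; [case: (sZ (n0 + k)%N) => _; apply|rewrite linP].
    + by split=> //; apply: lin_cyc.
    + by exists (lin l x).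
    + exact: lin_bnd.
  - split=> [|a1 x y _ _ [Zx ->] [Zy ->]|x _ [Zx ->]|x Zx|x _ [_ ->]] //.
    + by split=> //; exact: (issub0 (sZ _)).
    + by split=> //; case: (sZ (n0 + k).+1) => _; apply.
    + by exists x.
    + exact: (@formquo_bnd A m T l (n0 + k).+1 w).
  - move=> x _ [Zx ->] [b1 [z [Bb Zz ->]]]; exists z, (lin l z); split=> //.
    by rewrite addrK.
have := hp (n0 + k)%N => /eqP; rewrite subr_eq => /eqP e1.
rewrite natrD hornerD e1 -addrA addrC; apply: lerD; last exact: lb.
by move: la; rewrite hornerD !hornerC.
Qed.
End Growth.

(** * Generic linear forms *)

Section Generic.
Variables (A : comNzRingType) (m : nat).
Implicit Types (T : gquo A m) (l : 'I_m -> A).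

(* [kl T l e n x] : multiplication by [l^e] kills the class of [x]. *)
Fixpoint kl T l (e : nat) : forall n, T n -> Prop :=
  match e with
  | 0%N => fun n x => bnd T n x
  | e'.+1 => fun n x => @kl T l e' n.+1 (lin l x)
  end.
Arguments kl : clear implicits.

Definition locnil l T := forall n x, cyc T n x -> exists e, kl T l e n x.

Lemma kl_addB T l e n x y : gwf T -> kl T l e n y -> bnd T n (x - y) -> kl T l e n x.
Proof.
move=> w; elim: e n x y => [|e IH] n x y /= hy Bxy.
  exact: (issubBr (bnd_sub n w) Bxy).
by apply: IH hy _; rewrite -linearB; apply: lin_bnd.
Qed.

Lemma kl_hom T T' R l e n x x' : ghom R -> R n x x' -> kl T l e n x -> kl T' l e n x'.
Proof.
move=> hR; elim: e n x x' => [|e IH] n x x' Rx /=; first exact: (mhomB (hR.1 n) Rx).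
by apply: IH; apply: lin_hom hR Rx.
Qed.

Lemma locnil_serre l : serre (@locnil l).
Proof.
split=> [T w _ h n x Zx|T1 T2 T3 w1 w2 w3 _ _ _ [R [S [hR hS ex]]] h1 h3 n x Zx].
  by exists 0%N; apply: h.
have [x' Sx] := mhomT (hS.1 n) Zx.
have [e he] := h3 _ _ (mhomI (hS.1 n) Sx).2.
elim: e n x x' {Zx} Sx he => [|e IH] n x x' Sx /= he.
  have [y [z [Ry Bz]]] := ex _ _ _ Sx he.
  have [e1 k1] := h1 _ _ (mhomI (hR.1 n) Ry).1.
  exists e1; apply: kl_addB w2 _ Bz; exact: kl_hom hR Ry k1.
have [e2 k2] := IH _ _ _ (lin_hom l hS Sx) he.
by exists e2.+1.
Qed.

Lemma evzero_ext T U : subfam T U -> evzero (restr U (bnd T)) -> evzero (restr (cyc T) U) -> evzero T.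
Proof.
move=> sU [n1 h1] [n2 h2]; exists (maxn n1 n2) => n; rewrite geq_max => /andP[k1 k2].
exact: subset_trans (h2 _ k2) (h1 _ k1).
Qed.

Lemma kl_mono T (Z B : forall n, set (T n)) l e n x :
  (forall n, bnd T n `<=` B n) -> kl T l e n x -> kl (restr Z B) l e n x.
Proof. by move=> h; elim: e n x => [|e IH] n x /=; [apply: h|apply: IH]. Qed.

Lemma kl_restr T (Z : forall n, set (T n)) l e n x :
  kl T l e n x -> kl (restr Z (bnd T)) l e n x.
Proof. by apply: kl_mono => k; exact: subset_refl. Qed.

Lemma kl_inj T l e n x : gwf T ->
  (forall n x, cyc T n x -> bnd T n.+1 (lin l x) -> bnd T n x) ->
  cyc T n x -> kl T l e n x -> bnd T n x.
Proof.
move=> w hi; elim: e n x => [|e IH] n x Zx //= hk.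
by apply: hi => //; apply: IH => //; apply: lin_cyc.
Qed.

(** After devissage a variable that is not zero is injective, and a variable both injective and
    locally nilpotent leaves only the zero module. *)
Lemma evzero_nil T : gwf T -> comm T -> noeth T ->
  (forall j, locnil (@opform A m j) T) -> evzero T.
Proof.
move: T; apply: (@devissage A m (fun T => (forall j, locnil (@opform A m j) T) -> evzero T)).
- move=> T U w c sU h1 h2 hT; apply: (evzero_ext sU).
    apply: h1 => j n x Ux; have [_ _ UZ] := sU.1 n.
    have [e he] := hT j _ _ (UZ _ Ux); exists e; exact: kl_restr.
  apply: h2 => j n x Zx; have [e he] := hT j _ _ Zx; exists e.
  by apply: kl_mono he => k; case: (sU.1 k).
- move=> T T' R w w' [hR hi hs] _ h hT'.
  have [|n0 hn0] := h.
    move=> j n x Zx; have [x' Rx] := mhomT (hR.1 n) Zx.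
    have [e he] : exists e, kl (gshift T') (@opform A m j) e n x'.
      have [e he] := hT' j n.+1 x' (mhomI (hR.1 n) Rx).2; exists e.
      by elim: e n x' {Zx Rx x} he => [|e IH] n x' //=; apply: IH.
    exists e; elim: e n x x' Rx he {Zx} => [|e IH] n x x' Rx /= he; first exact: hi Rx he.
    by apply: IH he; apply: (lin_hom _ hR Rx).
  exists n0.+1 => -[//|n] nn x' Zx'; have [x Rx] := hs _ _ Zx'.
  by apply: (mhomB (hR.1 n) Rx); apply: hn0 => //; case: (mhomI (hR.1 n) Rx).
- move=> T w c hn hinj _ hT.
  have [h0|/existsNP [j hj]] := pselect (opzero T); first exact: evzero_of_zero.
  exists 0%N => n _ x Zx; have [e he] := hT j n x Zx.
  apply: (kl_inj w _ Zx he); case: (hinj (@opform A m j)) => // h.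
  by case: hj => k y /h; rewrite lin_opform.
Qed.

Section Bad.
Variable mI : {pred A}.
Hypothesis mI_unit : forall x, x \notin mI -> exists y, y * x = 1.

(** A one-parameter family of forms on the moment curve: genericity then means that a single scalar
    avoids finitely many residue classes. *)
Definition moment (c : A) : 'I_m -> A := fun j => c ^+ j.

(* By Vandermonde, [m] of the forms [moment c] with distinct residues of [c] span the
   variables. *)
Lemma moment_zero T (a : 'rV[A]_m) : gwf T ->
  (forall i j : 'I_m, (i < j)%N -> a 0 j - a 0 i \notin mI) ->
  (forall j n x, cyc T n x -> bnd T n.+1 (lin (moment (a 0 j)) x)) -> opzero T.
Proof.
move=> w ha h0 k n x Zx; have sB := bnd_sub n.+1 w.
pose V := Vandermonde m a.
have hdet : bnd T n.+1 (\det V *: gop T k n x).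
  have -> : \det V *: gop T k n x = \sum_j (\adj V) j k *: lin (moment (a 0 j)) x.
    under [RHS]eq_bigr => j _ do rewrite /lin scaler_sumr.
    rewrite exchange_big /=.
    transitivity (\sum_i (V *m \adj V) i k *: gop T i n x).
      rewrite mul_mx_adj (bigD1 k) //= mxE eqxx big1 ?addr0 // => i /negPf ik.
      by rewrite mxE ik scale0r.
    apply: eq_bigr => i _; rewrite mxE scaler_suml; apply: eq_bigr => j _.
    by rewrite scalerA /moment /V mxE mulrC.
  by apply: issub_sum => // j _; apply: issubZ => //; apply: h0.
have [u hu] : exists u, u * \det V = 1.
  rewrite det_Vandermonde.
  apply: (big_ind (fun z => exists u, u * z = 1)); first by exists 1; rewrite mul1r.
    by move=> y z [u hu] [v hv]; exists (u * v); rewrite mulrACA hu hv mulr1.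
  move=> i _; apply: (big_ind (fun z => exists u, u * z = 1)); first by exists 1; rewrite mul1r.
    by move=> y z [u hu] [v hv]; exists (u * v); rewrite mulrACA hu hv mulr1.
  by move=> j ij; apply/mI_unit/ha.
by rewrite -[gop _ _ _ _]scale1r -hu -scalerA; apply: issubZ.
Qed.

Definition avoids (bads : seq A) c := forall b, b \in bads -> c - b \notin mI.

Lemma generic T : gwf T -> comm T -> noeth T ->
  exists bads, forall c, avoids bads c -> filter_regular (moment c) T.
Proof.
move: T; apply: (@devissage A m (fun T => exists bads, forall c, avoids bads c -> filter_regular (moment c) T)).
- move=> T U w c sU [b1 h1] [b2 h2]; exists (b1 ++ b2) => y hy.
  have [|n1 k1] := h1 y; first by move=> b bb; apply: hy; rewrite mem_cat bb.
  have [|n2 k2] := h2 y; first by move=> b bb; apply: hy; rewrite mem_cat bb orbT.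
  exists (maxn n1 n2) => n; rewrite geq_max => /andP[e1 e2] x Zx Bx.
  apply: (k1 n e1) => //; apply: (k2 n e2) => //=.
  by have [_ BU _] := sU.1 n.+1; apply: BU.
- move=> T T' R w w' [hR hi hs] _ [b h]; exists b => y /h [n0 hn0].
  exists n0.+1 => -[//|n] nn x' Zx' Bx'; have [x Rx] := hs _ _ Zx'.
  apply: (mhomB (hR.1 n) Rx); apply: hn0 => //; first by case: (mhomI (hR.1 n) Rx).
  by apply: (hi n.+1 _ (lin (moment y) x' : T' n.+2)) => //; apply: (lin_hom _ hR Rx).
- move=> T w c hn hinj _.
  have [h0|hnz] := pselect (opzero T).
    exists [::] => y _; have [n0 hn0] := evzero_of_zero w hn h0.
    by exists n0 => n nn x Zx _; apply: hn0.
  pose yz y := forall n x, cyc T n x -> bnd T n.+1 (lin (moment y) x).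
  (* Greedy choice: either [k] vanishing forms with pairwise distinct residues are found, or
     finitely many residues contain all of them. For [k = m] the first case kills every variable. *)
  have dich k : (exists s : seq A, [/\ size s = k, forall b, b \in s -> yz b &
       forall i j, (i < j)%N -> (j < k)%N -> s`_j - s`_i \notin mI]) \/
     exists bads : seq A, forall y, yz y -> exists2 b, b \in bads & y - b \in mI.
    elim: k => [|k [[s [sk sz sd]]|]]; [by left; exists [::]| |by right].
    have [hb|] := pselect (forall y, yz y -> exists2 b, b \in s & y - b \in mI).
      by right; exists s.
    move=> /existsNP [y /not_implyP [yy hy]]; left; exists (rcons s y).
    rewrite size_rcons sk; split=> // [b|i j ij jk].
      by rewrite mem_rcons in_cons => /orP[/eqP ->|/sz].
    rewrite !nth_rcons sk; have ik : (i < k)%N by rewrite -ltnS (leq_trans _ jk).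
    rewrite ik; move: jk; rewrite ltnS leq_eqVlt => /orP[/eqP jk|jk].
      rewrite jk ltnn eqxx; apply/negP => h; apply: hy; exists s`_i => //.
      by rewrite mem_nth // sk.
    by rewrite jk; apply: sd.
  have [[s [sm sz sd]]|[bads hb]] := dich m.
    case: hnz; apply: (@moment_zero T (\row_j s`_j)) => // [i j ij|j].
      by rewrite !mxE; apply: sd.
    by rewrite mxE; apply: sz; rewrite mem_nth ?sm.
  exists bads => y hy; exists 0%N => n _; case: (hinj (moment y)); last by apply.
  by move=> /hb [b bb yb]; have := hy b bb; rewrite yb.
Qed.
End Bad.
End Generic.

(** * Quotients and local rings *)

Section QuotientLength.
Variable A : comNzRingType.
Implicit Types V Q : lmodType A.

Lemma has_length_len Q l : has_length Q l <-> @len A Q setT [set 0] l.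
Proof.
have aux k : (exists c, @submod_chain A Q k c) <-> exists c, @chain A Q setT [set 0] k c.
  split=> -[c hc].
    exists (fun i => [set x | x \in c i]); split=> [i _|i ik].
      have sc := submodClosed_issub (c i); split=> //.
      by move=> x /= ->; apply: (issub0 sc).
    by have [h1 h2] := hc i ik; split=> // x; apply: h1.
  case: hc => c1 c2.
  (* [submod_chain] wants a submodule at every index, so the chain is continued constantly. *)
  pose c' i : set Q := c (minn i k).
  have sc i : issub (c' i) by case: (c1 (minn i k) (geq_minr _ _)).
  exists (fun i => smod (sc i)) => i ik; have [h1 h2] := c2 i ik.
  have e1 : minn i k = i by apply/minn_idPl/ltnW.
  have e2 : minn i.+1 k = i.+1 by apply/minn_idPl.
  split=> [x /(smodE (sc i)) cx|h].
    by apply/(smodE (sc i.+1)); rewrite /c' e2; apply: h1; rewrite -e1.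
  apply: h2 => x cx; rewrite -e1; apply/(smodE (sc i))/h.
  by apply/(smodE (sc i.+1)); rewrite /c' e2.
by rewrite /has_length /len /lenle !aux.
Qed.

Section Quot.
Local Open Scope quotient_scope.
Variables (V : lmodType A) (W : submodClosed V).

Definition quopi (x : V) : quotmod W := \pi_(quotmod W) x.
Fact quopi_linear : linear quopi.
Proof. by move=> a x y; rewrite /quopi quotmod_piD quotmod_piZ. Qed.
HB.instance Definition _ := GRing.isLinear.Build A V (quotmod W) *:%R quopi quopi_linear.
Lemma quopi_surj y : exists x, quopi x = y.
Proof. by exists (repr y); rewrite /quopi reprK. Qed.
Lemma quopi_eq0 x : quopi x = 0 <-> x \in W.
Proof.
rewrite -(linear0 quopi); split; first by move/quotmod_eqP; rewrite subr0.
by move=> h; apply/quotmod_eqP; rewrite subr0.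
Qed.

Section QuotLift.
Variables (V' : lmodType A) (f : {linear V -> V'}).
Hypothesis f0 : forall x, x \in W -> f x = 0.
Definition qlift (y : quotmod W) : V' := f (repr y).
Lemma qliftE x : qlift (quopi x) = f x.
Proof.
apply/eqP; rewrite -subr_eq0 -linearB; apply/eqP/f0/quotmod_eqP.
by rewrite reprK.
Qed.
Fact qlift_linear : linear qlift.
Proof.
move=> a x y; have [x' <-] := quopi_surj x; have [y' <-] := quopi_surj y.
by rewrite -linearP !qliftE linearP.
Qed.
Definition qliftm : {linear quotmod W -> V'} :=
  HB.pack qlift (GRing.isLinear.Build A (quotmod W) V' *:%R qlift qlift_linear).
Lemma qlmE x : qliftm (quopi x) = f x. Proof. exact: qliftE. Qed.
End QuotLift.
End Quot.

Lemma quot_lenle V (W : submodClosed V) l :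
  has_length (quotmod W) l -> @lenle A V setT [set x | x \in W] l.
Proof.
move=> /has_length_len [_ hl].
have wW : mwf setT [set x : V | x \in W].
  by split=> //; exact: submodClosed_issub.
apply: (lenle_inj wW (mwf_full _) (R := fun x y => y = quopi W x) _ _ hl).
  split=> [|a x y _ _ -> ->|//|x _|x _ -> /= hx]; rewrite ?linear0 ?linearP //.
    by exists (quopi W x).
  exact/quopi_eq0.
by move=> x _ -> /quopi_eq0.
Qed.

Lemma lenle_surj V V' (Z B : set V) (Z' B' : set V') R l : mwf Z B -> mwf Z' B' ->
  mhom Z B Z' B' R -> (forall x', Z' x' -> exists x, R x x') -> lenle Z B l -> lenle Z' B' l.
Proof.
move=> w w' hR hs hl; case: (w') => sZ sB BZ.
pose S (x y : V') := Z' x /\ y = x.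
have w3 : mwf Z' Z' by split.
rewrite -[l]addn0; apply: (lenle_exact w w' w3 (R := R) (S := S)) => //; last exact: lenle0.
split=> //.
- split=> [|a x y _ _ [Zx ->] [Zy ->]|x _ [Zx ->]|x Zx|x _ [_ ->]] //.
  + by split=> //; apply: (issub0 sZ).
  + by split=> //; case: sZ => _; apply.
  + by exists x.
- move=> x _ [Zx ->] _; have [y Ry] := hs _ Zx; exists y, x; split=> //.
  by rewrite subrr; apply: (issub0 sB).
Qed.

Lemma lenle_step V (Z U B : set V) a b : mwf Z U -> mwf U B ->
  lenle U B a -> lenle Z U b -> lenle Z B (a + b).
Proof.
move=> w1 w2 /(lenle_len w2) [k ka hk] /(lenle_len w1) [q qb hq].
have [_ h] := len_add w1 w2 hk hq.
by apply: lenle_leq h; apply: leq_add.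
Qed.

Lemma lenle_pow V (Z B : set V) p l : mwf Z B -> lenle Z B l ->
  lenle [set v : {ffun 'I_p -> V} | forall k, Z (v k)] [set v | forall k, B (v k)] (p * l).
Proof.
move=> [sZ sB BZ] hl.
pose Y (q : nat) := [set v : {ffun 'I_p -> V} | forall k : 'I_p, Z (v k) /\ ((q <= k)%N -> B (v k))].
have sY q : issub (Y q).
  split=> [k|a u v hu hv k]; rewrite !ffunE.
    by split=> [|_]; exact: issub0.
  have [Zu Bu] := hu k; have [Zv Bv] := hv k.
  by split=> [|qk]; [case: sZ|case: sB] => _; apply; auto.
have BY q : [set v : {ffun 'I_p -> V} | forall k, B (v k)] `<=` Y q.
  by move=> v h k; split=> //; apply: BZ.
have wY q : mwf (Y q) [set v | forall k, B (v k)] by split=> //; exact: pow_issub.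
suff h q : (q <= p)%N -> lenle (Y q) [set v | forall k, B (v k)] (q * l).
  apply: lenle_sub (h p (leqnn p)) => // v hv k.
  by split; [exact: hv|rewrite leqNgt ltn_ord].
elim: q => [|q IH] qp.
  by rewrite mul0n; apply: lenle0 => v hv k; apply: (hv k).2.
rewrite mulSn addnC; have wYq : mwf (Y q.+1) (Y q).
  by split=> // v hv k; have [Zk Bk] := hv k; split=> // /ltnW.
apply: (lenle_step wYq (wY q)); first exact/IH/ltnW.
apply: (lenle_inj wYq (And3 sZ sB BZ) (R := fun v x => Y q.+1 v /\ x = v (Ordinal qp))) hl.
  split=> [|a x y _ _ [Zx ->] [Zy ->]|x _ [Zx ->]|x Zx|x _ [Zx ->] hx].
  - by split; [exact: (issub0 (sY q.+1))|rewrite ffunE].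
  - by split; [case: (sY q.+1) => _; apply|rewrite !ffunE].
  - by split=> //; case: (Zx (Ordinal qp)).
  - by exists (x (Ordinal qp)).
  - by apply: (hx (Ordinal qp)).2.
move=> v _ [hv ->] Bv k; have [Zk Bk] := hv k; split=> //.
rewrite leq_eqVlt => /orP[/eqP e|/Bk //].
by have -> : k = Ordinal qp by apply/val_inj; rewrite /= -e.
Qed.

(** In the chain generated over [B] by the [z^j x], an equality [z^j x = b + a z^(j+1) x] puts
    [(1 - a z) z^j x] in [B], and [1 - a z] is a unit. *)
Lemma lenle_nilp V (Z B : set V) l (z : A) x : mwf Z B -> lenle Z B l ->
  (forall c, exists u, u * (1 - c * z) = 1) -> Z x -> exists e, B (z ^+ e *: x).
Proof.
move=> [sZ sB BZ] hl hu Zx; apply: contrapT => hB; apply: hl.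
pose U j := [set y | exists b a, B b /\ y = b + a *: (z ^+ j *: x)].
exists (fun i => U (l.+1 - i)%N); split=> [i il|i il].
  split.
  - split; first by exists 0, 0; rewrite scale0r addr0; split=> //; exact: issub0.
    move=> a _ _ [b [c [Bb ->]]] [b' [c' [Bb' ->]]].
    exists (a *: b + b'), (a * c + c'); split; first by case: sB => _; apply.
    by rewrite scalerDr addrACA [in RHS]scalerDl -scalerA.
  - by move=> b Bb; exists b, 0; rewrite scale0r addr0.
  - move=> _ [b [a [Bb ->]]]; apply: issubD => //; first exact: BZ.
    by do 2![apply: issubZ => //].
have -> : (l.+1 - i = (l.+1 - i.+1).+1)%N by rewrite subSS subSn.
set j := (l.+1 - i.+1)%N; split.
  move=> _ [b [a [Bb ->]]]; exists b, (a * z); split=> //.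
  by rewrite exprSr !scalerA mulrA mulrAC.
move=> h; have [b [a [Bb e]]] : U j.+1 (z ^+ j *: x).
  by apply: h; exists 0, 1; rewrite scale1r add0r; split=> //; exact: issub0.
apply: hB; exists j; have [u hu'] := hu a.
rewrite -[_ *: x]scale1r -hu' -scalerA; apply: issubZ => //.
suff -> : (1 - a * z) *: (z ^+ j *: x) = b by [].
rewrite scalerBl scale1r {1}e exprS !scalerA mulrA addrK //.
Qed.

Section Local.
Variable mm : idealr A.
Hypotheses (hA : noetherian A) (hloc : is_local mm).

Definition idp (U : set A^o) of issub U & ~ U 1 : pred A := fun x => `[< U x >].
Fact idp_closed U (h : issub U) (h1 : ~ U 1) : idealr_closed (idp h h1).
Proof.
split; [exact/asboolP/(issub0 h)|exact/asboolP|].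
by move=> a u v /asboolP hu /asboolP hv; apply/asboolP; case: h => _; apply.
Qed.
HB.instance Definition _ U (h : issub U) (h1 : ~ U 1) :=
  isIdealr.Build A (idp h h1) (idp_closed h h1).

Lemma idealr_issub (J : idealr A) : issub ([set x | x \in J] : set A^o).
Proof.
split=> [|a u v hu hv]; first exact: (idealr0 J).
exact: (rpredD (idealMr a hu) hv).
Qed.

Lemma local_unit x : x \notin mm -> exists u, u * x = 1.
Proof.
move=> hx; apply: contrapT => hu.
pose U0 : set A^o := [set y | exists a, y = a * x].
have s0 : issub U0.
  split; first by exists 0; rewrite mul0r.
  by move=> a _ _ [b ->] [c ->]; exists (a * b + c); rewrite mulrDl -mulrA.
have P0 : ~ U0 1 /\ U0 `<=` U0 by split=> // -[a ha]; apply: hu; exists a.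
have [U [sU _ [U1 U0U] hU]] := @acc_max A A^o setT (fun U => ~ U 1 /\ U0 `<=` U) U0
  (issubT _) (acc_ring hA) s0 (fun _ _ => I) P0.
pose J : idealr A := idp sU U1.
have hJ : is_maximal J.
  move=> K JK y Ky; apply/asboolP; apply: (hU [set x | x \in K]) => //.
  - exact: idealr_issub.
  - by move=> z Uz; apply: JK; apply/asboolP.
  - by split=> [/=|z /U0U Uz]; [rewrite idealr1|apply: JK; apply/asboolP].
move: hx; rewrite -(hloc.2 J hJ) => /asboolP; apply; apply: U0U.
by exists 1; rewrite mul1r.
Qed.

Lemma local_unit1 z c : z \in mm -> exists u, u * (1 - c * z) = 1.
Proof.
move=> hz; apply: local_unit; apply/negP => h.
have h2 : c * z \in mm by apply: idealMr.
have := issubD (idealr_issub mm) h h2; rewrite subrK.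
by rewrite /= idealr1.
Qed.
End Local.
End QuotientLength.

(** * Rees modules *)

Section Rees.
Variables (A : comNzRingType) (N : lmodType A) (I : {pred A}).
Implicit Types V : lmodType A.

Lemma smul_gen V (J : {pred A}) (W : {pred V}) a w :
  a \in J -> w \in W -> a *: w \in smul J W.
Proof.
move=> Ja Ww; apply/asboolP; exists 1%N, (fun=> 1), (fun=> a *: w); split.
  by move=> _; exists a, w.
by rewrite big_ord_recl big_ord0 addr0 scale1r.
Qed.

Lemma smul_least V (J : {pred A}) (W : {pred V}) (U : set V) : issub U ->
  (forall a w, a \in J -> w \in W -> U (a *: w)) -> forall x, x \in smul J W -> U x.
Proof.
move=> sU h x /asboolP[n [c [e [he ->]]]]; apply: issub_sum => // i _.
by apply: issubZ => //; have [a [w [Ja Ww ->]]] := he i; apply: h.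
Qed.

Lemma pow_smul_sub V n : issub [set x : V | x \in pow_smul V I n].
Proof. exact: submodClosed_issub. Qed.

Lemma pow_smul_sum V n p (f : 'I_p -> V) :
  (forall i, f i \in pow_smul V I n) -> \sum_i f i \in pow_smul V I n.
Proof.
move=> h; apply: (issub_sum (U := [set x | x \in pow_smul V I n])) => [|i _ /=].
  exact: pow_smul_sub.
exact: h.
Qed.

Lemma pow_smulZ V n a (x : V) : x \in pow_smul V I n -> a *: x \in pow_smul V I n.
Proof. exact: (issubZ a (pow_smul_sub V n)). Qed.

Lemma pow_smul0 V (x : V) : x \in pow_smul V I 0.
Proof.
rewrite -[x]scale1r; apply: smul_gen => //.
apply/asboolP; exists 1%N, (fun=> 1), (fun=> 1); split=> //.
by rewrite big_ord_recl big_ord0 addr0 scale1r.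
Qed.

Lemma pow_smulS V n a (x : V) : a \in I -> x \in pow_smul V I n -> a *: x \in pow_smul V I n.+1.
Proof.
move=> Ia; apply: (smul_least (U := [set x | a *: x \in pow_smul V I n.+1])).
  have s := pow_smul_sub V n.+1; split=> /=; first by rewrite scaler0; exact: (issub0 s).
  move=> b u v hu hv; rewrite scalerDr scalerA mulrC -scalerA.
  by case: s => _; apply.
move=> b w hb _ /=; rewrite scalerA; apply: smul_gen => //.
exact: (@smul_gen A^o).
Qed.

Section Generators.
Variables (q : nat) (a : 'I_q -> A).
Hypothesis Ia : forall j, a j \in I.
Hypothesis Igen : forall x, x \in I -> exists c : 'I_q -> A, x = \sum_j c j * a j.

Lemma pow_smul_gen V n (x : V) : x \in pow_smul V I n.+1 ->
  exists z : 'I_q -> V, (forall j, z j \in pow_smul V I n) /\ x = \sum_j a j *: z j.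
Proof.
have sn := pow_smul_sub V n.
set P := [set x : V | exists z : 'I_q -> V, (forall j, z j \in pow_smul V I n) /\ x = \sum_j a j *: z j].
have sP : issub P.
  split; first by exists (fun=> 0); split; [move=> _; exact: (issub0 sn)|rewrite big1 // => j _; rewrite scaler0].
  move=> b _ _ [z [hz ->]] [z' [hz' ->]]; exists (fun j => b *: z j + z' j); split.
    by move=> j; case: sn => _ h; exact: (h b _ _ (hz j) (hz' j)).
  rewrite scaler_sumr -big_split; apply: eq_bigr => j _ /=.
  by rewrite scalerDr !scalerA mulrC.
apply: (smul_least (U := P)) => // b w hb _.
have sPw (f : A) : issub ([set e : A^o | P ((e * f) *: w)]).
  split=> /=; first by rewrite mul0r scale0r; exact: (issub0 sP).
  move=> k u v hu hv; rewrite mulrDl scalerDl -[k *: u]/(k * u) -mulrA -scalerA.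
  by case: sP => _; apply.
suff : [set e : A^o | P ((e * 1) *: w)] b by rewrite /= mulr1.
apply: (smul_least (J := I) (W := mem (ideal_pow I n))) hb => // e f he hf /=.
rewrite mulr1 -[e *: f]/(e * f).
have [c ->] := Igen he; rewrite mulr_suml.
have -> : (\sum_j c j * a j * f) *: w = \sum_j c j *: (a j *: (f *: w)).
  by rewrite scaler_suml; apply: eq_bigr => j _; rewrite !scalerA ?mulrA.
apply: issub_sum => // j _; apply: issubZ => //.
exists (fun i => (i == j)%:R *: (f *: w)); split=> [i|].
  by apply: pow_smulZ; apply: smul_gen.
rewrite (bigD1 j) //= eqxx scale1r big1 ?addr0 // => i /negPf ->.
by rewrite scale0r scaler0.
Qed.

Lemma pow_smul_le V n (x : V) : x \in pow_smul V I n.+1 -> x \in pow_smul V I n.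
Proof.
move=> /pow_smul_gen [z [hz ->]].
by apply: pow_smul_sum => j; apply: pow_smulZ.
Qed.

Definition rees_ob n : lmodType A := submod (pow_smul N I n).
Lemma rees_op_mem j n (x : rees_ob n) : a j *: sinc x \in pow_smul N I n.+1.
Proof. by apply: pow_smulS => //; apply: sincP. Qed.
Definition rees_op j n (x : rees_ob n) : rees_ob n.+1 := smk (rees_op_mem j x).
Fact rees_op_linear j n : linear (@rees_op j n).
Proof.
move=> b x y; apply: sinc_inj; rewrite [RHS]sinc_linear.
rewrite -[LHS]/(a j *: sinc (b *: x + y)) sinc_linear scalerDr scalerA mulrC -scalerA.
by [].
Qed.
HB.instance Definition _ j n :=
  GRing.isLinear.Build A (rees_ob n) (rees_ob n.+1) *:%R (@rees_op j n) (@rees_op_linear j n).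

(* The Rees module of [I] and [N]; the variable [X_j] acts as the generator [a j]. *)
Definition rees : gsys A q := @GSys A q rees_ob (fun j n => @rees_op j n).

Lemma rees_comm : comm rees.
Proof.
by move=> i j n x; apply: sinc_inj; rewrite /= /rees_op !smkK !scalerA mulrC.
Qed.

Hypotheses (hA : noetherian A) (N_fg : fin_gen N).

Lemma rees_fg n : fin_gen (rees n).
Proof. exact: fg_submod. Qed.

Lemma rees_noeth : noeth (full rees).
Proof.
apply: (@noeth_gen A q (full rees) 0) => [||n|n x _ _].
- exact: full_wf.
- exact: rees_comm.
- by rewrite leqn0 => /eqP ->; apply: fg_acc => //; apply: rees_fg.
have [z [hz hx]] := pow_smul_gen (sincP x).
exists (fun j => smk (hz j)); split=> //=; apply: sinc_inj.
by rewrite linearB linear0 /= linear_sum /= hx subrr.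
Qed.

(** Each [I^(k+1) N / I^(k+2) N] is the image of [q] copies of [I^k N / I^(k+1) N] under the
    generators of [I]. *)
Lemma lenle_pow_smul l n : @lenle A N setT [set x | x \in smul I (predT : {pred N})] l ->
  exists k, @lenle A N setT [set x | x \in pow_smul N I n] k.
Proof.
move=> hl; have sp k := pow_smul_sub N k.
have step k : exists b, lenle [set x | x \in pow_smul N I k] [set x | x \in pow_smul N I k.+1] b.
  elim: k => [|k [b hb]].
    exists l; apply: lenle_sub hl => // x /=.
    apply: (smul_least (sp 1%N)) => c w Ic _.
    by apply: pow_smulS => //; apply: pow_smul0.
  have w1 : mwf [set x : N | x \in pow_smul N I k] [set x | x \in pow_smul N I k.+1].
    by split=> // x; apply: pow_smul_le.
  have w2 : mwf [set x : N | x \in pow_smul N I k.+1] [set x | x \in pow_smul N I k.+2].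
    by split=> // x; apply: pow_smul_le.
  exists (q * b)%N; have := lenle_pow (p := q) w1 hb.
  pose f (v : {ffun 'I_q -> N}) := \sum_j a j *: v j.
  have fL c u v : f (c *: u + v) = c *: f u + f v.
    rewrite /f scaler_sumr -big_split; apply: eq_bigr => j _ /=.
    by rewrite !ffunE scalerDr !scalerA mulrC.
  have fB k' (v : {ffun 'I_q -> N}) : (forall j, v j \in pow_smul N I k') -> f v \in pow_smul N I k'.+1.
    by move=> hv; apply: pow_smul_sum => j; apply: pow_smulS.
  apply: (lenle_surj (R := fun (v : {ffun 'I_q -> N}) x => (forall j, v j \in pow_smul N I k) /\ x = f v)) => //.
  - by split; [exact: pow_issub|exact: pow_issub|move=> v hv j; apply: pow_smul_le; apply: hv].
  - have s1 := pow_issub q (sp k); split=> [|c x y _ _ [Zx ->] [Zy ->]|x _ [Zx ->]|x Zx|x _ [_ ->]].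
    + split; first exact: (issub0 s1).
      by rewrite /f big1 // => j _; rewrite ffunE scaler0.
    + by split; [case: s1 => _ h; exact: h|rewrite fL].
    + by split=> //; apply: fB.
    + by exists (f x).
    + exact: fB.
  - move=> x /pow_smul_gen [z [hz ->]]; exists [ffun j => z j]; split=> [j|]; first by rewrite ffunE.
    by apply: eq_bigr => j _; rewrite ffunE.
elim: n => [|n [k hk]].
  by exists 0%N; apply: lenle0 => x _; apply: pow_smul0.
have [b hb] := step n; exists (b + k)%N.
apply: (lenle_step (U := [set x | x \in pow_smul N I n])) => //; split=> // x.
exact: pow_smul_le.
Qed.

Section Finite.
Variables (l : nat) (hl : @lenle A N setT [set x | x \in smul I (predT : {pred N})] l).
Variables (U : lmodType A) (F : free_resolution U) (i : nat).
Hypothesis hN : hexact N F i.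

Lemma sinc_ffun p n (v : {ffun 'I_p -> N}) : (forall k, v k \in pow_smul N I n) ->
  exists c : {ffun 'I_p -> rees_ob n}, fmap (@sinc A _ _) c = v.
Proof.
move=> h; exists [ffun k => smk (h k)]; apply/ffunP => k.
by rewrite [LHS]ffunE ffunE.
Qed.

Lemma torsys_cycE n (c : {ffun 'I_(rk F i.+1) -> rees_ob n}) :
  cyc (torsys F i rees) n c <-> tensor_mx (diff F i) (fmap (@sinc A _ _) c) = 0.
Proof.
rewrite tensor_nat; split=> [/= ->|h]; first exact: linear0.
by apply: (fmap_inj (@sinc_inj A _ _)); rewrite linear0.
Qed.

Lemma torsys_bndE n (c : {ffun 'I_(rk F i.+1) -> rees_ob n}) :
  bnd (torsys F i rees) n c <-> exists w : {ffun 'I_(rk F i.+2) -> N},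
    (forall k, w k \in pow_smul N I n) /\ fmap (@sinc A _ _) c = tensor_mx (diff F i.+1) w.
Proof.
split=> [[w ->]|[w [/sinc_ffun [w' hw'] h]]].
  exists (fmap (@sinc A _ _) w); split; last by rewrite tensor_nat.
  by move=> k; rewrite ffunE; apply: sincP.
exists w'; apply: (fmap_inj (@sinc_inj A _ _)).
by rewrite h -hw' tensor_nat.
Qed.

(* A cycle of [F (x) I^n N] bounds in [F (x) N]; this presents the homology as a
   quotient of a submodule of [(N / I^n N)^r]. *)
Lemma rees_finlen : finlen (torsys F i rees).
Proof.
move=> n; have [k hk] := lenle_pow_smul n hl.
have sp := pow_smul_sub N n.
pose X := [set v : {ffun 'I_(rk F i.+2) -> N} | forall j, tensor_mx (diff F i.+1) v j \in pow_smul N I n].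
pose Y := [set v : {ffun 'I_(rk F i.+2) -> N} | forall j, v j \in pow_smul N I n].
have YX : Y `<=` X.
  move=> v hv j; rewrite ffunE; apply: pow_smul_sum => s.
  exact: pow_smulZ.
have sX : issub X.
  split=> [j|c u v hu hv j]; first by rewrite linear0 ffunE; exact: (issub0 sp).
  rewrite linearP; move: (hu j) (hv j) => /=.
  move: (tensor_mx _ u) (tensor_mx _ v) => u' v' hu' hv'.
  by rewrite !ffunE; case: sp => _ h; exact: (h c _ _ hu' hv').
have wXY : mwf X Y by split=> //; exact: (pow_issub (rk F i.+2) sp).
have wT : mwf [set: N] [set x | x \in pow_smul N I n] by split.
exists (rk F i.+2 * k)%N.
have := lenle_pow (p := rk F i.+2) wT hk => h1.
have hX : lenle X Y (rk F i.+2 * k) by apply: lenle_sub h1.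
apply: (lenle_surj wXY (torsys_mwf _ _ _) (R := fun v (c : {ffun 'I_(rk F i.+1) -> rees_ob n}) =>
   X v /\ fmap (@sinc A _ _) c = tensor_mx (diff F i.+1) v) _ _ hX).
  split=> [|b x y x' y' [Zx hx] [Zy hy]|x c [Zx hx]|x Zx|x c [Zx hx] hY].
  - by split; [exact: (issub0 sX)|rewrite !linear0].
  - by split; [case: sX => _ h; exact: h|rewrite !linearP /= hx hy].
  - by split=> //; apply/torsys_cycE; rewrite hx tensor_diff0.
  - by have [c hc] := sinc_ffun Zx; exists c.
  - by apply/torsys_bndE; exists x.
move=> c /torsys_cycE /hN [v hv]; exists v; split=> // j.
by rewrite -hv ffunE; apply: sincP.
Qed.
End Finite.
End Generators.
End Rees.

(** * Serre classes containing the Tor of the residue field *)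

Section TorClasses.
Variables (A : comNzRingType) (mm : idealr A).
Hypotheses (hA : noetherian A) (hloc : is_local mm).
Implicit Types L V : lmodType A.

Lemma image_modP V V' (f : {linear V -> V'}) x : (x \in image_mod f) <-> exists y, f y = x.
Proof. by split=> [/asboolP|h]; [|exact/asboolP]. Qed.

Section FixSystem.
Variables (m : nat) (W : gsys A m).
Hypothesis cW : comm W.

Lemma first_step L' L (f : {linear L' -> L}) (F' : free_resolution L') (F : free_resolution L) :
  injective f -> exists G : free_resolution (quotmod (image_mod f)),
    forall i, exact3 (torsys F' i W) (torsys F i W) (torsys G i W) /\
              exact3 (torsys G i.+1 W) (torsys F' i W) (torsys F i W).
Proof.
move=> fi; have [phi [phi0 phiS]] := lift_exists F' F f.
have ex x : quopi (image_mod f) x = 0 <-> exists y, f y = x.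
  by split=> [/quopi_eq0/image_modP|/image_modP/quopi_eq0].
exists (cone_res fi (@quopi_surj A L (image_mod f)) ex phi0 phiS) => i.
by split; [exact: exact_first|exact: exact_conn].
Qed.

Section Shift.
Variables (L : lmodType A) (F : free_resolution L) (e : nat).
Let f : {linear 'rV_(rk F e.+1) -> 'rV_(rk F e)} := mulmxr (diff F e).
Fact syzygy_im x : f x \in image_mod f.
Proof. by apply/image_modP; exists x. Qed.
Fact syzygy_surj u : exists x, cores syzygy_im x = u.
Proof. by have /image_modP [x hx] := sincP u; exists x; apply: sinc_inj. Qed.
Fact syzygy_exact x : cores syzygy_im x = 0 <-> exists y, x = y *m diff F e.+1.
Proof.
split=> [h|/diff_exact h].
  by apply/diff_exact; have := congr1 (@sinc A _ _) h; rewrite linear0.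
by apply: sinc_inj; rewrite linear0.
Qed.
Definition syzygy_res : free_resolution (syzygy F e.+1) :=
  @FreeResolution A (syzygy F e.+1) (fun j => rk F (j + e.+1)) (fun j => diff F (j + e.+1))
    (cores syzygy_im) syzygy_surj syzygy_exact (fun j => @diff_exact A L F (j + e.+1)).
End Shift.

(* [syzygy_res F 0], with indices [j.+1] instead of [j + 1] up to conversion. *)
Definition shift_res L (F : free_resolution L) : free_resolution (syzygy F 1) :=
  @FreeResolution A (syzygy F 1) (fun j => rk F j.+1) (fun j => diff F j.+1)
    (cores (@syzygy_im L F 0)) (@syzygy_surj L F 0) (@syzygy_exact L F 0)
    (fun j => @diff_exact A L F j.+1).

Definition scalquo (z : A) (T : gquo A m) : gquo A m := @GQuo A m T (cyc T)
  (fun n => [set x | exists b c, [/\ bnd T n b, cyc T n c & x = b + z *: c]]).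

Lemma scalquo_bnd z T n : gwf T -> bnd T n `<=` bnd (scalquo z T) n.
Proof.
move=> w x Bx; exists x, 0; rewrite scaler0 addr0; split=> //.
exact: (issub0 (cyc_sub n w)).
Qed.

Lemma scalquo_sub z T : gwf T -> subfam T (bnd (scalquo z T)).
Proof.
move=> w; have [w1 w2 w3] := w; split=> [n|j n x [b [c [Bb Zc ->]]]].
  have [sZ sB BZ] := w1 n; split.
  - split; first exact/(scalquo_bnd z w)/(issub0 sB).
    move=> a _ _ [b [c [Bb Zc ->]]] [b' [c' [Bb' Zc' ->]]].
    exists (a *: b + b'), (a *: c + c'); split; [by case: sB => _; apply|by case: sZ => _; apply|].
    rewrite !scalerDr addrACA; congr (_ + (_ + _)).
    by rewrite !scalerA mulrC.
  - exact: scalquo_bnd.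
  - move=> _ [b [c [Bb Zc ->]]]; apply: issubD => //; first exact: BZ.
    exact: issubZ.
by exists (gop T j n b), (gop T j n c); rewrite linearD linearZ; split; [exact: w3|exact: w2|].
Qed.

Lemma scalquo_wf z T : gwf T -> gwf (scalquo z T).
Proof. by move=> w; apply: (subfam_wf w (scalquo_sub z w)).2. Qed.

Section Coker.
Variables (L : lmodType A) (z : A) (F : free_resolution L).
Hypothesis zi : forall x : L, z *: x = 0 -> x = 0.

(** Multiplication by [z] lifts to the scalar matrix on [F]; its cone resolves [L / z L], and the
    cokernel of [z] on Tor embeds in the Tor of that quotient. *)
Lemma scalquo_step : exists (G : free_resolution
    (quotmod (image_mod (GRing.scale z : {linear L -> L})))),
  forall i, exact3 (nullsys (scalquo z (torsys F i W))) (scalquo z (torsys F i W)) (torsys G i W).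
Proof.
pose f : {linear L -> L} := GRing.scale z.
have fi : injective f.
  by move=> x y /eqP; rewrite -subr_eq0 -linearB => /eqP /zi /eqP; rewrite subr_eq0 => /eqP.
have ex x : quopi (image_mod f) x = 0 <-> exists y, f y = x.
  by split=> [/quopi_eq0/image_modP|/image_modP/quopi_eq0].
pose phi i : 'M[A]_(rk F i, rk F i) := z%:M.
have phi0 x : f (aug F x) = aug F (x *m phi 0%N) by rewrite mul_mx_scalar linearZ.
have phiS i : sq (phi i) (phi i.+1) by rewrite /sq /phi scalar_mxC.
pose G := cone_res fi (@quopi_surj A L (image_mod f)) ex phi0 phiS.
exists G => i.
pose R : forall n, scalquo z (torsys F i W) n -> torsys G i W n -> Prop :=
  @rinl A m _ _ _ F F f (quopi (image_mod f)) fi (@quopi_surj A L (image_mod f)) ex phi phi0 phiS i W.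
apply: (@exact3_inj A m (scalquo z (torsys F i W)) (torsys G i W) R).
- exact/scalquo_wf/torsys_wf.
- have [h1 h2] := ghom_inl fi (@quopi_surj A L (image_mod f)) ex phi0 phiS i W.
  split=> // n; have [a b c d e] := h1 n; split=> // x x' Rx [b1 [c1 [Bb Zc hx]]].
  have [Zx hx'] := Rx.
  have [s hs] := Bb.
  exists (fjoin s c1); rewrite hx'; apply: fjoin_eq.
    rewrite (cone_fl fi (@quopi_surj A L (image_mod f)) ex phi0 phiS (i:=i.+1)).
    by rewrite fl_join fr_join /= /finl fl_join tensor_scalar -hs.
  rewrite (cone_fr fi (@quopi_surj A L (image_mod f)) ex phi0 phiS (i:=i.+1)).
  by rewrite fr_join /= /finl fr_join [tensor_mx _ c1]Zc oppr0.
- move=> n x _ [Zx ->] [w0 hw].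
  pose w : {ffun 'I_(rk F i.+2 + rk F i.+1) -> W n} := w0.
  rewrite -[w0]/w in hw.
  have h1 : x = tensor_mx (diff F i.+1) (fl w) + z *: fr w.
    rewrite -tensor_scalar.
    rewrite -(cone_fl fi (@quopi_surj A L (image_mod f)) ex phi0 phiS (i:=i.+1)).
    by rewrite -hw /= /finl fl_join.
  exists (tensor_mx (diff F i.+1) (fl w)), (fr w); split=> //; first by exists (fl w).
  have := congr1 (@fr _ _ _ _) hw.
  rewrite (cone_fr fi (@quopi_surj A L (image_mod f)) ex phi0 phiS (i:=i.+1)).
  by rewrite /= /finl fr_join => /eqP; rewrite eq_sym oppr_eq0 => /eqP.
Qed.
End Coker.

Variable C : gquo A m -> Prop.
Hypothesis hC : serre C.

Lemma zero_class L (F : free_resolution L) i : (forall x : L, x = 0) -> C (torsys F i W).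
Proof.
move=> L0; apply: hC.1; [exact: torsys_wf|exact: torsys_comm|].
by move=> n v /= /(zero_hexact L0).
Qed.

Lemma step_class L' L (f : {linear L' -> L}) (F' : free_resolution L') (F : free_resolution L) i :
  injective f -> C (torsys F' i W) ->
  (forall G : free_resolution (quotmod (image_mod f)), C (torsys G i W)) -> C (torsys F i W).
Proof.
move=> fi h1 h2; have [G hG] := first_step F' F fi; have [ex _] := hG i.
by apply: (hC.2 _ _ _ _ _ _ _ _ _ ex) => //; try exact: torsys_wf; exact: torsys_comm.
Qed.

Section Index.
Variable i : nat.
Hypothesis nak : forall L (F : free_resolution L) z, fin_gen L -> z \in mm ->
  C (scalquo z (torsys F i W)) -> C (torsys F i W).
Variable Fk : free_resolution (residue_module mm).
Hypothesis hk : C (torsys Fk i W).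

Definition cyclic L (u : L) := forall x, exists c : A, x = c *: u.
Definition ann L (u : L) : set A^o := [set c | c *: u = 0].

Lemma cyclic_fg L (u : L) : cyclic u -> fin_gen L.
Proof.
move=> h; apply/fin_genE; exists 1%N, (fun=> u) => x _; have [c ->] := h x.
by exists (fun=> c); rewrite big_ord_recl big_ord0 addr0.
Qed.

Lemma ann_sub L (u : L) : issub (ann u).
Proof.
split; first exact: scale0r.
by move=> a x y /= hx hy; rewrite /ann /= scalerDl -scalerA hx hy scaler0 addr0.
Qed.

Lemma cyclic_quot L (u : L) (Y : submodClosed L) : cyclic u -> cyclic (quopi Y u).
Proof.
move=> h y; have [x <-] := quopi_surj y; have [c ->] := h x.
by exists c; rewrite linearZ.
Qed.

Lemma residue_map L (u : L) : (forall c, c \in mm -> c *: u = 0) -> (forall c, c *: u = 0 -> c \in mm) ->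
  exists f : {linear residue_module mm -> L}, injective f /\ forall c : A, f (quopi _ (c : A^o)) = c *: u.
Proof.
move=> h1 h2.
have lin : linear (fun c : A^o => c *: u).
  by move=> a x y; rewrite scalerDl scalerA.
pose g : {linear A^o -> L} := HB.pack (fun c : A^o => (c : A) *: u)
   (GRing.isLinear.Build A A^o L *:%R (fun c : A^o => (c : A) *: u) lin).
pose J := GRing.SubmodClosed.clone A A^o (ideal_pred mm) _.
have g0 (x : A^o) : x \in J -> g x = 0 by move=> hx; apply: h1.
exists (qliftm g0); split; last by move=> c; rewrite qlmE.
move=> x y; have [x' <-] := quopi_surj x; have [y' <-] := quopi_surj y.
rewrite !qlmE => /eqP; rewrite -subr_eq0 -linearB => /eqP /h2 h.
by apply/eqP; rewrite -subr_eq0 -linearB; apply/eqP/quopi_eq0.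
Qed.

Lemma cyclic_sub L (x : L) (h : issub (spanset (fun _ : 'I_1 => x))) :
  exists2 y : submod (smod h), sinc y = x & cyclic y.
Proof.
have hx : x \in smod h by apply/smodE; exact: (spanset_gen (fun _ : 'I_1 => x) ord0).
exists (smk hx) => // y; have /smodE [c hc] := sincP y.
exists (c ord0); apply: sinc_inj.
by rewrite hc big_ord_recl big_ord0 addr0 [RHS]linearZ.
Qed.

Lemma cyclic_class L (u : L) (F : free_resolution L) : cyclic u -> C (torsys F i W).
Proof.
pose P (U : set A^o) := exists L (u : L), [/\ cyclic u, ann u = U & exists F : free_resolution L, ~ C (torsys F i W)].
move=> cu; apply: contrapT => hF.
have P0 : P (ann u) by exists L, u; split=> //; exists F.
have [U [sU _ [{hF P0}L' [{}u [{}cu eU [{}F hF]]]] hU]] :=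
  @acc_max A A^o setT P (ann u) (issubT _) (acc_ring hA) (ann_sub u) (fun _ _ => I) P0.
apply: hF.
have IH L2 (u2 : L2) (F2 : free_resolution L2) c : cyclic u2 ->
    (forall a, a *: u = 0 -> a *: u2 = 0) -> c *: u2 = 0 -> c *: u <> 0 -> C (torsys F2 i W).
  move=> cu2 sub hc1 hc2; apply: contrapT => hF2; apply: hc2.
  have : ann u2 `<=` U.
    apply: hU => //; [exact: ann_sub| |by exists L2, u2; split=> //; exists F2].
    by rewrite -eU => a; apply: sub.
  by rewrite -eU; apply.
have [u0|u0] := pselect (u = 0).
  by apply: zero_class => x; have [c ->] := cu x; rewrite u0 scaler0.
(* [ann u] is not prime: the submodule generated by [b u] and the quotient by it are cyclic with
   larger annihilators. *)
have [[b [c [hb hc hcb]]]|hp] := pselect (exists b c : A, [/\ b *: u <> 0, c *: u <> 0 & c *: (b *: u) = 0]).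
  have h := spanset_sub (fun _ : 'I_1 => b *: u).
  have [y hy cy] := cyclic_sub h.
  have [F' _] := free_resolution_exists hA (cyclic_fg cy).
  apply: (@step_class _ _ (@sinc A L' (smod h)) F' F); first exact: sinc_inj.
    apply: (IH _ y F' c cy) => // [a ha|]; apply: sinc_inj; rewrite linearZ linear0 /= hy //.
    by rewrite scalerA mulrC -scalerA ha scaler0.
  move=> G; apply: (IH _ (quopi (image_mod (@sinc A L' (smod h))) u) G b) => //.
  - exact: cyclic_quot.
  - by move=> a ha; rewrite -linearZ /= ha linear0.
  - rewrite -linearZ /=; apply/quopi_eq0/image_modP; by exists y.
(* [ann u] is prime and omits [z], so [z] is regular on [L'] and Nakayama reduces to [L' / z L']. *)
have [[z hz zu]|hm] := pselect (exists2 z, z \in mm & z *: u <> 0).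
  apply: (nak (z := z)) => //; first exact: cyclic_fg cu.
  have zi (x : L') : z *: x = 0 -> x = 0.
    have [b ->] := cu x => hzb; apply: contrapT => hb; apply: hp.
    by exists b, z.
  have [G hG] := scalquo_step F zi.
  have wH := torsys_wf F i W; have cH : comm (torsys F i W) by exact: torsys_comm.
  apply: (hC.2 _ _ _ _ _ _ _ _ _ (hG i)).
  - exact/nullsys_wf/scalquo_wf.
  - exact: scalquo_wf.
  - exact: torsys_wf.
  - exact: cH.
  - exact: cH.
  - exact: torsys_comm.
  - by apply: hC.1; [exact/nullsys_wf/scalquo_wf|exact: cH|move=> k x].
  - apply: (IH _ (quopi _ u) G z) => //; first exact: cyclic_quot.
      by move=> a ha; rewrite -linearZ /= ha linear0.
    by rewrite -linearZ /=; apply/quopi_eq0/image_modP; exists u.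
(* Now [ann u] is the maximal ideal, and [L'] is a copy of the residue module. *)
have [f [fi fE]] : exists f : {linear residue_module mm -> L'}, injective f /\ forall c : A, f (quopi _ (c : A^o)) = c *: u.
  apply: residue_map => [c hc|c hc].
    by apply: contrapT => h; apply: hm; exists c.
  apply: contrapT => /negP /(local_unit hA hloc) [v hv]; apply: u0.
  by rewrite -[u]scale1r -hv -scalerA hc scaler0.
apply: (step_class (F' := Fk) (f := f)) => // G; apply: zero_class => x.
have [y <-] := quopi_surj x; apply/quopi_eq0/image_modP.
by have [c ->] := cu y; exists (quopi _ (c : A^o)).
Qed.

Lemma fg_class L (F : free_resolution L) : fin_gen L -> C (torsys F i W).
Proof.
move=> /fin_genE [n [e he]]; elim: n L F e he => [|n IH] L F e he.
  by apply: zero_class => x; have [c ->] := he x I; rewrite big_ord0.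
have h := spanset_sub (fun _ : 'I_1 => e ord0).
have [y hy cy] := cyclic_sub h.
have [F' _] := free_resolution_exists hA (cyclic_fg cy).
apply: (@step_class _ _ (@sinc A L (smod h)) F' F); first exact: sinc_inj.
  exact: (cyclic_class F' cy).
move=> G; apply: (IH _ G (fun j => quopi _ (e (lift ord0 j)))) => x _.
have [x' <-] := quopi_surj x; have [c ->] := he x' I.
exists (fun j => c (lift ord0 j)); rewrite linear_sum big_ord_recl /=.
have -> : quopi (image_mod (@sinc A L (smod h))) (c ord0 *: e ord0) = 0.
  by apply/quopi_eq0/image_modP; exists (c ord0 *: y); rewrite linearZ /= hy.
by rewrite add0r; apply: eq_bigr => j _; rewrite linearZ.
Qed.
(** The resolution without its first term computes the same Tor for the first syzygy, which is again
    finitely generated. *)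
Lemma fg_class_le L (F : free_resolution L) j :
  fin_gen L -> (i <= j)%N -> C (torsys F j W).
Proof.
move=> fgL /subnK <-; elim: (j - i)%N L F fgL => [|k IH] L F fgL.
  exact: (fg_class F fgL).
have h := IH _ (shift_res F); rewrite addSn; apply: h.
exact: (@fg_surj A _ _ (aug (shift_res F)) (@aug_surj _ _ (shift_res F)) (@fg_row A _)).
Qed.

End Index.

(** [T_j(k)] lies between [T_{j+1}(Q / k)] and [T_j(Q)] in the long exact sequence; this is the
    downward step in the index. *)
Lemma class_pred Q (FQ : free_resolution Q) (Fk : free_resolution (residue_module mm)) j
    (f : {linear residue_module mm -> Q}) :
  injective f -> fin_gen Q -> C (torsys FQ j W) ->
  (forall L (F : free_resolution L), fin_gen L -> C (torsys F j.+1 W)) -> C (torsys Fk j W).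
Proof.
move=> fi fgQ h1 h2; have [G hG] := first_step Fk FQ fi; have [_ ex] := hG j.
apply: (hC.2 _ _ _ _ _ _ _ _ _ ex) => //; try exact: torsys_wf; try exact: torsys_comm.
by apply: h2; exact: (@fg_surj A _ _ (quopi (image_mod f)) (@quopi_surj _ _ _) fgQ).
Qed.
End FixSystem.
End TorClasses.

(** * Regular sequences and heights *)

Section Primes.
Variables (A : comNzRingType) (mm : idealr A).
Hypotheses (hA : noetherian A) (hloc : is_local mm).
Implicit Types (P : prime_idealr A) (V Q : lmodType A).

Fact idp_prime (U : set A^o) (h : issub U) (h1 : ~ U 1) :
  (forall a b : A, U (a * b) -> U a \/ U b) -> prime_idealr_closed (idp h h1).
Proof.
by move=> hp a b /asboolP /hp [hu|hu]; apply/orP; [left|right]; exact/asboolP.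
Qed.

Definition mk_prime (U : set A^o) (h : issub U) (h1 : ~ U 1)
    (hp : forall a b : A, U (a * b) -> U a \/ U b) : prime_idealr A :=
  HB.pack (idp h h1) (isPrimeIdealrClosed.Build A (idp h h1) (@idp_prime U h h1 hp)).

Definition strict P P' := {subset P <= P'} /\ ~ {subset P' <= P}.

(* [P'] is maximal among the ideals that contain [J] and avoid all [a x^n], [a] outside [P]. *)
Lemma prime_below (J : set A^o) P x : issub J -> (forall a : A, J a -> a \in P) ->
  (forall a : A, J (x * a) -> J a) -> x \in P ->
  exists P', (forall a : A, J a -> a \in P') /\ strict P' P.
Proof.
move=> sJ JP hx xP.
pose disj (U : set A^o) := J `<=` U /\ forall (a : A) n, a \notin P -> ~ U (a * x ^+ n).
have gJ : disj J.
  split=> // a n aP; elim: n => [|n IH]; first by rewrite mulr1 => /JP; rewrite (negPf aP).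
  by rewrite exprS mulrCA => /hx.
have [U [sU _ [JU gU] mU]] := @acc_max A A^o setT disj J (issubT _) (acc_ring hA) sJ (fun _ _ => I) gJ.
have U1 : ~ U 1.
  have : ~ U (1 * x ^+ 0) by apply: gU; rewrite idealr1.
  by rewrite mulr1.
pose ad (b : A) : set A^o := [set y | exists u c, U u /\ y = u + c * b].
have sad b : issub (ad b).
  split; first by exists 0, 0; rewrite mul0r addr0; split=> //; exact: issub0.
  move=> a _ _ [u [c [Uu ->]]] [u' [c' [Uu' ->]]].
  exists (a *: u + u'), (a * c + c'); split; first by case: sU => _; apply.
  by rewrite scalerDr addrACA mulrDl -mulrA.
have adU b : U `<=` ad b by move=> u Uu; exists u, 0; rewrite mul0r addr0.
have meet b : ~ U b -> exists a n, a \notin P /\ ad b (a * x ^+ n).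
  move=> Ub; apply: contrapT => h; apply: Ub; apply: (mU (ad b)) => //.
    split; first exact: subset_trans (adU b).
    by move=> a n aP hab; apply: h; exists a, n.
  by exists 0, 1; rewrite mul1r add0r; split=> //; exact: issub0.
have hp a b : U (a * b) -> U a \/ U b.
  move=> Uab; apply: contrapT => /not_orP [/meet [a1 [n1 [h1 [u1 [c1 [Uu1 e1]]]]]]].
  move=> /meet [a2 [n2 [h2 [u2 [c2 [Uu2 e2]]]]]].
  apply: (gU (a1 * a2) (n1 + n2)%N); first by rewrite prime_idealrM negb_or h1.
  rewrite exprD mulrACA e1 e2 mulrDl mulrDr -addrA.
  apply: (issubD sU); first by rewrite mulrC; exact: (issubZ u2 sU Uu1).
  have -> : u1 * (c2 * b) + c1 * a * (u2 + c2 * b) =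
      (c2 * b) * u1 + ((c1 * a) * u2 + (c1 * c2) * (a * b)).
    by rewrite mulrDr [u1 * _]mulrC [c1 * a * (_ * _)]mulrACA.
  apply: (issubD sU); first exact: (issubZ (c2 * b) sU Uu1).
  apply: (issubD sU); first exact: (issubZ (c1 * a) sU Uu2).
  exact: (issubZ (c1 * c2) sU Uab).
exists (mk_prime sU U1 hp); split; first by move=> a /JU Ua; exact/asboolP.
split=> [a /asboolP Ua|h].
  by apply/negPn/negP => aP; apply: (gU a 0%N) => //; rewrite mulr1.
have /asboolP Ux := h x xP; apply: (gU 1 1%N); first by rewrite idealr1.
by rewrite mul1r.
Qed.

Definition ht_ge n P := exists c : nat -> prime_idealr A,
  c n = P /\ forall i, (i < n)%N -> strict (c i) (c i.+1).

Lemma ht_ge_step n P P' : ht_ge n P' -> strict P' P -> ht_ge n.+1 P.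
Proof.
move=> [c [cn hc]] sP; exists (fun i => if (i <= n)%N then c i else P).
rewrite ltnn; split=> // i; rewrite ltnS.
by case: (ltngtP i n) => // [lt|->] _; [apply: hc|rewrite cn].
Qed.

Lemma ht_ge_dim n P t c d : ht_ge n P -> c 0%N = P ->
  (forall i, (i < t)%N -> strict (c i) (c i.+1)) -> has_dim A^o d -> (n + t <= d)%N.
Proof.
move=> [b [bn hb]] c0 hc [_ hd]; rewrite leqNgt; apply/negP => lt; apply: hd.
exists (fun i => if (i <= n)%N then b i else c (i - n)%N); split.
  move=> a /asboolP /(_ 1); rewrite [a *: 1]mulr1 => ->; rewrite /=.
  exact: idealr0.
move=> i il; have {il}[lt'] : (i < n + t)%N by apply: leq_trans lt.
have [ni|ni] := ltnP i n; first by rewrite (ltnW ni); apply: hb.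
have e : (if (i <= n)%N then b i else c (i - n)%N) = c (i - n)%N.
  case: leqP => // h; have -> : i = n by apply/eqP; rewrite eqn_leq h ni.
  by rewrite subnn c0.
rewrite e subSn //; apply: hc; by rewrite ltn_subLR.
Qed.

(** Each member of the sequence is regular modulo its predecessors, so [prime_below] provides a
    strictly smaller prime that still contains these: one unit of height per member. *)
Lemma ht_regular_seq s i P : @regular_seq A A^o s -> (i <= size s)%N ->
  (forall x : A, x \in smul (mem (take i s)) (predT : {pred A^o}) -> x \in P) -> ht_ge i P.
Proof.
move=> [hs _]; elim: i P => [|i IH] P il hP; first by exists (fun=> P).
pose J := [set x : A^o | x \in smul (mem (take i s)) (predT : {pred A^o})].
have sJ : issub J by exact: submodClosed_issub.
have sub1 (x : A) : x \in take i.+1 s -> x \in P.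
  move=> hx; apply: hP; rewrite -[x]mulr1.
  exact: (@smul_gen A A^o (mem (take i.+1 s)) predT x 1).
have [|a||P' [JP' sP]] := @prime_below J P s`_i sJ.
- move=> a; apply: (smul_least (U := [set a : A^o | a \in P])).
    exact: (idealr_issub P).
  move=> b w hb _ /=; rewrite -[b *: w]/(b * w) mulrC; apply: idealMr; apply: sub1.
  by rewrite (take_nth 0 il) mem_rcons in_cons [b \in _]hb orbT.
- by move=> h; apply: hs.
- by apply: sub1; rewrite (take_nth 0 il) mem_rcons mem_head.
by apply: ht_ge_step sP; apply: IH => //; apply: ltnW.
Qed.

Lemma grade_lt_dim V g t d : has_grade (annihilator V) A^o g -> has_dim V t ->
  has_dim A^o d -> (g + t <= d)%N.
Proof.
move=> [[s [<- hs hreg]] _] [[c [c0 hc]] _] hd.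
apply: (ht_ge_dim (P := c 0%N) (c := c)) => //.
apply: (ht_regular_seq hreg (leqnn _)); rewrite take_size.
apply: (smul_least (U := [set a : A^o | a \in c 0%N])); first exact: (idealr_issub (c 0%N)).
move=> a w ha _ /=; rewrite -[a *: w]/(a * w) mulrC; apply: idealMr.
by apply: c0; apply: hs.
Qed.
End Primes.

(** * Embedding the residue field in a module with a finite free resolution *)

Section Socle.
Variables (A : comNzRingType) (mm : idealr A).
Hypotheses (hA : noetherian A) (hloc : is_local mm).
Implicit Types (P : prime_idealr A) (V Q : lmodType A).

Lemma ideal_gens (J : idealr A) : exists q (a : 'I_q -> A),
  (forall j, a j \in J) /\ forall x, x \in J -> exists c : 'I_q -> A, x = \sum_j c j * a j.
Proof.
have [q [a ha]] := hA (GRing.SubmodClosed.clone A A^o (ideal_pred J) _).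
exists q, a; split=> [j|x hx].
  have : (a j : A^o) \in Defs.span (range a) by apply/span_spansetE; exact: spanset_gen.
  by rewrite -ha.
by have : (x : A^o) \in Defs.span (range a); [rewrite -ha|move/span_spansetE].
Qed.

(** Countably many finite lists name only countably many residue classes. *)
Lemma good_avoid (b : nat -> seq A) : ~ countable [set: {ideal_quot mm}] ->
  exists c, forall n, avoids mm (b n) c.
Proof.
move=> hk; apply: contrapT => hc; apply: hk.
pose f (x : nat * nat) := (\pi_({ideal_quot mm}) (nth 0 (b x.1) x.2))%qT.
have sub : [set: {ideal_quot mm}] `<=` f @` setT.
  move=> y _; apply: contrapT => hy; apply: hc; exists (repr y) => n z zb.
  apply/negP; rewrite Quotient.idealrBE => /eqP e; apply: hy.
  exists (n, index z (b n)) => //; rewrite /f /= nth_index // -e.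
  by rewrite reprK.
apply: sub_countable (subset_card_le sub) _.
by apply: sub_countable (card_image_le f setT) _; apply: countableP.
Qed.

Definition fres Q n := exists F : free_resolution Q, forall i, (n < i)%N -> rk F i = 0%N.

Section Base.
Definition brk (i : nat) := if i is 0 then 1%N else 0%N.
Definition baug (x : 'rV[A]_(brk 0)) : A^o := x 0 0.
Fact baug_linear : linear baug.
Proof. by move=> a x y; rewrite /baug !mxE. Qed.
HB.instance Definition _ := GRing.isLinear.Build A 'rV[A]_(brk 0) A^o *:%R baug baug_linear.
Fact baug_surj u : exists x, baug x = u.
Proof. by exists (const_mx u); rewrite /baug mxE. Qed.
Fact baug_exact x : baug x = 0 <-> exists y, x = y *m (0 : 'M_(brk 1, brk 0)).
Proof.
split=> [h|[y ->]]; last by rewrite mulmx0 /baug mxE.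
by exists 0; rewrite mulmx0; apply/rowP => i; rewrite !ord1 mxE.
Qed.
Fact bdiff_exact i (x : 'rV[A]_(brk i.+1)) :
  x *m (0 : 'M_(brk i.+1, brk i)) = 0 <-> exists y, x = y *m (0 : 'M_(brk i.+2, brk i.+1)).
Proof.
by split=> _; [exists 0; apply/rowP => -[]|apply/matrixP => j k; rewrite mulmx0].
Qed.
Definition base_res : free_resolution A^o :=
  @FreeResolution A A^o brk (fun i => 0) baug baug_surj baug_exact bdiff_exact.
End Base.

Lemma fres_base : fres A^o 0.
Proof. by exists base_res => -[|i]. Qed.

Definition zmul Q (z : A) : submodClosed Q := image_mod (GRing.scale z : {linear Q -> Q}).
Arguments zmul : clear implicits.

Lemma fres_step Q n z : (forall x : Q, z *: x = 0 -> x = 0) -> fres Q n ->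
  fres (quotmod (zmul Q z)) n.+1.
Proof.
move=> zi [F hF]; pose f : {linear Q -> Q} := GRing.scale z.
have fi : injective f.
  by move=> x y /eqP; rewrite -subr_eq0 -linearB => /eqP /zi /eqP; rewrite subr_eq0 => /eqP.
have ex x : quopi (image_mod f) x = 0 <-> exists y, f y = x.
  by split=> [/quopi_eq0/image_modP|/image_modP/quopi_eq0].
pose phi i : 'M[A]_(rk F i, rk F i) := z%:M.
have phi0 x : f (aug F x) = aug F (x *m phi 0%N) by rewrite mul_mx_scalar linearZ.
have phiS i : sq (phi i) (phi i.+1) by rewrite /sq /phi scalar_mxC.
exists (cone_res fi (@quopi_surj A Q (image_mod f)) ex phi0 phiS) => -[//|i] ni.
rewrite -[rk _ _]/(rk F i.+1 + rk F i)%N !hF //; exact: ltnW.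
Qed.

Hypothesis inf : forall bads, exists c, avoids mm bads c.

(** The Rees module of the maximal ideal on [Q] replaces prime avoidance: a generic combination [z]
    of the generators is injective in Rees degrees [>= n0], and without socle a nonzero element
    killed by [z] can be multiplied into the [n0]-th power of the ideal without becoming zero. *)
Lemma regular_or_socle Q : fin_gen Q ->
  (exists2 z, z \in mm & forall x : Q, z *: x = 0 -> x = 0) \/
  exists2 y : Q, y <> 0 & forall z, z \in mm -> z *: y = 0.
Proof.
move=> fQ; have [|hs] := pselect (exists2 y : Q, y <> 0 & forall z, z \in mm -> z *: y = 0).
  by right.
left; have [q [a [Ia Igen]]] := ideal_gens mm.
have cR : comm (rees Q Ia) := @rees_comm A Q _ q a Ia.
have nR : noeth (full (rees Q Ia)) := @rees_noeth A Q _ q a Ia Igen hA fQ.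
have [bads hb] := generic (local_unit hA hloc) (full_wf (rees Q Ia)) cR nR.
have [c /hb [n0 hn0]] := inf bads.
pose z := \sum_j moment c j * a j.
have zm : [set x : A^o | x \in mm] z.
  apply: (@issub_sum A A^o _ _ _ _ (fun j : 'I_q => moment c j * a j) (idealr_issub mm)) => j _.
  exact: idealMr.
exists z => // x zx; apply: contrapT => x0.
have [y [hy y0 zy]] : exists y : Q, [/\ y \in pow_smul Q mm n0, y <> 0 & z *: y = 0].
  elim: (n0) => [|n [y [hy y0 zy]]]; first by exists x; split=> //; exact: pow_smul0.
  have [w wm wy] : exists2 w, w \in mm & w *: y <> 0.
    apply: contrapT => h; apply: hs; exists y => // w wm.
    by apply: contrapT => wy; apply: h; exists w.
  exists (w *: y); split=> //; first exact: pow_smulS.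
  by rewrite scalerA mulrC -scalerA zy scaler0.
apply: y0; have := hn0 n0 (leqnn _) (smk hy) I; move=> /= h.
have -> : y = sinc (smk hy) by [].
rewrite h ?linear0 //; apply: sinc_inj; rewrite linear0 /lin linear_sum -[RHS]zy scaler_suml.
by apply: eq_bigr => j _; rewrite linearZ /= /rees_op smkK scalerA.
Qed.

Section Depth.
Variable d : nat.
Hypothesis dimA : has_dim A^o d.

(** The height clause is the stopping rule: it grows with each regular element divided out and
    bounds [n] by the dimension. *)
Definition depth_state Q (u : Q) n := [/\ cyclic u, u <> 0, fres Q n &
  forall P, (forall a : A, a *: u = 0 -> a \in P) -> ht_ge n P].

Lemma ann_max Q (u : Q) a : u <> 0 -> a *: u = 0 -> a \in mm.
Proof.
move=> u0 h; apply/negPn/negP => /(local_unit hA hloc) [v hv]; apply: u0.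
by rewrite -[u]scale1r -hv -scalerA h scaler0.
Qed.

Definition max_prime : prime_idealr A.
Proof.
apply: (@mk_prime A [set x : A^o | x \in mm] (idealr_issub mm)) => [|a b /= hab].
  by rewrite /= idealr1.
apply: contrapT => /not_orP [/negP /(local_unit hA hloc) [u hu] /negP /(local_unit hA hloc) [v hv]].
have : (u * v) * (a * b) \in mm by apply: idealMr.
by rewrite mulrACA hu hv mulr1 idealr1.
Defined.
Lemma max_primeP a : a \in mm -> a \in max_prime.
Proof. by move=> h; apply/asboolP. Qed.

Lemma depth_step Q (u : Q) n z : depth_state u n -> z \in mm ->
  (forall x : Q, z *: x = 0 -> x = 0) -> depth_state (quopi (zmul Q z) u) n.+1.
Proof.
move=> [cu u0 fQ hP] zm zi; split.
- exact: cyclic_quot.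
- move=> /quopi_eq0 /image_modP [y hy]; apply: u0; have [b hb] := cu y.
  have [v hv] := local_unit1 hA hloc b zm.
  rewrite -[u]scale1r -hv -scalerA scalerBl scale1r mulrC -scalerA -hb -{1}hy.
  by rewrite /= subrr scaler0.
- exact: fres_step.
- move=> P hPu.
  have hz : z \in P.
    by apply: hPu; rewrite -linearZ; apply/quopi_eq0/image_modP; exists u.
  have [a ha|a /= ha|P' [hP' sP]] := @prime_below A hA (ann u) P z (ann_sub u) _ _ hz.
  - by apply: hPu; rewrite -linearZ /= [a *: u]ha linear0.
  - by apply: zi; rewrite scalerA.
  - by apply: ht_ge_step sP; apply: hP.
Qed.

Lemma depth_embedding : exists Q n, [/\ (n <= d)%N, fin_gen Q, fres Q n &
  exists f : {linear residue_module mm -> Q}, injective f].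
Proof.
have bound Q (u : Q) n : depth_state u n -> (n <= d)%N.
  move=> [_ u0 _ hP]; rewrite -[n]addn0.
  apply: (@ht_ge_dim A n max_prime 0 (fun=> max_prime) d) => //.
  by apply: hP => a /(ann_max u0) /max_primeP.
have h0 : @depth_state A^o 1 0.
  split; [|exact/eqP/oner_neq0|exact: fres_base|].
    by move=> x; exists x; rewrite [RHS]mulr1.
  by move=> P _; exists (fun=> P).
(* [k] counts the steps left; since [n <= d] throughout, a socle element must appear before it is
   exhausted. *)
suff h k Q (u : Q) n : depth_state u n -> (d < n + k)%N -> exists Q n, [/\ (n <= d)%N, fin_gen Q, fres Q n &
  exists f : {linear residue_module mm -> Q}, injective f].
  by apply: (h d.+1 _ _ _ h0).
elim: k Q u n => [|k IH] Q u n st; first by rewrite addn0 ltnNge (bound _ _ _ st).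
move=> lt; have [cu u0 fQ _] := st.
have [[z zm zi]|[y y0 hy]] := regular_or_socle (cyclic_fg cu).
  by apply: (IH _ _ _ (depth_step st zm zi)); rewrite addSnnS.
exists Q, n; split=> //; [exact: bound st|exact: cyclic_fg cu|].
have [f [fi _]] := residue_map hy (fun c => @ann_max Q y c y0).
by exists f.
Qed.
End Depth.
End Socle.

(** * Nakayama's lemma *)

Section Nakayama.
Variables (A : comNzRingType) (mm : idealr A).
Hypotheses (hA : noetherian A) (hloc : is_local mm).

Section Graded.
Variables (m : nat) (C : gquo A m -> Prop) (T : gquo A m).
Hypotheses (hC : serre C) (w : gwf T) (c : comm T).

(** Induction along [T/z -> T/z^(j+1) -> T/z^j], the first map being multiplication by [z^j]. *)
Lemma scalquo_pow z j : C (scalquo z T) -> C (scalquo (z ^+ j) T).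
Proof.
move=> hz; have wz k := scalquo_wf (z ^+ k) w.
elim: j => [|j IH].
  apply: hC.1; [exact: wz|exact: c|] => n x Zx; exists 0, x.
  by rewrite expr0 scale1r add0r; split=> //; exact: (issub0 (bnd_sub n w)).
have w1 := scalquo_wf z w.
apply: (hC.2 _ _ _ w1 (wz j.+1) (wz j) c c c _ hz IH).
exists (@gfun A m (scalquo z T) (scalquo (z ^+ j.+1) T) (fun n => GRing.scale (z ^+ j))),
  (@gfun A m (scalquo (z ^+ j.+1) T) (scalquo (z ^+ j) T) (fun n => idfun)); split.
- apply: gfun_hom => //.
  + by move=> k n x; rewrite /= linearZ.
  + by move=> n x Zx; apply: (issubZ _ (cyc_sub n w)).
  + move=> n _ [b [e [Bb Ze ->]]]; exists (z ^+ j *: b), e; split=> //.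
      by apply: (issubZ _ (bnd_sub n w)).
    by rewrite /= scalerDr !scalerA -exprSr.
- apply: gfun_hom => // n _ [b [e [Bb Ze ->]]]; exists b, (z *: e); split=> //.
    by apply: (issubZ _ (cyc_sub n w)).
  by rewrite /= scalerA -exprSr.
move=> n x _ [Zx ->] [b [e [Bb Ze hx]]]; exists e, (z ^+ j *: e); split=> //.
have -> : x = b + z ^+ j *: e by [].
rewrite addrK; apply: (scalquo_bnd (z ^+ j.+1) w Bb).
Qed.

(** Finite length makes [z] nilpotent on every element, noetherianity makes the exponent [e]
    uniform, and [T] then embeds in [T / z^e T]. *)
Lemma nak_finlen z : noeth T -> finlen T -> z \in mm -> C (scalquo z T) -> C T.
Proof.
move=> hn fl zm hz.
pose K e n := [set x | cyc T n x /\ bnd T n (z ^+ e *: x)].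
have [e|e n x [Zx Bx]|e he] := hn K.
- split=> [n|j n x [Zx Bx]].
    have [sZ sB BZ] := gwf_m n w; split=> [|x Bx|x []//].
    + split; first by rewrite /K /= scaler0; split; exact: issub0.
      move=> a u v [Zu Bu] [Zv Bv]; split; first by case: sZ => _; apply.
      by rewrite scalerDr scalerA mulrC -scalerA; case: sB => _; apply.
    + by split; [exact: BZ|exact: issubZ].
  have [_ w2 w3] := w; split; first exact: w2.
  by rewrite -linearZ; apply: w3.
- by split=> //; rewrite exprS -scalerA; apply: issubZ => //; apply: bnd_sub.
have kill n x : cyc T n x -> bnd T n (z ^+ e *: x).
  move=> Zx; have [l hl] := fl n.
  have [e' he'] := lenle_nilp (gwf_m n w) hl (fun a => local_unit1 hA hloc a zm) Zx.
  have : K (maxn e e') n x.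
    split=> //; rewrite -(subnK (leq_maxr e e')) exprD -scalerA.
    by apply: issubZ => //; apply: bnd_sub.
  by move/(he _ n (leq_maxl e e')) => [].
apply: (serre_inj hC w c (scalquo_wf (z ^+ e) w) c
   (R := @gfun A m T (scalquo (z ^+ e) T) (fun n => idfun)) _ _ (scalquo_pow e hz)).
  by apply: gfun_hom => // n x; exact: scalquo_bnd.
move=> n x _ [Zx ->] [b [x' [Bb Zx' e1]]]; have -> : x = b + z ^+ e *: x' by [].
by apply: issubD => //; [exact: bnd_sub|exact: kill].
Qed.
End Graded.

(** For a maximal proper [U] above [B] and [x] outside it, [Z = U + A x]; substituting [c = u + a x]
    in [x = b + z c] puts [(1 - a z) x] in [U]. *)
Lemma nakayama (V : lmodType A) (Z B : set V) z : issub Z -> @acc A V Z [set 0] ->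
  issub B -> B `<=` Z -> z \in mm ->
  (forall x, Z x -> exists b c, [/\ B b, Z c & x = b + z *: c]) -> Z `<=` B.
Proof.
move=> sZ hn sB BZ zm h; apply: contrapT => hZB.
have [U [sU UZ [BU hU] mU]] := @acc_max A V Z (fun U => B `<=` U /\ ~ Z `<=` U) B
  sZ hn sB BZ (conj (@subset_refl _ B) hZB).
apply: hU => x Zx; apply: contrapT => Ux.
pose U' := [set y | exists u a, U u /\ y = u + a *: x].
have ZU' : Z `<=` U'.
  apply: contrapT => hc; apply: Ux; apply: (mU U') => //.
  - split; first by exists 0, 0; rewrite scale0r addr0; split=> //; exact: issub0.
    move=> a _ _ [u [k [Uu ->]]] [v [l [Uv ->]]]; exists (a *: u + v), (a * k + l).
    split; first by case: sU => _; apply.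
    by rewrite scalerDr addrACA scalerDl scalerA.
  - by move=> _ [u [a [Uu ->]]]; apply: issubD => //; [exact: UZ|exact: issubZ].
  - by move=> u Uu; exists u, 0; rewrite scale0r addr0.
  - by split=> // u Bu; exists u, 0; rewrite scale0r addr0; split=> //; exact: BU.
  - by exists 0, 1; rewrite scale1r add0r; split=> //; exact: issub0.
have [b [c [Bb Zc e]]] := h x Zx; have [u [a [Uu ec]]] := ZU' c Zc.
have [v hv] := local_unit1 hA hloc a zm; apply: Ux.
rewrite -[x]scale1r -hv -scalerA; apply: issubZ => //.
have -> : (1 - a * z) *: x = b + z *: u.
  rewrite scalerBl scale1r [X in X - _]e ec scalerDr scalerA [z * a]mulrC addrA addrK //.
by apply: issubD => //; [exact: BU|exact: issubZ].
Qed.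

End Nakayama.

(** * Iterated cones *)

Section Classes.
Variables (A : comNzRingType) (m : nat).
Implicit Types (T : gquo A m) (W : gsys A m) (C : gquo A m -> Prop).

(** The two further closures concern the ends of [exact_second], so that membership passes from a
    system to its cones. *)
Definition sclass C := [/\ serre C,
  forall T l, gwf T -> comm T -> C T -> C (gshift (formquo T l))
  & forall T l, gwf T -> comm T -> C T -> C (formker T l)].

Lemma finlen_serre : serre (@finlen A m).
Proof.
split=> [T w _ h n|T1 T2 T3 w1 w2 w3 _ _ _ [R [S [hR hS ex]]] h1 h3 n].
  by exists 0%N; apply: lenle0.
have [a ha] := h1 n; have [b hb] := h3 n; exists (a + b)%N.
exact: (lenle_exact (gwf_m n w1) (gwf_m n w2) (gwf_m n w3) (mexact_slice n hR hS ex) ha hb).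
Qed.

Lemma finlen_sclass : sclass (@finlen A m).
Proof.
split=> [|T l w c h n|T l w c h]; first exact: finlen_serre.
  have [k hk] := h n.+1; exists k; apply: lenle_sub hk => //.
  exact: (@formquo_bnd _ _ T l n.+1 w).
exact: (finlen_subfam (formker_sub l w c) h).1.
Qed.

Lemma noeth_serre : serre (@noeth A m).
Proof.
split=> [T w _ h|T1 T2 T3 w1 w2 w3 _ _ _ ex h1 h3]; first exact: noeth_triv.
exact: noeth_exact ex h1 h3.
Qed.

Lemma noeth_sclass : sclass (@noeth A m).
Proof.
split=> [|T l w c h|T l w c h]; first exact: noeth_serre.
  by apply: gshift_noeth; [exact: formquo_wf|exact: formquo_noeth].
exact: (noeth_sub (formker_sub l w c) h).
Qed.

Lemma kl_gshift T l e n (x : T n.+1) : @kl A m T l e n.+1 x -> @kl A m (gshift T) l e n x.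
Proof. by elim: e n x => [|e IH] n x //=; apply: IH. Qed.

Lemma locnil_sclass l : sclass (@locnil A m l).
Proof.
split=> [|T l' w c h n x Zx|T l' w c h n x [Zx _]]; first exact: locnil_serre.
  have [e he] := h n.+1 x Zx; exists e; apply: kl_gshift.
  by apply: (@kl_mono _ _ T (cyc T) (bnd (formquo T l'))) he => k; apply: formquo_bnd.
have [e he] := h n x Zx; exists e.
exact: (@kl_restr _ _ T (cyc (formker T l'))).
Qed.

Lemma locnil_coker T l : gwf T -> locnil l (gshift (formquo T l)).
Proof.
move=> w n x Zx; exists 1%N; exists 0, x; rewrite add0r; split=> //.
exact: (issub0 (bnd_sub n.+2 w)).
Qed.

Lemma locnil_formker T l : locnil l (formker T l).
Proof. by move=> n x [_ Bx]; exists 1%N. Qed.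

Section Reop.
Variables (p : nat) (Y : 'I_p -> 'I_m -> A).
(** The same pieces over a polynomial ring in [p] variables that act through the forms [Y j]. *)
Definition reop_sys W : gsys A p := @GSys A p W (fun j n => @lin A m W (Y j) n).
Definition reop T : gquo A p := @GQuo A p (reop_sys T) (cyc T) (bnd T).

Lemma reop_comm W : comm W -> comm (reop_sys W).
Proof. by move=> c i j n x; exact: (lin_lin (Y i) (Y j) x c). Qed.

Lemma reop_wf T : gwf T -> gwf (reop T).
Proof.
move=> w; have [w1 _ _] := w.
by split=> // j n x h; [exact: (lin_cyc (Y j) w h)|exact: (lin_bnd (Y j) w h)].
Qed.

Definition ynoeth T := noeth (reop T).

Lemma ynoeth_serre : serre ynoeth.
Proof.
split=> [T w _ h|T1 T2 T3 w1 w2 w3 _ _ _ [R [S [hR hS ex]]] h1 h3]; first exact: noeth_triv.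
apply: (noeth_exact (reop_wf w1) (reop_wf w2) (reop_wf w3) _ h1 h3).
exists R, S; split=> //; split; [exact: hR.1| |exact: hS.1|].
  by move=> j n x x' h; exact: (lin_hom (Y j) hR h).
by move=> j n x x' h; exact: (lin_hom (Y j) hS h).
Qed.

Lemma ynoeth_sclass : sclass ynoeth.
Proof.
split=> [|T l w c h|T l w c h]; first exact: ynoeth_serre.
  apply: (@gshift_noeth _ _ (reop (formquo T l))); first exact/reop_wf/formquo_wf.
  apply: (@noeth_restr _ _ (reop T) (cyc T) (bnd (formquo T l))) h => n.
    exact: subset_refl.
  exact: (@formquo_bnd _ _ T l n w).
apply: (@noeth_restr _ _ (reop T) (cyc (formker T l)) (bnd T)) h => n; last exact: subset_refl.
by move=> x [].
Qed.

Lemma locnil_reop T j : locnil (Y j) T -> locnil (@opform A p j) (reop T).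
Proof.
move=> h n x /h [e he]; exists e.
elim: e n x he => [|e IH] n x //= /IH.
by rewrite -[lin (Y j) x]/(gop (reop T) j n x) -lin_opform.
Qed.

Lemma evzero_reop T : gwf T -> comm T -> ynoeth T -> (forall j, locnil (Y j) T) -> evzero T.
Proof.
move=> w c hn h; apply: (@evzero_nil A p (reop T)) => //; first exact: reop_wf.
  exact: reop_comm.
by move=> j; apply/locnil_reop/h.
Qed.
End Reop.

(* [quobnd Z B ys] is the boundary family of [Z / (B + \sum_i ys_i Z)]. *)
Fixpoint quobnd W (Z B : forall n, set (W n)) (ys : seq ('I_m -> A)) : forall n, set (W n) :=
  if ys is y :: ys' then @quobnd W Z (bnd (formquo (restr Z B) y)) ys' else B.
Definition quosys T ys : gquo A m := restr (cyc T) (@quobnd T (cyc T) (bnd T) ys).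

Lemma quobnd_gen W (Z B : forall n, set (W n)) ys p (Y : 'I_p -> 'I_m -> A) n x :
  (forall n, issub (Z n)) -> (forall y, List.In y ys -> exists j, Y j = y) ->
  @quobnd W Z B ys n.+1 x -> exists b (z : 'I_p -> W n),
  [/\ B n.+1 b, forall j, Z n (z j) & x = b + \sum_j lin (Y j) (z j)].
Proof.
move=> sZ; elim: ys B => [|y ys IH] B hY /=.
  move=> Bx; exists x, (fun=> 0); split=> // [j|]; first exact: (issub0 (sZ n)).
  by rewrite big1 ?addr0 // => j _; rewrite linear0.
move=> /IH [y' hy'|b' [z [[b [z0 [Bb Zz0 ->]]] Zz ->]]]; first by apply: hY; right.
have [|j0 e0] := hY y; first by left.
exists b, (fun j => z j + (j == j0)%:R *: z0); split=> // [j|].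
  by apply: issubD => //; apply: issubZ.
rewrite -addrA; congr (_ + _); under [RHS]eq_bigr => j _ do rewrite linearD linearZ /=.
rewrite big_split addrC /=; congr (_ + _).
rewrite (bigD1 j0) //= eqxx scale1r e0 big1 ?addr0 // => j /negPf ->.
by rewrite scale0r.
Qed.

(** If the quotient by the forms vanishes in large degrees, the module is generated over them by its
    low degrees, and [noeth_gen] applies. *)
Lemma quosys_ynoeth T ys p (Y : 'I_p -> 'I_m -> A) : gwf T -> comm T ->
  (forall n, @acc A (T n) (cyc T n) (bnd T n)) ->
  (forall y, List.In y ys -> exists j, Y j = y) -> evzero (quosys T ys) -> ynoeth Y T.
Proof.
move=> w c hnm hY [n0 hn0].
apply: (@noeth_gen A p (reop Y T) n0); [exact: reop_wf|exact: reop_comm|by move=> n _; exact: hnm|].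
move=> n x nn Zx.
have [b [z [Bb Zz e]]] := quobnd_gen (fun n => cyc_sub n w) hY (hn0 n.+1 (leqW nn) x Zx).
exists z; split=> //=; have -> : x = b + \sum_j lin (Y j) (z j) by [].
by rewrite addrK.
Qed.
End Classes.

(** * Towers of cones along generic forms *)

Section Tower.
Variables (A : comNzRingType) (mm : idealr A).
Hypotheses (hA : noetherian A) (hloc : is_local mm).
Variable m : nat.
Implicit Types (W V : gsys A m) (T : gquo A m) (C : gquo A m -> Prop).
Implicit Types (L : lmodType A) (y : 'I_m -> A).

Definition fgsys W := comm W /\ forall n, fin_gen (W n).

(** A relation rather than a function, since the flat cover used by the cone is not canonical. *)
Definition cstep y W V := exists (G : gsys A m) (pi : forall n, {linear G n -> W n.+1})
  (cW : comm W) (pic : @gcompat A m G (gshift_sys W) pi),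
  [/\ comm G, forall n x, exists z, pi n z = x, forall n, flat (G n),
      forall n, fin_gen (G n) & V = csys y cW pic].

Lemma cstep_exists y W : fgsys W -> exists V, cstep y W V.
Proof.
move=> [cW fW].
have [G [pi [cG pic pis Gf Gfg]]] := cover_exists hA (gshift_comm cW) (fun n => fW n.+1).
by exists (csys y cW pic), G, pi, cW, pic.
Qed.

Lemma cstep_ok y W V : cstep y W V -> fgsys W -> fgsys V.
Proof.
move=> [G [pi [cW [pic [cG pis Gf Gfg ->]]]]] [_ fW]; split; first exact: csys_comm.
exact: csys_fg.
Qed.

Lemma cstep_serre y W V C L (F : free_resolution L) i : serre C -> cstep y W V ->
  C (coker_l W y F i) -> C (ker_l W y F i) -> C (torsys F i V).
Proof.
move=> hC [G [pi [cW [pic [cG pis Gf Gfg ->]]]]] h1 h2.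
have c1 : comm (coker_l W y F i) by exact/gshift_comm/torsys_comm.
have c2 : comm (ker_l W y F i) by exact: torsys_comm.
apply: (hC.2 _ _ _ _ _ _ _ _ _ (exact_second y cW pic pis Gf F i) h1 h2) => //.
- exact: coker_wf.
- exact: torsys_wf.
- exact: ker_wf.
- exact/torsys_comm/csys_comm.
Qed.

Lemma cstep_nil y W V L (F : free_resolution L) i : cstep y W V -> locnil y (torsys F i V).
Proof.
move=> h; apply: (cstep_serre (locnil_serre y) h).
  exact/locnil_coker/torsys_wf.
exact: locnil_formker.
Qed.

(** The cokernel of [y] in index [i + 1] embeds in the Tor of the cone in index [i]: undoing a cone
    costs one index and one order of growth. *)
Lemma cstep_descend y W V L (F : free_resolution L) i e : cstep y W V ->
  finlen (torsys F i.+1 W) -> growth_le e (torsys F i V) -> growth_le e.+1 (torsys F i.+1 W).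
Proof.
move=> [G [pi [cW [pic [cG pis Gf Gfg ->]]]]] fl hB.
have c1 : comm (coker_l W y F i) by exact/gshift_comm/torsys_comm.
have w1 := coker_wf y cW F i.
apply: (@growth_le_descend A m (torsys F i.+1 W) y) => //; [exact: torsys_wf|exact: torsys_comm|].
apply: ((growth_le_serre A m e).2 _ _ _ _ _ _ _ _ _ (exact_coker y cW pic pis Gf F i) _ hB) => //.
- exact: nullsys_wf.
- exact: torsys_wf.
- exact/torsys_comm/csys_comm.
- by apply: (growth_le_serre A m e).1; [exact: nullsys_wf|exact: c1|move=> k x].
Qed.

Lemma cstep_slice y W V L (F : free_resolution L) i n : cstep y W V ->
  cyc (torsys F i V) n `<=` bnd (torsys F i V) n ->
  (forall w, cyc (torsys F i W) n w -> bnd (torsys F i W) n.+1 (lin y w) -> bnd (torsys F i W) n w) /\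
  cyc (coker_l W y F i) n `<=` bnd (coker_l W y F i) n.
Proof.
move=> [G [pi [cW [pic [cG pis Gf Gfg ->]]]]] h; split.
  by move=> w; apply: (slice_ker pis h).
exact: (slice_coker pis Gf h).
Qed.

Section Tall.
Variable i0 : nat.
Definition tor_in C W := forall L (F : free_resolution L) i, fin_gen L -> (i0 <= i)%N -> C (torsys F i W).

Lemma cstep_tor_in y W V C : sclass C -> cstep y W V -> fgsys W -> tor_in C W -> tor_in C V.
Proof.
move=> [hC h1 h2] st [cW _] hT L F i fL ii; apply: (cstep_serre hC st).
  by apply: h1; [exact: torsys_wf|exact: torsys_comm|apply: hT => //; apply: leqW].
by apply: h2; [exact: torsys_wf|exact: torsys_comm|apply: hT].
Qed.

Fixpoint tower (ys : seq ('I_m -> A)) W V : Prop :=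
  if ys is y :: ys' then exists2 W', cstep y W W' & tower ys' W' V else V = W.

Lemma tower_ok ys W V : tower ys W V -> fgsys W -> fgsys V.
Proof.
elim: ys W => [|y ys IH] W /=; first by move=> ->.
by move=> [W' st /IH h] /(cstep_ok st).
Qed.

Lemma tower_tor_in ys W V C : sclass C -> tower ys W V -> fgsys W -> tor_in C W -> tor_in C V.
Proof.
move=> hC; elim: ys W => [|y ys IH] W /=; first by move=> ->.
by move=> [W' st /IH h] ok /(cstep_tor_in hC st ok); apply: h; exact: cstep_ok st ok.
Qed.

(** A form is locally nilpotent on the Tor of the cone it defines, and later cones keep this because
    [locnil] is an [sclass]. *)
Lemma tower_nil ys W V y : tower ys W V -> fgsys W -> List.In y ys -> tor_in (@locnil A m y) V.
Proof.
elim: ys W => [|z ys IH] W //= [W' st tw] ok [<-|]; last exact/IH/(cstep_ok st).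
apply: (tower_tor_in (locnil_sclass z) tw (cstep_ok st ok)) => L F i _ _.
exact: cstep_nil st.
Qed.

Lemma tower_descend ys W V L (F : free_resolution L) i e : tower ys W V -> fgsys W ->
  fin_gen L -> (i0 <= i)%N -> tor_in (@finlen A m) W ->
  (forall j, (i <= j)%N -> growth_le e (torsys F j V)) ->
  forall j, (i + size ys <= j)%N -> growth_le (e + size ys) (torsys F j W).
Proof.
move=> + + fL ii; elim: ys W => [|y ys IH] W /=; first by move=> -> _ _ h j; rewrite !addn0; exact: h.
move=> [W' st tw] ok fl h [|j]; first by rewrite addnS.
rewrite !addnS ltnS => hj; apply: (cstep_descend st).
  by apply: fl => //; rewrite (leq_trans ii) // (leq_trans (leq_addr (size ys) i)) // leqW.
exact: (IH _ tw (cstep_ok st ok) (cstep_tor_in (finlen_sclass A m) st ok fl) h).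
Qed.

Hypothesis k_unc : ~ countable [set: {ideal_quot mm}].
Variables (M : lmodType A) (FM : free_resolution M).
Hypothesis M_fg : fin_gen M.

(** [T] stands for [T_{d-1}(k)] and is only divided by the forms, while the modules of [M] follow
    the cones; [T] may grow by one order more, whence one form [x] beyond the tower. *)
Lemma tower_exists i1 s W T : (i0 <= i1)%N -> fgsys W -> tor_in (@noeth A m) W ->
  tor_in (@finlen A m) W -> (forall i, (i1 <= i)%N -> growth_le s (torsys FM i W)) ->
  gwf T -> comm T -> noeth T -> finlen T -> growth_le s.+1 T ->
  exists ys V x, [/\ size ys = s, tower ys W V,
    forall i, (i1 <= i)%N -> evzero (torsys FM i V) & evzero (quosys T (rcons ys x))].
Proof.
move=> i01; elim: s W T => [|s IH] W T ok hn fl hM w c nT fT hT.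
  have [bads hb] := generic (local_unit hA hloc) w c nT.
  have [x /(_ 0%N) hx] := good_avoid (fun=> bads) k_unc.
  exists [::], W, (moment x); split=> //.
    by move=> i /hM; apply: Ble0_evzero; exact: torsys_wf.
  have := hilb_formquo w c nT fT (hb x hx) hT => /growth_le_gshift.
  by apply: Ble0_evzero; exact: formquo_wf.
have [bT hbT] := generic (local_unit hA hloc) w c nT.
have [cW _] := ok.
have gM i : exists bads, forall c, avoids mm bads c -> filter_regular (moment c) (torsys FM (i1 + i) W).
  apply: (generic (local_unit hA hloc)); [exact: torsys_wf|exact: torsys_comm|].
  by apply: hn => //; rewrite (leq_trans i01) // leq_addr.
have /choice [bM hbM] := gM.
(* One scalar serves [T], at position 0, and every index [i1 + n'] of [M], at position [n' + 1]. *)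
have [x hx] := good_avoid (fun n => if n is n'.+1 then bM n' else bT) k_unc.
pose y : 'I_m -> A := moment x.
have hy i : (i1 <= i)%N -> filter_regular y (torsys FM i W).
  by move=> /subnKC <-; apply: hbM; apply: (hx (i - i1).+1).
have [W' st] := cstep_exists y ok.
have [ys [V [z [sz tw hV hz]]]] : exists ys V z, [/\ size ys = s, tower ys W' V,
    forall i, (i1 <= i)%N -> evzero (torsys FM i V) & evzero (quosys (formquo T y) (rcons ys z))].
  apply: IH.
  - exact: cstep_ok st ok.
  - exact: (cstep_tor_in (noeth_sclass A m) st ok).
  - exact: (cstep_tor_in (finlen_sclass A m) st ok).
  - move=> i ii; have ii0 := leq_trans i01 ii.
    apply: (cstep_serre (growth_le_serre A m s) st).
      apply: hilb_formquo; [exact: torsys_wf|exact: torsys_comm|exact/hn/leqW|exact/fl/leqW|exact/hy/leqW|].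
      exact/hM/leqW.
    have [n0 hn0] := hy i ii; apply: evzero_growth_le; exists n0 => n nn u [Zu Bu].
    exact: hn0.
  - exact: formquo_wf.
  - exact: c.
  - exact: formquo_noeth.
  - apply: (@finlen_restr _ _ T (cyc T) (bnd (formquo T y))) fT => n; first exact: subset_refl.
    exact: (@formquo_bnd _ _ T y n w).
  - exact/growth_le_gshift/(hilb_formquo w c nT fT (hbT x (hx 0%N))).
exists (y :: ys), V, z; split=> //=; first by rewrite sz.
by exists W'.
Qed.
End Tall.
End Tower.

(** * The upper bound for test modules *)

Section Bound.
Variables (A : comNzRingType) (mm : idealr A).
Hypotheses (hA : noetherian A) (hloc : is_local mm).
Hypothesis k_unc : ~ countable [set: {ideal_quot mm}].

(** Keeping [n1] fixed is the point: the class records a bound on degrees common to all its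
    members. *)
Lemma zero_serre m n1 : serre (fun T : gquo A m => forall n, (n1 <= n)%N -> cyc T n `<=` bnd T n).
Proof.
split=> [T w _ h n _|T1 T2 T3 w1 w2 w3 _ _ _ [R [S [hR hS ex]]] h1 h3 n nn x Zx]; first exact: h.
have [x' Sx] := mhomT (hS.1 n) Zx.
have [y [z [Ry Bz]]] := ex _ _ _ Sx (h3 n nn _ (mhomI (hS.1 n) Sx).2).
apply: (issubBr (bnd_sub n w2) Bz); apply: (mhomB (hR.1 n) Ry).
exact/(h1 n nn)/(mhomI (hR.1 n) Ry).1.
Qed.

Lemma torsys_acc m (W : gsys A m) L (F : free_resolution L) i n : fin_gen (W n) ->
  @acc A (torsys F i W n) (cyc (torsys F i W) n) [set 0].
Proof.
move=> fW; have := acc_pow (p := rk F i.+1) (fg_acc hA fW).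
by apply: acc_subset; [exact: subsetT|exact: subset_refl].
Qed.

Lemma zero_nak m (W : gsys A m) n1 L (F : free_resolution L) i z : fgsys W -> z \in mm ->
  (forall n, (n1 <= n)%N -> cyc (scalquo z (torsys F i W)) n `<=` bnd (scalquo z (torsys F i W)) n) ->
  forall n, (n1 <= n)%N -> cyc (torsys F i W) n `<=` bnd (torsys F i W) n.
Proof.
move=> [cW fW] zm h n nn; have w := torsys_wf F i W.
apply: (nakayama hA hloc (cyc_sub n w) _ (bnd_sub n w) (@bnd_cyc _ _ _ n w) zm).
  exact/torsys_acc/fW.
by move=> x Zx; have [b [c [Bb Zc e]]] := h n nn x Zx; exists b, c.
Qed.

Lemma tor_zero m (W : gsys A m) L (F : free_resolution L) i n :
  cyc (torsys F i W) n `<=` bnd (torsys F i W) n -> forall x : tor F (W n) i.+1, x = 0.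
Proof.
move=> h x; have [z <-] := quopi_surj x; apply/quopi_eq0.
have [w hw] := h (sinc z) (proj1 (kernelP _ _) (sincP z)).
by apply/image_modP; exists w.
Qed.

Lemma zero_hom m (W : gsys A m) L (F : free_resolution L) i n : hexact (W n) F i ->
  cyc (torsys F i W) n `<=` bnd (torsys F i W) n.
Proof. by move=> h v; apply: h. Qed.

Lemma In_nth T (x0 : T) l x : List.In x l -> exists j : 'I_(size l), nth x0 l j = x.
Proof.
elim: l => [|y l IH] //= [->|/IH [j hj]]; first by exists ord0.
by exists (lift ord0 j).
Qed.
Lemma nth_In T (x0 : T) l j : (j < size l)%N -> List.In (nth x0 l j) l.
Proof. by elim: l j => [|y l IH] [|j] //= h; [left|right; exact: IH]. Qed.
Lemma In_rcons T (x y : T) l : List.In x (rcons l y) -> List.In x l \/ x = y.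
Proof.
elim: l => [|z l IH] /=; first by case=> // ->; right.
by case=> [->|/IH [h|->]]; [left; left|left; right|right].
Qed.

Variables (m : nat) (W : gsys A m) (i0 : nat).
Hypotheses (okWW : fgsys W) (W_noeth : tor_in i0 (@noeth A m) W) (W_finlen : tor_in i0 (@finlen A m) W).
Variables (M : lmodType A) (FM : free_resolution M).
Hypotheses (M_fg : fin_gen M) (M_test : test_module M).
Variable Fk : free_resolution (residue_module mm).
Hypothesis Q_embed : exists (Q : lmodType A) (FQ : free_resolution Q) (f : {linear residue_module mm -> Q}),
  [/\ injective f, fin_gen Q & forall j, (i0 <= j)%N -> forall n, cyc (torsys FQ j W) n `<=` bnd (torsys FQ j W) n].

Lemma residue_fg : fin_gen (residue_module mm).
Proof. exact: (@fg_surj A _ _ (aug Fk) (@aug_surj _ _ Fk) (@fg_row A _)). Qed.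

(** Finite length supplies the Nakayama hypothesis of [fg_class_le], so every Serre class is tested
    on [k] alone. *)
Lemma tor_in_class C i : serre C -> (i0 <= i)%N -> C (torsys Fk i W) -> tor_in i C W.
Proof.
move=> hC ii hk L F j fL ij; have [cW _] := okWW.
apply: (fg_class_le hA hloc cW hC _ hk F fL ij) => L' F' z fL' zm hz.
have cH : comm (torsys F' i W) by exact: torsys_comm.
refine (@nak_finlen A mm hA hloc m C (torsys F' i W) hC (torsys_wf F' i W) cH z (@W_noeth _ F' i fL' ii) (@W_finlen _ F' i fL' ii) zm hz).
Qed.

Lemma tor_in_down C : serre C -> forall k, tor_in (i0 + k) C W -> tor_in i0 C W.
Proof.
move=> hC; have [Q [FQ [f [fi fQ hQ]]]] := Q_embed; have [cW _] := okWW.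
elim=> [|k IH]; first by rewrite addn0.
move=> h; apply: IH; apply: (tor_in_class hC (leq_addr k i0)).
apply: (class_pred cW hC Fk fi fQ).
  apply: hC.1; [exact: torsys_wf|exact: torsys_comm|].
  by move=> n; apply: hQ; apply: leq_addr.
by move=> L F fL; apply: h => //; rewrite addnS.
Qed.

Lemma test_bound s i1 : (i0 <= i1)%N -> (forall i, (i1 <= i)%N -> growth_le s (torsys FM i W)) ->
  growth_le s.+1 (torsys Fk i0 W) -> growth_le s (torsys Fk i0 W).
Proof.
move=> i01 hM hk; have [cW fW] := okWW; have kfg := residue_fg.
have wT := torsys_wf Fk i0 W; have cT : comm (torsys Fk i0 W) by exact: torsys_comm.
have nT := @W_noeth _ Fk i0 kfg (leqnn i0); have fT := @W_finlen _ Fk i0 kfg (leqnn i0).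
have [ys [V [x [sz tw hV hz]]]] :=
  tower_exists hA hloc k_unc M_fg i01 okWW W_noeth W_finlen hM wT cT nT fT hk.
have okV := tower_ok hA tw okWW; have [V' st] := cstep_exists hA x okV.
have okV' := cstep_ok hA st okV.
pose Y (j : 'I_(size (rcons ys x))) := nth x (rcons ys x) j.
(* Over [Y] the module [T_{i0}(k)] is noetherian because its quotient by these forms vanishes in
   large degrees; [k] passes this to all modules, and cones preserve it. *)
have hY : forall L (F : free_resolution L) i, fin_gen L -> (i0 <= i)%N -> ynoeth Y (torsys F i V').
  apply: (cstep_tor_in (ynoeth_sclass Y) st okV); apply: (tower_tor_in hA (ynoeth_sclass Y) tw okWW).
  apply: (tor_in_class (ynoeth_serre Y) (leqnn i0)).
  apply: (quosys_ynoeth wT cT _ (In_nth x (l := rcons ys x)) hz) => n.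
  have := torsys_acc (F := Fk) (i := i0) (fW n); apply: acc_subset; first exact: subset_refl.
  by move=> u ->; exact: (issub0 (bnd_sub n wT)).
have hnil j : locnil (Y j) (torsys Fk i0 V').
  have [h|e] := In_rcons (nth_In x (ltn_ord j)).
    have hn := tower_nil hA (i0 := i0) tw okWW (h : List.In (Y j) ys).
    have hn' : tor_in i0 (@locnil A m (Y j)) V' by apply: (cstep_tor_in (locnil_sclass (Y j)) st okV hn).
    exact: (hn' _ Fk i0 kfg (leqnn i0)).
  by have -> : Y j = x by []; exact: cstep_nil st.
have [n1 hn1] : evzero (torsys Fk i0 V').
  by apply: (evzero_reop _ _ (hY _ Fk i0 kfg (leqnn i0)) hnil); [exact: torsys_wf|exact/torsys_comm/okV'.1].
have zV' L (F : free_resolution L) i : fin_gen L -> (i0 <= i)%N -> forall n, (n1 <= n)%N ->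
    cyc (torsys F i V') n `<=` bnd (torsys F i V') n.
  move=> fL ii; refine (@fg_class_le A mm hA hloc m V' okV'.1 _ (@zero_serre m n1) i0 _ Fk hn1 L F i fL ii).
  by move=> L' F' z _ zm; exact: zero_nak.
have zM n i : (n1 <= n)%N -> (i1 <= i)%N -> cyc (torsys FM i V) n `<=` bnd (torsys FM i V) n.
  move=> nn ii; have [n0 hn0] := hV i ii.
  (* Descent on the degree: [x] is injective from [n1] on, so vanishing beyond [n0], which depends
     on [i], comes down to [n1]. *)
  have h e : forall n, (n1 <= n)%N -> (n0 <= n + e)%N -> cyc (torsys FM i V) n `<=` bnd (torsys FM i V) n.
    elim: e => [|e IH] k k1 k0 u Zu; first by apply: hn0 Zu; rewrite addn0 in k0.
    have [inj _] := cstep_slice st (zV' _ FM i M_fg (leq_trans i01 ii) k k1).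
    apply: inj => //; apply: (IH k.+1 (leqW k1)); first by rewrite addSnnS.
    by apply: lin_cyc => //; exact: torsys_wf.
  by apply: (h n0) => //; apply: leq_addl.
have [P hP] : finite_pd (V n1).
  apply: M_test; first exact: okV.2.
  exists FM, i1.+1 => -[//|i] ii; apply: tor_zero; exact: zM.
pose i2 := maxn i0 P.
have zk i : (i2 < i)%N -> evzero (torsys Fk i V).
  (* Finite projective dimension kills degree [n1], and surjectivity of [x] carries the vanishing up
     from there; surjectivity holds one index above the vanishing for [V'], hence the successor. *)
  case: i => // i; rewrite ltnS geq_max => /andP[ii pi]; exists n1 => n /subnKC <-.
  elim: (n - n1)%N => [|k IH]; first by rewrite addn0; apply: zero_hom; apply: (pd_hexact hP); apply: leqW.
  rewrite addnS => u Zu.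
  have [_ h] := cstep_slice st (zV' _ Fk i kfg ii (n1 + k)%N (leq_addr k n1)).
  have [b [z [Bb Zz ->]]] := h u Zu.
  apply: issubD => //; first exact: (bnd_sub _ (torsys_wf Fk i.+1 V)).
  by apply: lin_bnd; [exact: torsys_wf|apply: IH].
have i02 : (i0 <= i2)%N := leq_maxl i0 P.
(* Undoing the [s] cones moves the index up by [s]; [tor_in_down] brings the bound back to [i0]. *)
have hB := tower_descend hA tw okWW kfg (leqW i02) W_finlen (fun j h => evzero_growth_le 0 (zk j h)).
rewrite add0n sz in hB.
have h3 : growth_le s (torsys Fk (i2.+1 + s)%N W) by apply: hB.
have le3 : (i0 <= i2.+1 + s)%N by rewrite (leq_trans i02) // addSnnS leq_addr.
have := tor_in_class (growth_le_serre A m s) le3 h3; rewrite -(subnKC le3) => /(tor_in_down (growth_le_serre A m s)).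
by apply.
Qed.
End Bound.

(** * Comparison with the Tor of the quotients *)

Section Comparison.
Variable A : comNzRingType.
Implicit Types (V L : lmodType A).

Definition torZ V L (F : free_resolution L) i :=
  [set v : {ffun 'I_(rk F i.+1) -> V} | tensor_mx (diff F i) v = 0].
Definition torB V L (F : free_resolution L) i :=
  [set v : {ffun 'I_(rk F i.+1) -> V} | exists w, v = tensor_mx (diff F i.+1) w].
Arguments torZ : clear implicits.
Arguments torB : clear implicits.

Lemma tor_len V L (F : free_resolution L) i l :
  has_length (tor F V i.+1) l <-> len (torZ V L F i) (torB V L F i) l.
Proof.
rewrite has_length_len.
have wT : @mwf A (tor F V i.+1) setT [set 0] by exact: mwf_full.
pose Zi := tor_cycles F V i.+1.
pose R (x : tor F V i.+1) v := exists z : submod Zi, x = quopi _ z /\ v = sinc z.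
refine (@len_iso A _ _ setT [set 0] (torZ V L F i) (torB V L F i) R l wT (torsys_mwf V F i) _ _ _).
- split=> [|a x y x' y' [z [-> ->]] [z' [-> ->]]|x v [z [-> ->]]|x _|x v [z [-> ->]] /quopi_eq0].
  + by exists 0; rewrite !linear0.
  + by exists (a *: z + z'); rewrite !linearP.
  + by split=> //; exact: (proj1 (kernelP _ _) (sincP z)).
  + by have [z <-] := quopi_surj x; exists (sinc z), z.
  + by move=> /image_modP [w hw]; exists w.
- by move=> x v [z [-> ->]] [w hw]; apply/quopi_eq0/image_modP; exists w.
- by move=> v /kernelP hv; exists (quopi _ (smk hv)), (smk hv).
Qed.

Section Quotient.
Variables (N : lmodType A) (I : {pred A}) (q : nat) (a : 'I_q -> A).
Hypothesis Ia : forall j, a j \in I.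
Variables (L : lmodType A) (F : free_resolution L) (i n : nat).
Hypotheses (h1 : hexact N F i) (h2 : hexact N F i.+1).

(* The connecting map of [0 -> I^n N -> N -> N / I^n N -> 0]; it is an isomorphism
   because [F (x) N] is exact in the two degrees involved. *)
Lemma quotient_len l :
  has_length (tor F (quotmod (pow_smul N I n)) i.+2) l <->
  len (cyc (torsys F i (rees N Ia)) n) (bnd (torsys F i (rees N Ia)) n) l.
Proof.
rewrite tor_len; set P := pow_smul N I n; pose V := quotmod P.
pose pr p (u : {ffun 'I_p -> N}) : {ffun 'I_p -> V} := fmap (quopi P) u.
have prD p p' (D : 'M[A]_(p, p')) u : pr _ (tensor_mx D u) = tensor_mx D (pr _ u).
  by rewrite /pr tensor_nat.
have pr0 p (u : {ffun 'I_p -> N}) : pr p u = 0 <-> forall k, u k \in P.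
  split=> [h k|h]; first by apply/quopi_eq0; have := congr1 (fun v : {ffun 'I_p -> V} => v k) h; rewrite !ffunE.
  by apply/ffunP => k; rewrite !ffunE; apply/quopi_eq0.
have prS p (v : {ffun 'I_p -> V}) : exists u, pr p u = v by exact/fmap_surj/quopi_surj.
pose R (v : {ffun 'I_(rk F i.+2) -> V}) (c : {ffun 'I_(rk F i.+1) -> rees_ob N I n}) :=
  exists u, v = pr _ u /\ fmap (@sinc A _ _) c = tensor_mx (diff F i.+1) u.
refine (@len_iso A _ _ (torZ V L F i.+1) (torB V L F i.+1) (cyc (torsys F i (rees N Ia)) n)
  (bnd (torsys F i (rees N Ia)) n) R l (torsys_mwf V F i.+1) (gwf_m n (torsys_wf F i (rees N Ia))) _ _ _).
- split=> [|b x y x' y' [u [-> hu]] [u' [-> hu']]|v c [u [-> hu]]|v Zv|v c [u [-> hu]] [w hw]].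
  + by exists 0; rewrite /pr !linear0.
  + by exists (b *: u + u'); rewrite /pr !linearP /= hu hu'.
  + split; last by apply/(torsys_cycE Ia); rewrite hu tensor_diff0.
    rewrite -[torZ _ _ _ _ _]/(tensor_mx (diff F i.+1) (pr _ u) = 0) -prD.
    by apply/pr0 => k; rewrite -hu ffunE; exact: sincP.
  + have [u hu] := prS _ v; have hDu : forall k, tensor_mx (diff F i.+1) u k \in P.
      by apply/pr0; rewrite prD hu.
    by have [c hc] := sinc_ffun hDu; exists c, u.
  + have [w' hw'] := prS _ w; apply/(torsys_bndE Ia).
    exists (u - tensor_mx (diff F i.+2) w'); split.
      by apply/pr0; rewrite /pr linearB /= -/(pr _ u) hw -hw' -prD subrr.
    by rewrite linearB /= tensor_diff0 subr0.
- move=> v c [u [-> hu]] /(torsys_bndE Ia) [e [he hce]].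
  have [w hw] : exists w, u - e = tensor_mx (diff F i.+2) w.
    by apply: h2; rewrite linearB /= -hu -hce subrr.
  exists (pr _ w); rewrite -prD -hw /pr linearB /= -/(pr _ u) -/(pr _ e).
  by rewrite (proj2 (pr0 _ e) he) subr0.
- move=> c /(torsys_cycE Ia) /h1 [u hu]; exists (pr _ u); exists u; by split.
Qed.
End Quotient.

Lemma hilb_tor_degree N (I : idealr A) q (a : 'I_q -> A) (Ia : forall j, a j \in I)
    L (F : free_resolution L) i p : hexact N F i -> hexact N F i.+1 ->
  hilb (torsys F i (rees N Ia)) p -> tor_degree I N L i.+2 ((size p)%:Z - 1).
Proof.
move=> h1 h2 [n0 hn0]; exists F, p; split=> //; exists n0 => n /hn0 [l [hl pl]].
by exists l; split=> //; apply/(quotient_len Ia n h1 h2).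
Qed.

(** [syzygy_res F i] is [F] shifted by [i + 1], so [Tor_1] of the syzygy and [Tor_{i+2}(L, -)] are
    homology of the same matrices. *)
Lemma hilb_tor_degree_syzygy N (I : idealr A) q (a : 'I_q -> A) (Ia : forall j, a j \in I)
    L (F : free_resolution L) i p : hexact N F i -> hexact N F i.+1 ->
  hilb (torsys F i (rees N Ia)) p -> tor_degree I N (syzygy F i.+1) 1 ((size p)%:Z - 1).
Proof.
move=> h1 h2 [n0 hn0]; exists (syzygy_res F i), p; split=> //; exists n0 => n /hn0 [l [hl pl]].
exists l; split=> //; apply/tor_len.
exact: (proj1 (tor_len _ _ _ _) (proj2 (quotient_len Ia n h1 h2 l) hl)).
Qed.
End Comparison.

Lemma finite_nat_bounded (S : set nat) : finite_set S -> exists b, forall i, S i -> (i < b)%N.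
Proof.
move=> /finite_seqP [s ->]; exists (\sum_(x <- s) x).+1 => i /= si.
by rewrite ltnS (big_rem i) //= leq_addr.
Qed.

Theorem mainTheorem7 (A : comNzRingType) (m : idealr A) (d : nat)
  (A_noeth : noetherian A) (A_local : is_local m) (A_gor : gorenstein A)
  (A_nonreg : ~ regular_local m) (A_dim : has_dim A^o d) (d_ge1 : (1 <= d)%N)
  (k_unc : ~ countable [set: {ideal_quot m}])
  (N : lmodType A) (t : nat) (N_fg : fin_gen N) (N_perf : perfect N)
  (N_dim : has_dim N t) (t_ge1 : (1 <= t)%N)
  (I : idealr A) (I_def : ideal_of_definition m N I)
  (M : lmodType A) (M_fg : fin_gen M) (M_mcm : max_cohen_macaulay m M)
  (M_nonfree : ~ is_free M) (M_test : test_module M)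
  (F : free_resolution (residue_module m)) (F_min : minimal_resolution m F) :
  infinite_set [set i : nat | (1 <= i)%N /\
    exists r : int,
      tor_degree I N M i r /\ tor_degree I N (syzygy F d) 1 r].
Proof.
case: d d_ge1 A_dim => // e _ A_dim.
have [_ [g [N_grade [N_pd _]]]] := N_perf.
(* From [g + t <= d = e + 1] and [t >= 1]. *)
have ge : (g <= e)%N.
  have h := grade_lt_dim A_noeth N_grade N_dim A_dim.
  by rewrite -ltnS (leq_trans _ h) // -addn1 leq_add2l.
have hex L (FL : free_resolution L) i : (e <= i)%N -> hexact N FL i.
  by move=> ei; apply: (pd_hexact N_pd); apply: leq_trans ei.
have [_ [l /quot_lenle N_len]] := I_def.
have [q [a [Ia Igen]]] := ideal_gens A_noeth I.
pose W := rees N Ia.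
have okW0 : fgsys W.
  by split; [exact: (@rees_comm A N _ q a Ia)|exact: (rees_fg Ia A_noeth N_fg)].
have nW : noeth (full W) := @rees_noeth A N _ q a Ia Igen A_noeth N_fg.
have W_noeth : tor_in e (@noeth A q) W by move=> L FL i _ _; exact: torsys_noeth.
have W_finlen : tor_in e (@finlen A q) W.
  by move=> L FL i _ ei; apply: (rees_finlen Ia Igen N_len); apply: hex.
have inf bads : exists c, avoids m bads c.
  by have [c hc] := good_avoid (fun=> bads) k_unc; exists c; apply: (hc 0%N).
have Q_embed : exists (Q : lmodType A) (FQ : free_resolution Q) (f : {linear residue_module m -> Q}),
  [/\ injective f, fin_gen Q & forall j, (e <= j)%N -> forall n, cyc (torsys FQ j W) n `<=` bnd (torsys FQ j W) n].
  have [Q [n [nd fQ [FQ hFQ] [f fi]]]] := depth_embedding A_noeth A_local inf A_dim.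
  exists Q, FQ, f; split=> // j ej k c /(torsys_cycE Ia) /(hex _ FQ _ ej) [w hw].
  apply/(torsys_bndE Ia); exists w; split=> // s.
  (* The resolution stops at [n <= e + 1 < j + 2], so [w] has no coordinates and its membership in
     [I^k N] is vacuous. *)
  have rk0 : rk FQ j.+2 = 0%N by apply: hFQ; rewrite (leq_ltn_trans nd).
  by have := leq_trans (ltn_ord s) (eq_leq rk0).
have [FM _] := free_resolution_exists A_noeth M_fg.
have F_fg := residue_fg F.
have hilbW L (FL : free_resolution L) i : fin_gen L -> (e <= i)%N ->
    exists p, hilb (torsys FL i W) p.
  move=> fL ei; apply: hilb_exists; [exact: torsys_wf|exact/torsys_comm/okW0.1| |].
    exact: W_noeth.
  exact: W_finlen.
have [p0 hp0] := hilbW _ F e F_fg (leqnn e).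
have size_le i p : (e <= i)%N -> hilb (torsys FM i W) p -> (size p <= size p0)%N.
  move=> ei hp; apply: (hilb_growth_le hp).
  apply: (tor_in_class A_noeth A_local okW0 W_noeth W_finlen (growth_le_serre A q (size p0)) (leqnn e) _ FM M_fg ei).
  exact: growth_le_hilb hp0 (leqnn _).
move=> /finite_nat_bounded [b hb].
(* Otherwise the Hilbert polynomials of [M] would all have smaller degree than [p0] from [max(e, b)]
   on, the situation excluded by [test_bound]. *)
have [i [p [ei bi hp sp]]] : exists i p, [/\ (e <= i)%N, (b <= i)%N, hilb (torsys FM i W) p & size p = size p0].
  apply: contrapT => hno; pose i1 := maxn e b.
  have strict_size i p : (i1 <= i)%N -> hilb (torsys FM i W) p -> (size p < size p0)%N.
    rewrite geq_max => /andP[ei bi] hp; rewrite ltn_neqAle (size_le i p ei hp) andbT.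
    by apply/eqP => sp; apply: hno; exists i, p.
  have e1 : (e <= i1)%N := leq_maxl e b.
  (* A zero [p0] leaves no room for a strictly smaller size; otherwise [size p0 = s + 1] is growth
     of order [n^s]. *)
  case sp0 : (size p0) => [|s].
    by have [p hp] := hilbW _ FM i1 M_fg e1; have := strict_size i1 p (leqnn _) hp; rewrite sp0.
  have : growth_le s (torsys F e W).
    apply: (test_bound A_noeth A_local k_unc okW0 W_noeth W_finlen M_fg M_test Q_embed e1).
      move=> i i1i; have [p hp] := hilbW _ FM i M_fg (leq_trans e1 i1i).
      by apply: (growth_le_hilb hp); rewrite -ltnS -sp0; apply: strict_size hp.
    by apply: (growth_le_hilb hp0); rewrite sp0.
  by move/(hilb_growth_le hp0); rewrite sp0 ltnn.
(* Index [i] of [torsys] is the homological index [i + 2] for the quotients [N / I^n N]. *)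
have : (i.+2 < b)%N.
  apply: hb; split=> //; exists ((size p)%:Z - 1); split.
    by apply: (hilb_tor_degree (Ia := Ia) _ _ hp); apply: hex => //; apply: leqW.
  rewrite sp; apply: (hilb_tor_degree_syzygy (Ia := Ia) _ _ hp0); apply: hex => //.
by rewrite ltnNge (leq_trans bi) // leqW.
Qed.
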